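(* Let $(M,\mathcal{C})$ be the conformal class of a Riemann-Lorentz space $(M,g)$ with polar end $D^\infty$, and let $\mathcal{D}$ be an (abstract) simultaneity distribution on $M$. Then, after replacing $M$ by a suitable neighbourhood of any given polar point, there exists $\overline g\in\mathcal{C}$ such that $\mathcal{D}=\mathcal{D}_{\overline g}$.
   Context: Riemann-Lorentz space with polar end: $M$ is a smooth manifold of dimension $m\ge 2$, $D^\infty\subset M$ is a nonempty closed subset, and $g$ is a smooth nondegenerate symmetric $(0,2)$-tensor field on $M-D^\infty$. The dual metric $g^*$ on $T^*(M-D^\infty)$ is $g^*(\alpha,\beta)=g(X_\alpha,X_\beta)$, where $g(X_\alpha,\cdot)=\alpha$. It is required that: (D1) $g^*$ extends smoothly to all of $M$ (extension still denoted $g^*$), and for every coframe $(\theta^1,\dots,\theta^m)$ on an open set $U$ meeting $D^\infty$ one has $U\cap D^\infty=\{x\in U:\det(g^*(\theta^a,\theta^b))|_x=0\}$ and $d_x\det(g^*(\theta^a,\theta^b))\neq0$ for all $x\in U\cap D^\infty$ (so $D^\infty$ is a hypersurface and the radical $\mathrm{Rad}_p(g^* )\subset T_p^*M$ is one-dimensional for $p\in D^\infty$); (D2) for every $p\in D^\infty$ the annihilator $\{X\in T_pM:\mu(X)=0\ \forall\mu\in \mathrm{Rad}_p(g^* )\}$ equals $T_pD^\infty$; (RL) every connected component of $M-D^\infty$ is either Riemannian or Lorentzian (one minus sign) for $g$. Points of $D^\infty$ are called polar points. Conformal class: $\mathcal{C}=\{e^{2\sigma}g:\sigma\in C^\infty(M)\}$;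 every member is again a Riemann-Lorentz metric with the same polar end $D^\infty$. Canonical equation $\tau_g$: for each Riemann-Lorentz metric $g$ with polar end $D^\infty$ (that is, each smooth nondegenerate symmetric $(0,2)$-tensor field $g$ on $M-D^\infty$ satisfying (D1), (D2) and (RL)), through each $p\in D^\infty$ there passes a unique (up to reparametrization) smooth pregeodesic $\overline\gamma$ of $g$ crossing $D^\infty$ transversely, and it has a unique smooth parametrization with $\overline\gamma(0)=p$ and $g(\overline\gamma'(s),\overline\gamma'(s))=1/s$ for $s\neq0$. $\tau_g$ is the smooth function near $D^\infty$ with $\tau_g(\overline\gamma(s))=s$ for all these curves; $\tau_g=0$ is an equation for $D^\infty$. The simultaneity distribution $\mathcal{D}_g$ of $g$ is the $(m-1)$-dimensional distribution tangent to the level hypersurfaces $\{\tau_g=t\}$. An (abstract) simultaneity distribution is a smooth completely integrable $(m-1)$-dimensional distribution $\mathcal{D}$ on $M$ such that $D^\infty$ is an integral manifold of $\mathcal{D}$. *)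

(* Defs.v *)
From HB Require Import structures.
From mathcomp Require Import all_boot all_order all_algebra.
From mathcomp Require Import all_classical all_reals all_analysis.

Set Implicit Arguments.
Unset Strict Implicit.
Unset Printing Implicit Defensive.

Import Order.TTheory GRing.Theory Num.Theory.
Import numFieldNormedType.Exports.

Local Open Scope classical_set_scope.
Local Open Scope ring_scope.

Section Smoothness.
Context {R : realType} {V W : normedModType R}.

(* Class C^k on the open set O. The values of f outside O are irrelevant. *)
Fixpoint Ck (k : nat) (O : set V) (f : V -> W) : Prop :=
  if k is k'.+1 then
    (forall x, O x -> differentiable f x) /\
    (forall v : V, Ck k' O (fun x => 'D_v f x))
  else forall x, O x -> {for x, continuous f}.

Definition smooth_on (O : set V) (f : V -> W) : Prop := forall k, Ck k O f.

End Smoothness.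

(* Both maps of a chart are total; only their restrictions to the domain and
   to its image matter. *)
Record chart (R : realType) (M : topologicalType) (m : nat) := Chart {
  cdom : set M;
  cfun :> M -> 'rV[R]_m;
  cinv : 'rV[R]_m -> M;
  cdom_open : open cdom;
  cimg_open : open (cfun @` cdom);
  cfunK : forall x, cdom x -> cinv (cfun x) = x;
  cfun_cont : {within cdom, continuous cfun};
  cinv_cont : {within cfun @` cdom, continuous cinv} }.

Section Manifold.
Context {R : realType} {M : topologicalType} {m : nat}.
Local Notation chart := (chart R M m).

Definition cimage (c : chart) (U : set M) : set 'rV[R]_m :=
  c @` (U `&` cdom c).

Definition compatible (c c' : chart) : Prop :=
  smooth_on (cimage c (cdom c')) (c' \o cinv c) /\
  smooth_on (cimage c' (cdom c)) (c \o cinv c').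

Record smooth_manifold (A : set chart) : Prop := SmoothManifold {
  manifold_hausdorff : hausdorff_space M;
  manifold_countable : second_countable (T := M);
  atlas_cover : forall x, exists2 c, A c & cdom c x;
  atlas_compatible : forall c c', A c -> A c' -> compatible c c';
  atlas_maximal : forall c, (forall c', A c' -> compatible c c') -> A c }.

(* Tangent vectors and covectors at x are given by their components in the
   charts around x, written as row vectors. Passing from c to c', with
   J := transition c c' x, the components v of a vector become v *m J, and those
   of a covector satisfy alpha = alpha' *m J^T. Fields of tensors and of
   subspaces are families indexed by charts and points; their values are
   relevant only for charts of the atlas and points of the chart domain. *)
Definition transition (c c' : chart) (x : M) : 'M[R]_m :=
  jacobian (c' \o cinv c) (c x).

Variable A : set chart.

Definition smooth_fun (U : set M) (f : M -> R) : Prop :=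
  forall c, A c -> smooth_on (cimage c U) (f \o cinv c).

Definition smooth_components (U : set M) (T : chart -> M -> 'M[R]_m) : Prop :=
  forall c, A c -> forall i j,
    smooth_on (cimage c U) (fun y => T c (cinv c y) i j).

Definition covariant2 (U : set M) (g : chart -> M -> 'M[R]_m) : Prop :=
  forall c c' x, A c -> A c' -> U x -> cdom c x -> cdom c' x ->
    g c x = transition c c' x *m g c' x *m (transition c c' x)^T.

Definition contravariant2 (U : set M) (h : chart -> M -> 'M[R]_m) : Prop :=
  forall c c' x, A c -> A c' -> U x -> cdom c x -> cdom c' x ->
    h c' x = (transition c c' x)^T *m h c x *m transition c c' x.

(* Row a of th c x holds the components in c of the covector th^a at x. *)
Record coframe (U : set M) (th : chart -> M -> 'M[R]_m) : Prop := Coframe {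
  coframe_transform : forall c c' x, A c -> A c' -> U x -> cdom c x ->
    cdom c' x -> th c x = th c' x *m (transition c c' x)^T;
  coframe_smooth : smooth_components U th;
  coframe_free : forall c x, A c -> U x -> cdom c x -> row_free (th c x) }.

Definition smooth_curve (a b : R) (gam : R -> M) : Prop :=
  (forall s, a < s < b -> {for s, continuous gam}) /\
  (forall c, A c ->
    smooth_on [set s | a < s < b /\ cdom c (gam s)] (c \o gam)).

Definition velocity (c : chart) (gam : R -> M) (s : R) : 'rV[R]_m :=
  derive1 (c \o gam) s.

(* Components in c of the vectors tangent at x to the subset S (meant to be an
   embedded submanifold): the velocities at x of the smooth curves in S. *)
Definition tangent (S : set M) (c : chart) (x : M) : set 'rV[R]_m :=
  [set v | exists (e : R) (gam : R -> M),
    [/\ 0 < e, smooth_curve (- e) e gam,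
        (forall s, - e < s < e -> S (gam s)), gam 0 = x
      & velocity c gam 0 = v]].

Record metric_field (U : set M) (g : chart -> M -> 'M[R]_m) : Prop :=
  MetricField {
    metric_transform : covariant2 U g;
    metric_smooth : smooth_components U g;
    metric_sym : forall c x, A c -> U x -> cdom c x -> (g c x)^T = g c x;
    metric_nondeg : forall c x, A c -> U x -> cdom c x -> g c x \in unitmx }.

(* The matrix of g*, where g*(alpha, beta) = g(X, Y) when alpha = g(X, .) and
   beta = g(Y, .). *)
Definition dual_matrix (G H : 'M[R]_m) : Prop :=
  forall X Y : 'rV[R]_m,
    (X *m G) *m H *m (Y *m G)^T = X *m G *m Y^T.

Definition radical (H : 'M[R]_m) : set 'rV[R]_m :=
  [set mu | forall beta : 'rV[R]_m, mu *m H *m beta^T = 0].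

Definition annihilator (S : set 'rV[R]_m) : set 'rV[R]_m :=
  [set X | forall mu, S mu -> mu *m X^T = 0].

Definition riemannian_at (G : 'M[R]_m) : Prop :=
  forall v : 'rV[R]_m, v != 0 -> 0 < (v *m G *m v^T) 0 0.

Definition lorentzian_at (G : 'M[R]_m) : Prop :=
  exists2 P : 'M[R]_m, P \in unitmx &
    P *m G *m P^T = diag_mx (\row_i (if val i == 0%N then -1 else 1)).

Definition everywhere_on (C : set M) (g : chart -> M -> 'M[R]_m)
    (Q : 'M[R]_m -> Prop) : Prop :=
  forall c x, A c -> C x -> cdom c x -> Q (g c x).

Definition coframe_det (h th : chart -> M -> 'M[R]_m) (c : chart) (x : M) : R :=
  \det (th c x *m h c x *m (th c x)^T).

(* gs is the smooth extension to M of the dual metric of g. *)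
Record polar_dual (Dinf : set M) (g gs : chart -> M -> 'M[R]_m) : Prop :=
  PolarDual {
    dual_transform : contravariant2 setT gs;
    dual_smooth : smooth_components setT gs;
    dual_off_end : forall c x, A c -> ~ Dinf x -> cdom c x ->
      dual_matrix (g c x) (gs c x);
    dual_det : forall U th, open U -> U `&` Dinf !=set0 -> coframe U th ->
      forall c x, A c -> U x -> cdom c x ->
        (Dinf x <-> coframe_det gs th c x = 0) /\
        (Dinf x -> exists v,
          'D_v (fun y => coframe_det gs th c (cinv c y)) (c x) != 0);
    dual_radical : forall c p, A c -> Dinf p -> cdom c p ->
      annihilator (radical (gs c p)) = tangent Dinf c p }.

Record riemann_lorentz (Dinf : set M) (g : chart -> M -> 'M[R]_m) : Prop :=
  RiemannLorentz {
    polar_end_nonempty : Dinf !=set0;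
    polar_end_closed : closed Dinf;
    rl_metric : metric_field (~` Dinf) g;
    rl_dual : exists gs, polar_dual Dinf g gs;
    rl_signature : forall x, ~ Dinf x ->
      everywhere_on (connected_component (~` Dinf) x) g riemannian_at \/
      everywhere_on (connected_component (~` Dinf) x) g lorentzian_at }.

(* The class of the restriction of g to the open submanifold U. *)
Definition conformal_class (Dinf U : set M) (g : chart -> M -> 'M[R]_m) :
    set (chart -> M -> 'M[R]_m) :=
  [set gbar | exists2 sigma : M -> R, smooth_fun U sigma &
    forall c x, A c -> U x -> ~ Dinf x -> cdom c x ->
      gbar c x = expR (2 * sigma x) *: g c x].

(* Gamma^k_ij at x in the chart c. *)
Definition christoffel (g : chart -> M -> 'M[R]_m) (c : chart) (x : M)
    (k i j : 'I_m) : R :=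
  let d (a p q : 'I_m) : R :=
    'D_(delta_mx 0 a) (fun y => g c (cinv c y) p q) (c x) in
  \sum_(l < m) 2^-1 * invmx (g c x) k l * (d i j l + d j i l - d l i j).

Definition covariant_acceleration (g : chart -> M -> 'M[R]_m) (c : chart)
    (gam : R -> M) (s : R) : 'rV[R]_m :=
  let v := velocity c gam s in
  derive1 (velocity c gam) s +
  \row_k \sum_(i < m) \sum_(j < m)
    christoffel g c (gam s) k i j * v 0 i * v 0 j.

Definition pregeodesic_at (g : chart -> M -> 'M[R]_m) (gam : R -> M) (s : R) :
    Prop :=
  forall c, A c -> cdom c (gam s) ->
    exists lam : R, covariant_acceleration g c gam s = lam *: velocity c gam s.

(* A pregeodesic of the open submanifold U crossing Dinf transversely at s = 0,
   in the parametrization with g(gam', gam') = 1/s. *)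
Record canonical_curve (Dinf U : set M) (g : chart -> M -> 'M[R]_m) (a b : R)
    (gam : R -> M) : Prop := CanonicalCurve {
  canonical_interval : a < 0 < b;
  canonical_smooth : smooth_curve a b gam;
  canonical_in : forall s, a < s < b -> U (gam s);
  canonical_start : Dinf (gam 0);
  canonical_off_end : forall s, a < s < b -> s != 0 -> ~ Dinf (gam s);
  canonical_transverse : forall c, A c -> cdom c (gam 0) ->
    ~ tangent Dinf c (gam 0) (velocity c gam 0);
  canonical_pregeodesic : forall s, a < s < b -> s != 0 ->
    pregeodesic_at g gam s;
  canonical_norm : forall s c, a < s < b -> s != 0 -> A c -> cdom c (gam s) ->
    (velocity c gam s *m g c (gam s) *m (velocity c gam s)^T) 0 0 = s^-1 }.

(* tau = tau_g on all of U: the last field makes tau unique on U. *)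
Record canonical_equation (Dinf U : set M) (g : chart -> M -> 'M[R]_m)
    (tau : M -> R) : Prop := CanonicalEquation {
  tau_smooth : smooth_fun U tau;
  tau_curve : forall a b gam, canonical_curve Dinf U g a b gam ->
    forall s, a < s < b -> tau (gam s) = s;
  tau_domain : forall x, U x -> exists a b gam s,
    [/\ canonical_curve Dinf U g a b gam, a < s < b & gam s = x] }.

(* A distribution is given by the row spaces of the matrices D c x. *)
Record distribution (D : chart -> M -> 'M[R]_m) : Prop := Distribution {
  distribution_transform : forall c c' x, A c -> A c' -> cdom c x ->
    cdom c' x -> (D c' x == D c x *m transition c c' x)%MS;
  distribution_rank : forall c x, A c -> cdom c x -> \rank (D c x) = m.-1;
  distribution_smooth : forall c x, A c -> cdom c x ->
    exists (V : set M) (B : M -> 'M[R]_(m.-1, m)),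
      [/\ open V, V x, V `<=` cdom c,
          (forall i j, smooth_on (cimage c V) (fun y => B (cinv c y) i j))
        & forall y, V y -> (B y == D c y)%MS] }.

(* Around each point there is a flat chart, in which D is spanned by the first
   m - 1 coordinate vector fields. *)
Definition completely_integrable (D : chart -> M -> 'M[R]_m) : Prop :=
  forall x, exists c, [/\ A c, cdom c x &
    forall y, cdom c y -> (D c y == (pid_mx m.-1 : 'M[R]_m))%MS].

Definition integral_manifold (D : chart -> M -> 'M[R]_m) (S : set M) : Prop :=
  forall c x, A c -> S x -> cdom c x ->
    [set v | (v <= D c x)%MS] = tangent S c x.

Record simultaneity_distribution (Dinf : set M) (D : chart -> M -> 'M[R]_m) :
    Prop := SimultaneityDistribution {
  simultaneity_distr : distribution D;
  simultaneity_integrable : completely_integrable D;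
  simultaneity_end : integral_manifold D Dinf }.

(* D = D_g on U. *)
Definition metric_simultaneity (Dinf U : set M) (g : chart -> M -> 'M[R]_m)
    (D : chart -> M -> 'M[R]_m) : Prop :=
  exists2 tau, canonical_equation Dinf U g tau &
    forall c x, A c -> U x -> cdom c x ->
      [set v | (v <= D c x)%MS] = tangent [set y | U y /\ tau y = tau x] c x.

End Manifold.

(* Main.v *)
(* In a flat chart of D around the polar point p, the end is the hyperplane t =
   t(p), where t is the last coordinate: the zero set of det g* is regular, and
   its tangent spaces are horizontal. There the last row g*(dt, .) vanishes, so
   g*(dt, .) = (t - t(p)) Q by Hadamard's lemma, and Q has a nonzero last entry
   at p because det g* has a simple zero. Let eps be the sign of this entry and
   tau = eps (t - t(p)). Multiplying g by a = eps Q_t, where Q_t is the last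
   entry of Q, makes N = (grad tau) / tau smooth across the end with dtau(N) =
   1, so that g(N, N) = 1 / tau. The equation g*(dtau, dtau) = tau makes the
   integral curves of N pregeodesics, which are parametrized as required.
   Conversely, along any canonical curve with momentum P, the function s
   |P_hor|^2 vanishes at 0 and its derivative is bounded by a multiple of it,
   so P_hor = 0 by Gronwall's lemma and P is a multiple of dtau; then f = tau
   along the curve satisfies f'^2 / f = 1 / s, whence f(s) = s. Thus tau is the
   canonical equation of the metric a g, and its level sets are the leaves t =
   const of D. *)

(* The metric and its Christoffel symbols are singular on the end, so canonical curves cannot be
   studied there through the geodesic equation for the velocity u. The equation is rewritten for the
   momentum P = u G: it then involves only the dual metric H and its derivatives, which are smooth
   across the end. P itself may still blow up at s = 0, but only in the direction of dt, which spans
   the radical of H on the end. The norm 1 / s forces the multiplier - 1 / (2 s) in the pregeodesic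
   equation. This is the origin of the weight in s |P_hor|^2: in its derivative the singular terms
   cancel. The factor a is dictated by the equation to be reached: g*(dtau, dtau) = (t - t(p)) Q_t,
   because eps^2 = 1, and its quotient by a has to be tau. The neighbourhood must contain, with each
   point, an arc of integral curve reaching the end. A ball need not have this property, which is
   why a slab is used. *)
From HB Require Import structures.
Require Import Defs.
From mathcomp Require Import all_boot all_order all_algebra.
From mathcomp Require Import all_classical all_reals all_analysis.
From mathcomp Require Import ring lra.
Import Order.TTheory GRing.Theory Num.Theory.
Import numFieldNormedType.Exports.

Set Implicit Arguments.
Unset Strict Implicit.
Unset Printing Implicit Defensive.

Local Open Scope classical_set_scope.
Local Open Scope ring_scope.

(** * Functions of class C^k *)

(** Unwinds the little-o of [diff_locallyP], so that a candidate differential can be verified by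
    inequalities, as is done for parameter integrals. *)
Lemma differentiable_epsP (R : realType) (V W : normedModType R) (f : V -> W)
    (x : V) (L : {linear V -> W}) : continuous L ->
  (forall e : R, 0 < e -> \forall h \near (0 : V), `|f (h + x) - f x - L h| <= e * `|h|) ->
  differentiable f x /\ 'd f x = L :> (V -> W).
Proof.
move=> cL fL.
have E : f \o shift x = cst (f x) + L +o_ (0 : V) id.
  apply/eqaddoP => e e0; apply: filterS (fL e e0) => h /=.
  by rewrite opprD addrA.
have dE := diff_unique cL E; split=> //.
by apply/diff_locallyP; rewrite dE.
Qed.

Lemma differentiable_eps (R : realType) (V W : normedModType R) (f : V -> W) (x : V) :
  differentiable f x ->
  forall e : R, 0 < e -> \forall h \near (0 : V), `|f (h + x) - f x - 'd f x h| <= e * `|h|.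
Proof.
move=> /diff_locally /eqaddoP E e e0; apply: filterS (E e e0) => h /=.
by rewrite opprD addrA.
Qed.

Lemma differentiable_near (R : realType) (V W : normedModType R) (f g : V -> W) (x : V) :
  {near x, f =1 g} -> differentiable f x -> differentiable g x.
Proof.
move=> fg df; have fgx : f x = g x by exact: nbhs_singleton fg.
apply: (proj1 (differentiable_epsP (L := 'd f x) _ _)); first exact: diff_continuous.
move=> e e0; have fg0 : \forall h \near (0 : V), f (h + x) = g (h + x).
  by move: fg; rewrite (near_shift 0) /=; apply: filterS => h /=; rewrite subr0.
by apply: filterS2 fg0 (differentiable_eps df e0) => h ->; rewrite fgx.
Qed.

Lemma differentiable_mx (R : realType) (V : normedModType R) m n
    (f : V -> 'M[R]_(m, n)) (x : V) :
  (forall i j, differentiable (fun y => f y i j) x) -> differentiable f x.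
Proof.
move=> df.
have -> : f = \sum_i \sum_j (fun y => f y i j *: delta_mx i j).
  apply/funext => y; rewrite fct_sumE [LHS]matrix_sum_delta.
  by apply: eq_bigr => i _; rewrite fct_sumE.
apply: differentiable_sum => i; apply: differentiable_sum => j.
exact: differentiableZl.
Qed.

(** Openness of [O] turns equality on [O] into equality near each of its points, which is what
    derivatives see. It allows a function to be rewritten on its domain only. *)
Lemma Ck_ext (R : realType) (V W : normedModType R) k (O : set V) (f g : V -> W) :
  open O -> (forall x, O x -> f x = g x) -> Ck k O f -> Ck k O g.
Proof.
move=> oO; elim: k f g => [|k IH] f g fg /=.
  move=> cf x Ox; have fx : f @ x --> f x := cf x Ox.
  have nfg : {near nbhs x, f =1 g}.
    by near=> y; apply: fg; near: y; exact: open_nbhs_nbhs.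
  change (g @ x --> g x); rewrite -(fg x Ox).
  by apply: cvg_trans fx; exact: near_eq_cvg.
move=> [df Df]; split=> [x Ox|v].
  have nfg : {near nbhs x, f =1 g}.
    by near=> y; apply: fg; near: y; exact: open_nbhs_nbhs.
  exact: differentiable_near nfg (df x Ox).
apply: IH (Df v) => x Ox; apply: near_eq_derive.
by near=> y; apply: fg; near: y; exact: open_nbhs_nbhs.
Unshelve. all: by end_near. Qed.

Lemma Ck_sub (R : realType) (V W : normedModType R) k (O O' : set V) (f : V -> W) :
  O' `<=` O -> Ck k O f -> Ck k O' f.
Proof.
move=> sO; elim: k f => [|k IH] f /=; first by move=> h x /sO; exact: h.
by move=> [df Df]; split=> [x /sO|v]; [exact: df|exact/IH/Df].
Qed.

Lemma CkW (R : realType) (V W : normedModType R) k (O : set V) (f : V -> W) :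
  Ck k.+1 O f -> Ck k O f.
Proof.
elim: k f => [|k IH] f.
  by move=> [df _] x Ox; exact/differentiable_continuous/df.
by move=> [df Df]; split=> // v; exact/IH/Df.
Qed.

Lemma CkD (R : realType) (V W : normedModType R) k (O : set V) (f g : V -> W) :
  open O -> Ck k O f -> Ck k O g -> Ck k O (fun x => f x + g x).
Proof.
move=> oO; elim: k f g => [|k IH] f g /=.
  by move=> cf cg x Ox; apply: cvgD; [exact: cf|exact: cg].
move=> [df Df] [dg Dg]; split=> [x Ox|v].
  by apply: differentiableD; [exact: df|exact: dg].
apply: (Ck_ext oO _ (IH _ _ (Df v) (Dg v))) => x Ox.
by rewrite deriveD//; apply: diff_derivable; [exact: df|exact: dg].
Qed.

Lemma Ck_cst (R : realType) (V W : normedModType R) k (O : set V) (a : W) :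
  Ck k O (fun _ : V => a).
Proof.
elim: k a => [|k IH] a /=; first by move=> x _; exact: cvg_cst.
split=> [x _|v]; first exact: differentiable_cst.
have -> : (fun x : V => 'D_v (fun=> a : W) x) = fun=> 0 by apply/funext => x; exact: derive_cst.
exact: IH.
Qed.

Lemma CkM (R : realType) (V : normedModType R) k (O : set V) (f g : V -> R) :
  open O -> Ck k O f -> Ck k O g -> Ck k O (fun x => f x * g x).
Proof.
move=> oO; elim: k f g => [|k IH] f g.
  by move=> cf cg x Ox; apply: cvgM; [exact: cf|exact: cg].
move=> Cf Cg; have [[df Df] [dg Dg]] := (Cf, Cg); split=> [x Ox|v].
  by apply: differentiableM; [exact: df|exact: dg].
apply: (Ck_ext oO _ (CkD oO (IH _ _ (CkW Cf) (Dg v)) (IH _ _ (CkW Cg) (Df v)))).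
by move=> x Ox; rewrite deriveM//; apply: diff_derivable; [exact: df|exact: dg].
Qed.

Lemma CkN (R : realType) (V : normedModType R) k (O : set V) (f : V -> R) :
  open O -> Ck k O f -> Ck k O (fun x => - f x).
Proof.
move=> oO Cf; apply: (Ck_ext oO _ (CkM oO (Ck_cst k O (-1 : R)) Cf)) => x _.
by rewrite mulN1r.
Qed.

Lemma CkB (R : realType) (V : normedModType R) k (O : set V) (f g : V -> R) :
  open O -> Ck k O f -> Ck k O g -> Ck k O (fun x => f x - g x).
Proof. by move=> oO Cf Cg; apply: CkD => //; exact: CkN. Qed.

(** The derivative of [1 / f] is [- (1 / f)^2 Df]; its factors [1 / f] are covered by the induction
    hypothesis one order lower. *)
Lemma CkV (R : realType) (V : normedModType R) k (O : set V) (f : V -> R) :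
  open O -> (forall x, O x -> f x != 0) -> Ck k O f -> Ck k O (fun x => (f x)^-1).
Proof.
move=> oO f0; elim: k => [|k IH].
  by move=> cf x Ox; apply: cvgV; [exact: f0|exact: cf].
move=> Cf; have [df Df] := Cf; split=> [x Ox|v].
  by apply: differentiableV; [exact: df|exact: f0].
have Ci := IH (CkW Cf).
have C1 := CkM oO (Ck_cst k O (-1 : R)) (CkM oO (CkM oO Ci Ci) (Df v)).
apply: (Ck_ext oO _ C1) => x Ox; rewrite deriveV ?f0//; last exact/diff_derivable/df.
by rewrite mulN1r /GRing.scale/= expr2 invfM mulNr.
Qed.

Lemma Ck_sum (R : realType) (V W : normedModType R) k (O : set V) (I : Type)
    (r : seq I) (P : pred I) (f : I -> V -> W) : open O ->
  (forall i, Ck k O (f i)) -> Ck k O (fun x => \sum_(i <- r | P i) f i x).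
Proof.
move=> oO Cf; elim: r => [|i r IH].
  by under [X in Ck _ _ X]eq_fun do rewrite big_nil; exact: Ck_cst.
under [X in Ck _ _ X]eq_fun do rewrite big_cons.
by case: (P i) => //; exact: CkD.
Qed.

Lemma Ck_prod (R : realType) (V : normedModType R) k (O : set V) (I : Type)
    (r : seq I) (P : pred I) (f : I -> V -> R) : open O ->
  (forall i, Ck k O (f i)) -> Ck k O (fun x => \prod_(i <- r | P i) f i x).
Proof.
move=> oO Cf; elim: r => [|i r IH].
  by under [X in Ck _ _ X]eq_fun do rewrite big_nil; exact: Ck_cst.
under [X in Ck _ _ X]eq_fun do rewrite big_cons.
by case: (P i) => //; exact: CkM.
Qed.

Lemma derive_coord (R : realType) (V : normedModType R) m n
    (f : V -> 'M[R]_(m, n)) (x v : V) i j : derivable f x v ->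
  'D_v f x i j = 'D_v (fun y => f y i j) x.
Proof. by move=> df; rewrite derive_mx// mxE. Qed.

Lemma continuous_mxP (R : realType) (V : normedModType R) m n (f : V -> 'M[R]_(m, n)) (x : V) :
  {for x, continuous f} <-> forall i j, {for x, continuous (fun y => f y i j)}.
Proof.
split=> [cf i j|cf].
  have cij := @coord_continuous _ m n i j (f x).
  exact: (continuous_comp cf cij).
apply/cvgrPdist_le => /= e e0; near=> y.
rewrite /Num.Def.normr/= mx_normrE (bigmax_le _ (ltW e0))//= => i _.
rewrite !mxE/=; move: i; near: y; apply: filter_forall => /= i.
exact: ((cvgrPdist_le _ _).1 (cf i.1 i.2)).
Unshelve. all: by end_near. Qed.

Lemma Ck_mxP (R : realType) (V : normedModType R) k m n (O : set V)
    (f : V -> 'M[R]_(m, n)) : open O ->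
  Ck k O f <-> forall i j, Ck k O (fun y => f y i j).
Proof.
move=> oO; elim: k f => [|k IH] f; split.
- by move=> cf i j x Ox; exact: (continuous_mxP f x).1 (cf x Ox) i j.
- by move=> cf x Ox; apply/continuous_mxP => i j; exact: cf.
- move=> [df Df] i j; split=> [x Ox|v].
    exact: (differentiable_comp (df x Ox) (differentiable_coord (f x) i j)).
  apply: (Ck_ext oO _ ((IH _).1 (Df v) i j)) => x Ox.
  by rewrite derive_coord//; exact/diff_derivable/df.
- move=> Cf.
  have df x : O x -> differentiable f x.
    by move=> Ox; apply: differentiable_mx => i j; exact: (Cf i j).1.
  split=> // v; apply/IH => i j; apply: (Ck_ext oO _ ((Cf i j).2 v)) => x Ox.
  by rewrite derive_coord//; exact/diff_derivable/df.
Qed.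

Lemma Ck_id (R : realType) (V : normedModType R) k (O : set V) : Ck k O (fun x => x).
Proof.
case: k => [|k]; first by move=> x _; exact: cvg_id.
split=> [x _|v]; first exact: ex_diff.
have -> : (fun x : V => 'D_v (fun y : V => y) x) = fun=> v.
  by apply/funext => x; exact: derive_id.
exact: Ck_cst.
Qed.

Lemma Ck_coord (R : realType) k (m n : nat) (O : set 'M[R]_(m, n)) i j :
  open O -> Ck k O (fun y : 'M[R]_(m, n) => y i j).
Proof. by move=> oO; exact: (Ck_mxP _ _ oO).1 (Ck_id _ _) i j. Qed.

Lemma derive_comp_rV (R : realType) (V : normedModType R) m
    (g : V -> 'rV[R]_m) (f : 'rV[R]_m -> R) (x v : V) :
  differentiable g x -> differentiable f (g x) ->
  'D_v (f \o g) x = \sum_i 'D_v (fun y => g y 0 i) x * 'D_(delta_mx 0 i) f (g x).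
Proof.
move=> dg df; rewrite deriveE; last exact: differentiable_comp.
rewrite diff_comp//= -(deriveE v dg) [X in 'd f _ X]row_sum_delta linear_sum.
apply: eq_bigr => i _; rewrite linearZ /= (deriveE _ df).
by rewrite derive_coord//; exact: diff_derivable.
Qed.

(** The chain rule is used in coordinates: the derivative of the composite is a sum of products of
    derivatives of [g] with composites ['D_i f \o g], to which the induction hypothesis applies
    because it is general in [f]. *)
Lemma Ck_comp (R : realType) (V : normedModType R) k m (O : set V)
    (O' : set 'rV[R]_m) (g : V -> 'rV[R]_m) (f : 'rV[R]_m -> R) :
  open O -> (forall x, O x -> O' (g x)) ->
  Ck k O g -> Ck k O' f -> Ck k O (f \o g).
Proof.
move=> oO gO; elim: k f => [|k IH] f.
  by move=> cg cf x Ox; apply: continuous_comp; [exact: cg|exact/cf/gO].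
move=> Cg [df Df]; have [dg Dg] := Cg; split=> [x Ox|v].
  by apply: differentiable_comp; [exact: dg|exact/df/gO].
have oC i : Ck k O ('D_(delta_mx 0 i) f \o g) by exact: (IH _ (CkW Cg) (Df _)).
have Cgi i : Ck k.+1 O (fun y => g y 0 i) by exact: (Ck_mxP _ _ oO).1.
apply: (Ck_ext oO _ (Ck_sum _ _ oO (fun i => CkM oO ((Cgi i).2 v) (oC i)))).
move=> x Ox; rewrite derive_comp_rV//; [exact: dg|exact/df/gO].
Qed.

Lemma Ck_comp_mx (R : realType) (V : normedModType R) k m (a b : nat) (O : set V)
    (O' : set 'rV[R]_m) (g : V -> 'rV[R]_m) (f : 'rV[R]_m -> 'M[R]_(a, b)) :
  open O -> open O' -> (forall x, O x -> O' (g x)) ->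
  Ck k O g -> Ck k O' f -> Ck k O (f \o g).
Proof.
move=> oO oO' gO Cg Cf; apply/(Ck_mxP _ _ oO) => i j.
exact: (Ck_comp oO gO Cg ((Ck_mxP _ _ oO').1 Cf i j)).
Qed.

Lemma Ck_scale_mx (R : realType) (V : normedModType R) k m n (O : set V) (a : V -> R)
    (f : V -> 'M[R]_(m, n)) : open O ->
  Ck k O a -> Ck k O f -> Ck k O (fun x => a x *: f x).
Proof.
move=> oO Ca /(Ck_mxP _ _ oO) Cf; apply/(Ck_mxP _ _ oO) => i j.
under [X in Ck _ _ X]eq_fun do rewrite mxE.
exact: CkM.
Qed.

Lemma Ck_det (R : realType) (V : normedModType R) k n (O : set V)
    (f : V -> 'M[R]_n) : open O -> Ck k O f -> Ck k O (fun x => \det (f x)).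
Proof.
move=> oO /(Ck_mxP _ _ oO) Cf; rewrite /determinant.
apply: Ck_sum => // s; apply: CkM => //; first exact: Ck_cst.
by apply: Ck_prod.
Qed.

Lemma Ck_ln (R : realType) (V : normedModType R) k (O : set V) (f : V -> R) :
  open O -> (forall x, O x -> 0 < f x) -> Ck k O f -> Ck k O (fun x => ln (f x)).
Proof.
move=> oO f0; have dl x : O x -> differentiable (@ln R) (f x).
  by move=> /f0 fx0; apply/derivable1_diffP; exact/ex_derive/is_derive1_ln.
case: k => [|k Cf].
  by move=> cf x Ox; apply: (continuous_comp (cf x Ox)); exact: continuous_ln (f0 x Ox).
have [df Df] := Cf; split=> [x Ox|v].
  by apply: (differentiable_comp (df x Ox)); exact: dl.
have fN0 x : O x -> f x != 0 by move=> /f0; rewrite lt0r => /andP[].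
apply: (Ck_ext oO _ (CkM oO (Df v) (CkV oO fN0 (CkW Cf)))) => x Ox.
rewrite [RHS]deriveE; last exact: (differentiable_comp (df x Ox) (dl x Ox)).
rewrite diff_comp//=; [|exact: df|exact: dl].
rewrite (diff1E (dl x Ox)) -deriveE; last exact: df.
rewrite derive1E (derive_val (is_derive := is_derive1_ln (f0 x Ox))).
by [].
Qed.

Lemma Ck0_lipschitz (R : realType) (V W : normedModType R) (f : V -> W) (L : R) :
  (forall x y, `|f x - f y| <= L * `|x - y|) -> Ck 0 setT f.
Proof.
move=> fL x _; apply/cvgrPdist_lt => e e0.
have L1 : 0 < `|L| + 1 by rewrite ltr_wpDl.
apply/nbhs_ballP; exists (e / (`|L| + 1)); first by rewrite /= divr_gt0.
move=> z; rewrite -ball_normE/= ltr_pdivlMr// => xz; apply: le_lt_trans (fL x z) _.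
apply: le_lt_trans xz; rewrite mulrC ler_wpM2l//.
by rewrite (le_trans (ler_norm L))// lerDl.
Qed.

(** * Mean values and integrals over the unit interval *)

Lemma mx_norm_leP (R : realType) m n (A : 'M[R]_(m, n)) (C : R) : 0 <= C ->
  (`|A| <= C) <-> (forall i j, `|A i j| <= C).
Proof.
move=> C0; split=> [AC i j|AC].
  by apply: le_trans AC; rewrite [leRHS]/Num.Def.normr/= mx_normrE; exact: (le_bigmax _ _ (i, j)).
by rewrite /Num.Def.normr/= mx_normrE bigmax_le.
Qed.

Lemma mx_coord_norm (R : realType) m n (A : 'M[R]_(m, n)) i j : `|A i j| <= `|A|.
Proof. by apply: (mx_norm_leP A _).1. Qed.

Lemma is_derive_mx (R : realType) m n (f : R -> 'M[R]_(m, n)) (df : 'M[R]_(m, n)) (s : R) :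
  (forall i j, is_derive s 1 (fun x => f x i j) (df i j)) -> is_derive s 1 f df.
Proof.
move=> H; have dv : derivable f s 1 by apply/derivable_mxP => i j; case: (H i j).
by split=> //; rewrite derive_mx//; apply/matrixP => i j; rewrite mxE; case: (H i j).
Qed.

Lemma is_derive_mx_coord (R : realType) m n (f : R -> 'M[R]_(m, n)) (df : 'M[R]_(m, n)) (s : R) i j :
  is_derive s 1 f df -> is_derive s 1 (fun x => f x i j) (df i j).
Proof. by move=> [dv <-]; split; [exact: (derivable_mxP _ _ _).1|rewrite derive_coord]. Qed.

Lemma is_derive1_continuous (R : realType) (f : R -> R) (s df : R) :
  is_derive s 1 f df -> {for s, continuous f}.
Proof. by move=> [dv _]; apply: differentiable_continuous; exact/derivable1_diffP. Qed.

Lemma mean_value (R : realType) (f df : R -> R) (a b : R) : a <= b ->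
  (forall z, a <= z <= b -> is_derive z 1 f (df z)) ->
  exists2 z, a <= z <= b & f b - f a = df z * (b - a).
Proof.
move=> ab D; have := @MVT_segment R f df a b ab; case.
- by move=> z zab; apply: D; move: zab; rewrite in_itv/= => /andP[/ltW-> /ltW->].
- apply: continuous_in_subspaceT => z; rewrite inE/= in_itv/= => /D.
  exact: is_derive1_continuous.
- by move=> c; rewrite in_itv/= => cab E; exists c.
Qed.

Lemma mean_value_le (R : realType) m n (f df : R -> 'M[R]_(m, n)) (a b C : R) : 0 <= C ->
  (forall z, (a <= z <= b) || (b <= z <= a) -> is_derive z 1 f (df z)) ->
  (forall z, (a <= z <= b) || (b <= z <= a) -> `|df z| <= C) ->
  `|f b - f a| <= C * `|b - a|.
Proof.
move=> C0; wlog ab : a b / a <= b.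
  move=> W D dC; have [ab|/ltW ba] := leP a b; first exact: W.
  by rewrite distrC (distrC b); apply: W => // z; rewrite orbC; [exact: D|exact: dC].
move=> D dC; apply/mx_norm_leP; first by rewrite mulr_ge0.
move=> i j; rewrite !mxE.
have [|z zab ->] := @mean_value R (fun x => f x i j) (fun x => df x i j) a b ab.
  by move=> z zab; apply: is_derive_mx_coord; apply: D; rewrite zab.
rewrite normrM ler_wpM2r//; apply: le_trans (mx_coord_norm _ _ _) _.
by apply: dC; rewrite zab.
Qed.

Lemma mean_value_le1 (R : realType) (f df : R -> R) (a b C : R) : 0 <= C ->
  (forall z, (a <= z <= b) || (b <= z <= a) -> is_derive z 1 f (df z)) ->
  (forall z, (a <= z <= b) || (b <= z <= a) -> `|df z| <= C) ->
  `|f b - f a| <= C * `|b - a|.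
Proof.
move=> C0; wlog ab : a b / a <= b.
  move=> W D dC; have [ab|/ltW ba] := leP a b; first exact: W.
  by rewrite distrC (distrC b); apply: W => // z; rewrite orbC; [exact: D|exact: dC].
move=> D dC.
have [|z zab ->] := @mean_value R f df a b ab.
  by move=> z zab; apply: D; rewrite zab.
by rewrite normrM ler_wpM2r//; apply: dC; rewrite zab.
Qed.

Lemma primitive_within (R : realType) (f : R -> R) (a b : R) : continuous f -> a < b ->
  exists F : R -> R, forall x, a < x < b -> is_derive x 1 F (f x).
Proof.
move=> cf ab; exists (fun x => (\int[@lebesgue_measure R]_(t in `[a, x]) f t)%R) => x /andP[ax xb].
have fi : (@lebesgue_measure R).-integrable `[a, b] (EFin \o f).
  apply: continuous_compact_integrable; first exact: segment_compact.
  exact: continuous_subspaceT.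
have [d e] := @continuous_FTC1_closed R f a x b xb fi ax (cf x).
by split; [exact: d|rewrite -derive1E; exact: e].
Qed.

(** The fundamental theorem gives a primitive on each bounded interval. Once normalized to vanish at
    0, two of them agree where both are defined, so the value at [x] can be taken from any interval
    around 0 that contains [x]. *)
Lemma primitive_exists (R : realType) (f : R -> R) : continuous f ->
  exists F : R -> R, forall x : R, is_derive x 1 F (f x).
Proof.
move=> cf.
have /choice[G Gp] : forall n : nat, exists G : R -> R,
    (forall x : R, - n.+1%:R < x < n.+1%:R -> is_derive x 1 G (f x)) /\ G 0 = 0.
  move=> n; have [|G DG] := @primitive_within R f (- n.+1%:R) n.+1%:R cf.
    by rewrite gtrN.
  exists (fun x => G x - G 0); split; last by rewrite subrr.
  move=> x /DG dG; rewrite -(subr0 (f x)).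
  by apply: is_deriveB.
have GE n p x : `|x| < n.+1%:R -> `|x| < p.+1%:R -> G n x = G p x.
  move=> xn xp.
  have zb z : (0 <= z <= x) || (x <= z <= 0) -> `|z| <= `|x|.
    move=> /orP[/andP[z0 zx]|/andP[xz z0]]; first by rewrite !ger0_norm// (le_trans z0).
    by rewrite !ler0_norm ?lerN2// (le_trans xz).
  have := @mean_value_le1 R (fun z => G n z - G p z) (fun z => f z - f z) 0 x 0 (lexx 0).
  rewrite mul0r normr_le0 (Gp n).2 (Gp p).2 !subr0 subr_eq0 => E; apply/eqP; apply: E.
    move=> z /zb zx; apply: is_deriveB; first by apply: (Gp n).1; rewrite -ltr_norml (le_lt_trans zx).
    by apply: (Gp p).1; rewrite -ltr_norml (le_lt_trans zx).
  by move=> z _; rewrite subrr normr0.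
pose N (x : R) := Num.truncn `|x|.
have NP (x : R) : `|x| < (N x).+1%:R by exact: truncnS_gt.
exists (fun x => G (N x) x) => x.
apply: (@near_eq_is_derive _ _ _ (G (N x))); last by apply: (Gp _).1; rewrite -ltr_norml.
near=> y; apply: GE => //; near: y.
exact: (cvgr_norm_lt x (@cvg_id _ _)).
Unshelve. all: by end_near. Qed.

Definition primitive (R : realType) (f : R -> R) : R -> R :=
  xget (fun _ => 0) [set F | forall x : R, is_derive x 1 F (f x)].

Lemma primitiveP (R : realType) (f : R -> R) (x : R) : continuous f ->
  is_derive x 1 (primitive f) (f x).
Proof.
move=> /primitive_exists[F FP]; rewrite /primitive.
by case: xgetP => [G -> /(_ x)//|/(_ F)].
Qed.

(** The integral over the unit interval. As an increment of a primitive it is accessible to the mean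
    value inequality, from which all its estimates follow. *)
Definition int01 (R : realType) (f : R -> R) : R := primitive f 1 - primitive f 0.

Lemma is_deriveB1 (R : realType) (f g : R -> R) (x df dg : R) :
  is_derive x 1 f df -> is_derive x 1 g dg -> is_derive x 1 (fun y => f y - g y) (df - dg).
Proof. by move=> Df Dg; exact: is_deriveB. Qed.

Lemma is_deriveM1 (R : realType) (f g : R -> R) (x df dg : R) :
  is_derive x 1 f df -> is_derive x 1 g dg ->
  is_derive x 1 (fun y => f y * g y) (f x * dg + g x * df).
Proof. by move=> Df Dg; exact: is_deriveM. Qed.

(** Mean value inequality for [primitive f - F]. With [g = f] it identifies the integral, and with
    [F] a primitive of [g] it compares two integrals. *)
Lemma int01_le (R : realType) (f g F : R -> R) (C : R) : 0 <= C -> continuous f ->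
  (forall x : R, 0 <= x <= 1 -> is_derive x 1 F (g x)) ->
  (forall x : R, 0 <= x <= 1 -> `|f x - g x| <= C) ->
  `|int01 f - (F 1 - F 0)| <= C.
Proof.
move=> C0 cf DF fgC; rewrite /int01.
rewrite (_ : _ - _ - _ = primitive f 1 - F 1 - (primitive f 0 - F 0)); last by ring.
have -> : C = C * `|1 - 0| by rewrite subr0 normr1 mulr1.
have zb (z : R) : (0 <= z <= 1) || (1 <= z <= 0) -> 0 <= z <= 1.
  by case/orP => // /andP[z1 z0]; have := le_trans z1 z0; rewrite ler10.
apply: (@mean_value_le1 R (fun z => primitive f z - F z) (fun z => f z - g z)) => //.
  by move=> z /zb z01; apply: is_deriveB1; [exact: primitiveP|exact: DF].
by move=> z /zb; exact: fgC.
Qed.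

Lemma int01_unique (R : realType) (f F : R -> R) : continuous f ->
  (forall x : R, 0 <= x <= 1 -> is_derive x 1 F (f x)) -> int01 f = F 1 - F 0.
Proof.
move=> cf DF; apply/eqP; rewrite -subr_eq0 -normr_le0.
by apply: (int01_le (g := f)) => // x _; rewrite subrr normr0.
Qed.

Lemma int01_lin (R : realType) (I : Type) (r : seq I) (a : I -> R) (f : I -> R -> R) :
  (forall i, continuous (f i)) ->
  int01 (fun u => \sum_(i <- r) a i * f i u) = \sum_(i <- r) a i * int01 (f i).
Proof.
move=> cf.
have D (x : R) : is_derive x 1 (fun y => \sum_(i <- r) a i * primitive (f i) y)
    (\sum_(i <- r) a i * f i x).
  elim: r => [|i r IH].
    under eq_fun do rewrite big_nil; rewrite big_nil; exact: is_derive_cst.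
  under eq_fun do rewrite big_cons; rewrite big_cons.
  apply: (@is_deriveD _ _ _ (fun y => a i * primitive (f i) y)).
  have := primitiveP x (cf i) => dP.
  by apply: (@is_deriveZ _ _ _ (primitive (f i)) (a i)).
rewrite (int01_unique (F := fun y => \sum_(i <- r) a i * primitive (f i) y)) //.
  by rewrite -sumrB; apply: eq_bigr => i _; rewrite -mulrBr.
elim: r {D} => [|i r IH] x.
  by under eq_fun do rewrite big_nil; exact: cvg_cst.
under eq_fun do rewrite big_cons.
by apply: cvgD; [apply: cvgM; [exact: cvg_cst|exact: cf]|exact: IH].
Qed.

Lemma linear_form_eps (R : realType) m (f : 'rV[R]_m -> R) (x : 'rV[R]_m) (a : 'I_m -> R) :
  (forall e : R, 0 < e ->
     \forall h \near (0 : 'rV[R]_m), `|f (h + x) - f x - \sum_i h 0 i * a i| <= e * `|h|) ->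
  differentiable f x /\ forall v, 'D_v f x = \sum_i v 0 i * a i.
Proof.
pose L (h : 'rV[R]_m) := \sum_i h 0 i * a i.
have Llin : linear L.
  move=> k u v; rewrite /L scaler_sumr -big_split; apply: eq_bigr => i _ /=.
  by rewrite !mxE mulrDl -mulrA.
pose LM := GRing.isLinear.Build _ _ _ _ _ Llin.
pose LL : {linear 'rV[R]_m -> R} := HB.pack L LM.
have cL : continuous LL.
  have C0 : Ck 0 setT LL by apply: (Ck_sum _ _ openT) => i; apply: (CkM openT);
    [exact: (Ck_coord _ _ _ openT)|exact: Ck_cst].
  by move=> v; exact: (C0 v I).
move=> /(differentiable_epsP (L := LL) cL)[df dE]; split=> // v.
by rewrite deriveE// dE.
Qed.

Lemma derive_partials (R : realType) m (f : 'rV[R]_m -> R) (x v : 'rV[R]_m) :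
  differentiable f x -> 'D_v f x = \sum_i v 0 i * 'D_(delta_mx 0 i) f x.
Proof.
move=> df; rewrite deriveE// {1}(row_sum_delta v) linear_sum; apply: eq_bigr => i _.
by rewrite linearZ/= deriveE.
Qed.

Lemma is_derive_line (R : realType) (V : normedModType R) (f : V -> R) (x v : V) (t : R) :
  differentiable f (x + t *: v) ->
  is_derive t 1 (fun s : R => f (x + s *: v)) ('D_v f (x + t *: v)).
Proof.
move=> df.
have dl : is_diff t (fun s : R => x + s *: v) (fun s : R => s *: v).
  have := @is_diffD R R V (fun=> x) (fun s : R => s *: v) (fun=> 0) (fun s : R => s *: v) t.
  by rewrite (_ : (fun=> 0) + _ = fun s : R => s *: v); [apply|apply/funext => s; rewrite /= fctE add0r].
have [dd dE] := dl.
have dc : differentiable (f \o (fun s : R => x + s *: v)) t by exact: differentiable_comp.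
split; first exact/derivable1_diffP.
by rewrite deriveE// diff_comp// dE /= scale1r deriveE.
Qed.

Lemma taylor1_le (R : realType) m (f : 'rV[R]_m -> R) (x w : 'rV[R]_m) (e : R) :
  (forall t, 0 <= t <= 1 -> differentiable f (x + t *: w)) ->
  (forall t i, 0 <= t <= 1 ->
    `|'D_(delta_mx 0 i) f (x + t *: w) - 'D_(delta_mx 0 i) f x| <= e) ->
  `|f (x + w) - f x - \sum_i w 0 i * 'D_(delta_mx 0 i) f x| <= m%:R * e * `|w|.
Proof.
move=> df De.
have [z z01] := mean_value ler01 (fun t ht => is_derive_line (df t ht)).
rewrite scale1r scale0r addr0 subr0 mulr1 => ->.
rewrite derive_partials; last exact: df.
rewrite -sumrB (le_trans (ler_norm_sum _ _ _))//.
apply: (@le_trans _ _ (\sum_(i < m) e * `|w|)); last first.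
  by rewrite sumr_const card_ord -[leLHS]mulr_natl mulrA.
apply: ler_sum => i _; rewrite -mulrBr normrM mulrC; apply: ler_pM => //.
  exact: De.
exact: mx_coord_norm.
Qed.

Lemma lipschitz_of_partials (R : realType) m (f : 'rV[R]_m -> R) (x w : 'rV[R]_m) (C : R) :
  0 <= C ->
  (forall t, 0 <= t <= 1 -> differentiable f (x + t *: w)) ->
  (forall t i, 0 <= t <= 1 -> `|'D_(delta_mx 0 i) f (x + t *: w)| <= C) ->
  `|f (x + w) - f x| <= m%:R * C * `|w|.
Proof.
move=> C0 df De.
have [z z01] := mean_value ler01 (fun t ht => is_derive_line (df t ht)).
rewrite scale1r scale0r addr0 subr0 mulr1 => ->.
rewrite derive_partials; last exact: df.
rewrite (le_trans (ler_norm_sum _ _ _))//.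
apply: (@le_trans _ _ (\sum_(i < m) C * `|w|)); last first.
  by rewrite sumr_const card_ord -[leLHS]mulr_natl mulrA.
apply: ler_sum => i _; rewrite normrM mulrC; apply: ler_pM => //.
  exact: De.
exact: mx_coord_norm.
Qed.

Lemma int01_dist (R : realType) (f g : R -> R) (C : R) : 0 <= C -> continuous f ->
  continuous g -> (forall x : R, 0 <= x <= 1 -> `|f x - g x| <= C) ->
  `|int01 f - int01 g| <= C.
Proof.
move=> C0 cf cg fg; apply: (int01_le (g := g)) => // x _; exact: primitiveP.
Qed.

Lemma int01D (R : realType) (f g : R -> R) : continuous f -> continuous g ->
  int01 (fun u => f u + g u) = int01 f + int01 g.
Proof.
move=> cf cg.
transitivity (primitive f 1 + primitive g 1 - (primitive f 0 + primitive g 0)); last first.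
  by rewrite /int01; ring.
apply: (@int01_unique R _ (fun u => primitive f u + primitive g u)).
- by move=> x; apply: cvgD; [exact: cf|exact: cg].
- move=> x _; apply: is_deriveD; exact: primitiveP.
Qed.

(* Clamping the parameter makes the integrands below continuous on the whole line,
   as the primitive requires, even though f is controlled on a ball only. *)
Definition clamp01 (R : realType) (u : R) : R := Num.max 0 (Num.min 1 u).

Lemma clamp01_in (R : realType) (u : R) : 0 <= clamp01 u <= 1.
Proof. by rewrite /clamp01 le_max lexx/= ge_max ler01/= ge_min lexx. Qed.

Lemma clamp01_id (R : realType) (u : R) : 0 <= u <= 1 -> clamp01 u = u.
Proof. by move=> /andP[u0 u1]; rewrite /clamp01 min_r// max_r. Qed.

Lemma clamp01_continuous (R : realType) : continuous (@clamp01 R).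
Proof.
move=> u; rewrite /clamp01; apply: continuous_max; first exact: cvg_cst.
by apply: continuous_min; [exact: cvg_cst|exact: cvg_id].
Qed.

(* The point dividing in the ratio u : 1 - u the segment from the projection of y
   on the hyperplane of last coordinate c to y. *)
Definition squeeze (R : realType) n (c u : R) (y : 'rV[R]_n.+1) : 'rV[R]_n.+1 :=
  y + ((u - 1) * (y 0 ord_max - c)) *: delta_mx 0 ord_max.

Lemma squeezeE (R : realType) n (c u : R) (y : 'rV[R]_n.+1) i :
  squeeze c u y 0 i = if i == ord_max then c + u * (y 0 i - c) else y 0 i.
Proof.
rewrite /squeeze !mxE eqxx /=; case: eqP => [->|_] /=; first by rewrite mulr1; ring.
by rewrite mulr0 addr0.
Qed.

Lemma squeeze_ball (R : realType) n (u : R) (y0 y : 'rV[R]_n.+1) r :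
  0 <= u <= 1 -> `|y0 - y| < r -> `|y0 - squeeze (y0 0 ord_max) u y| < r.
Proof.
move=> /andP[u0 u1]; apply: le_lt_trans; apply/mx_norm_leP => // i j.
rewrite ord1 2!mxE squeezeE; apply: le_trans (mx_coord_norm _ 0 j).
rewrite !mxE; case: eqP => [->|//].
rewrite (_ : _ - _ = u * (y0 0 ord_max - y 0 ord_max)); last by ring.
by rewrite normrM ger0_norm// ler_piMl.
Qed.

Lemma squeezeD (R : realType) n (c u : R) (h y : 'rV[R]_n.+1) :
  squeeze c u (h + y) = squeeze c u y + squeeze 0 u h.
Proof. by apply/rowP => i; rewrite [RHS]mxE !squeezeE !mxE; case: eqP => _; ring. Qed.

Lemma squeeze0_norm (R : realType) n (u : R) (h : 'rV[R]_n.+1) :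
  0 <= u <= 1 -> `|squeeze 0 u h| <= `|h|.
Proof.
move=> /andP[u0 u1]; apply/mx_norm_leP => // i j; rewrite ord1 squeezeE.
apply: le_trans (mx_coord_norm h 0 j); case: eqP => // _.
by rewrite subr0 add0r normrM ger0_norm// ler_piMl.
Qed.

Lemma squeeze_continuous (R : realType) n (c : R) (y : 'rV[R]_n.+1) :
  continuous (fun u => squeeze c u y).
Proof.
have C0 : Ck 0 setT (fun u : R => squeeze c u y).
  apply: (CkD openT); first exact: Ck_cst.
  apply: (Ck_scale_mx openT); last exact: Ck_cst.
  apply: (CkM openT); last exact: Ck_cst.
  by apply: (CkD openT); [exact: Ck_id|exact: Ck_cst].
by move=> u; exact: (C0 u I).
Qed.

(** Compactness of the unit interval, in its near-covering form, merges the radii of continuity at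
    the points [p u] into a single [d]. The points [x] may leave the curve [p]. *)
Lemma uniform_near_segment (R : realType) (V : normedModType R) (B : set V) (g : V -> R)
    (p : R -> V) (e : R) : continuous p -> open B -> (forall u, 0 <= u <= 1 -> B (p u)) ->
  (forall x, B x -> {for x, continuous g}) -> 0 < e ->
  exists2 d : R, 0 < d & forall u, 0 <= u <= 1 -> forall x, `|p u - x| < d ->
    B x /\ `|g x - g (p u)| <= e.
Proof.
move=> cp oB Bp cg e0.
pose P (d : R) (u : R) := forall x, `|p u - x| < d -> B x /\ `|g x - g (p u)| <= e.
have := (compact_near_coveringP `[(0:R), 1]%classic).1 (@segment_compact R 0 1).
move=> /(_ R (0^'+) P _) [|d /= d0 dP].
  move=> u; rewrite /= in_itv/= => u01; have Bu := Bp u u01.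
  have e2 : 0 < e / 2 by rewrite divr_gt0.
  have cgu : \forall x \near p u, `|g (p u) - g x| < e / 2.
    have : g @ p u --> g (p u) := cg _ Bu.
    by move=> /cvgrPdist_lt/(_ _ e2).
  have : \forall x \near p u, B x /\ `|g (p u) - g x| < e / 2.
    near=> x; split; first by near: x; exact: open_nbhs_nbhs.
    by near: x.
  move=> /nbhs_ballP[d /= d0 dP]; rewrite -ball_normE/= in dP.
  have d2 : 0 < d / 2 by rewrite divr_gt0.
  exists ([set u' | `|p u - p u'| < d / 2], [set k : R | k < d / 2]).
    split => /=; last exact: nbhs_right_lt.
    have : p @ u --> p u := cp u.
    by move=> /cvgrPdist_lt/(_ _ d2).
  move=> [u' k] /= [pu' kd] x xk.
  have [Bx gx] : B x /\ `|g (p u) - g x| < e / 2.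
    apply: dP => /=; rewrite -(subrKA (p u')) (le_lt_trans (ler_normD _ _))//.
    by rewrite [ltRHS]splitr ltrD// (lt_trans xk).
  have [Bu' gu'] : B (p u') /\ `|g (p u) - g (p u')| < e / 2.
    by apply: dP => /=; rewrite (lt_trans pu')// ltr_pdivrMr// ltr_pMr// ltr1n.
  split=> //; rewrite -(subrKA (g (p u))) (le_trans (ler_normD _ _))//.
  by rewrite [leRHS]splitr lerD//; [rewrite distrC ltW|rewrite ltW].
exists (d / 2); first by rewrite divr_gt0.
move=> u u01; apply: (dP (d / 2)); rewrite /ball_/= ?sub0r ?normrN ?gtr0_norm ?divr_gt0//.
  by rewrite ltr_pdivrMr// ltr_pMr// ltr1n.
Unshelve. all: by end_near. Qed.

(** The weight [u ^+ j] makes this family stable under differentiation in [y]: [squeeze] multiplies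
    the last coordinate by [u], so each derivative in that direction brings one more factor [u]. *)
Definition squeezed (R : realType) n (c : R) (j : nat) (f : 'rV[R]_n.+1 -> R)
    (y : 'rV[R]_n.+1) (u : R) : R :=
  clamp01 u ^+ j * f (squeeze c (clamp01 u) y).

Lemma squeezed_continuous (R : realType) n (y0 y : 'rV[R]_n.+1) r j f :
  (forall x, `|y0 - x| < r -> {for x, continuous f}) -> `|y0 - y| < r ->
  continuous (squeezed (y0 0 ord_max) j f y).
Proof.
move=> cf yr u; apply: cvgM.
  have ce : {for clamp01 u, continuous (fun x : R => x ^+ j)} by exact: exprn_continuous.
  exact: (continuous_comp (@clamp01_continuous R u) ce).
have cs : {for u, continuous (fun u => squeeze (y0 0 ord_max) (clamp01 u) y)}.
  have ce := @squeeze_continuous R n (y0 0 ord_max) y (clamp01 u).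
  exact: (continuous_comp (@clamp01_continuous R u) ce).
apply: (continuous_comp cs); apply: cf; apply: squeeze_ball => //; exact: clamp01_in.
Qed.

(** Differentiation under the integral sign: the first-order remainder is at most [e * |h|]
    uniformly in [u], so the bound survives integration. For the last coordinate the correction term
    replaces the weight [j] by [j.+1]. *)
Lemma int01_squeezed_diff (R : realType) n (y0 y : 'rV[R]_n.+1) r j f :
  (forall x, `|y0 - x| < r -> differentiable f x) ->
  (forall i x, `|y0 - x| < r -> {for x, continuous ('D_(delta_mx 0 i) f)}) ->
  `|y0 - y| < r ->
  let I k g z := int01 (squeezed (y0 0 ord_max) k g z) in
  differentiable (I j f) y /\ forall v, 'D_v (I j f) y =
    \sum_i v 0 i * (I j ('D_(delta_mx 0 i) f) y +
      (if i == ord_max then I j.+1 ('D_(delta_mx 0 i) f) y - I j ('D_(delta_mx 0 i) f) y else 0)).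
Proof.
move=> df cDf yr I; set c := y0 0 ord_max.
pose d i := 'D_(delta_mx 0 i) f.
have cf x : `|y0 - x| < r -> {for x, continuous f}.
  by move=> /df; exact: differentiable_continuous.
pose chi i u := squeezed c j (d i) y u +
  (if i == ord_max then squeezed c j.+1 (d i) y u + - 1 * squeezed c j (d i) y u else 0).
have cchi i : continuous (chi i).
  have cd k : continuous (squeezed c k (d i) y) by apply: squeezed_continuous yr => x; exact: cDf.
  move=> u; apply: cvgD; first exact: cd.
  case: eqP => _; last exact: cvg_cst.
  by apply: cvgD; [exact: cd|apply: cvgM; [exact: cvg_cst|exact: cd]].
have Echi i : int01 (chi i) = I j (d i) y +
    (if i == ord_max then I j.+1 (d i) y - I j (d i) y else 0).
  rewrite int01D; first 1 last.
  - by apply: squeezed_continuous yr => x; exact: cDf.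
  - case: eqP => _ u; last exact: cvg_cst.
    apply: cvgD; first by apply: (squeezed_continuous _ yr) => x; exact: cDf.
    by apply: cvgM; [exact: cvg_cst|apply: (squeezed_continuous _ yr) => x; exact: cDf].
  congr (_ + _); case: eqP => _; last first.
    by rewrite (int01_unique (F := fun=> 0)) ?subrr// => x; exact: cvg_cst.
  have cd k : continuous (squeezed c k (d i) y) by apply: squeezed_continuous yr => x; exact: cDf.
  pose ff (b : bool) := if b then squeezed c j.+1 (d i) y else squeezed c j (d i) y.
  pose aa (b : bool) : R := if b then 1 else -1.
  have := @int01_lin R bool [:: true; false] aa ff.
  rewrite !big_cons big_nil /aa /ff addr0 mul1r mulN1r => <-; last by case.
  by congr int01; apply/funext => u; rewrite !big_cons big_nil addr0 mul1r.
under [in X in _ /\ X]eq_forall do under eq_bigr do rewrite -Echi.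
apply: linear_form_eps => e e0.
(* [taylor1_le] multiplies the oscillation of the partial derivatives by the dimension [n.+1]. *)
have e1 : 0 < e / n.+1%:R by rewrite divr_gt0.
have /choice[D DP] : forall i, exists D : R, 0 < D /\ forall u, 0 <= u <= 1 ->
    forall x, `|squeeze c u y - x| < D -> `|y0 - x| < r /\ `|d i x - d i (squeeze c u y)| <= e / n.+1%:R.
  move=> i; have oB : open [set x | `|y0 - x| < r].
    by rewrite (_ : mkset _ = ball y0 r); [exact: ball_open|rewrite -ball_normE].
  have [u u01|x|D D0 DP] := @uniform_near_segment R _ [set x | `|y0 - x| < r] (d i)
    (fun u => squeeze c u y) (e / n.+1%:R) (@squeeze_continuous R n c y) oB _ _ e1.
  - exact: squeeze_ball.
  - exact: cDf.
  - by exists D.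
have nD : \forall h \near (0 : 'rV[R]_n.+1), forall i, `|h| < D i.
  near=> h => i; move: i; near: h; apply: filter_forall => /= i.
  apply/nbhs_ballP; exists (D i); first exact: (DP i).1.
  by move=> z; rewrite -ball_normE/= sub0r normrN.
near=> h.
have hyr : `|y0 - (h + y)| < r.
  rewrite opprD addrA addrAC (le_lt_trans (ler_normB _ _))// -ltrBrDl.
  near: h; apply/nbhs_ballP; exists (r - `|y0 - y|); first by rewrite /= subr_gt0.
  by move=> z; rewrite -ball_normE/= sub0r normrN.
have hD i : `|h| < D i by move: i; near: h.
have -> : \sum_i h 0 i * int01 (chi i) = int01 (fun u => \sum_i h 0 i * chi i u).
  by rewrite int01_lin.
have c1 := squeezed_continuous (j := j) cf hyr.
have c2 := squeezed_continuous (j := j) cf yr.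
have c3 : continuous (fun u => \sum_i h 0 i * chi i u).
  have C0 : Ck 0 setT (fun u => \sum_i h 0 i * chi i u).
    apply: (Ck_sum _ _ openT) => i; apply: (CkM openT); first exact: Ck_cst.
    by move=> u _; exact: cchi.
  by move=> u; exact: (C0 u Logic.I).
rewrite (_ : _ - _ - _ = I j f (h + y) - (I j f y + int01 (fun u => \sum_i h 0 i * chi i u))); last by ring.
rewrite -int01D//; apply: int01_dist => //.
  by rewrite mulr_ge0// ltW.
  by move=> u; apply: cvgD; [exact: c2|exact: c3].
move=> u u01; rewrite /squeezed /chi clamp01_id// squeezeD.
set P := squeeze c u y; set w := squeeze 0 u h.
have nw : `|w| <= `|h| by exact: squeeze0_norm.
have {}PD i t : 0 <= t <= 1 -> `|y0 - (P + t *: w)| < r /\ `|d i (P + t *: w) - d i P| <= e / n.+1%:R.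
  move=> /andP[t0 t1]; apply: (DP i).2 => //.
  rewrite opprD addNKr normrN normrZ ger0_norm//.
  by rewrite (le_lt_trans _ (hD i))// (le_trans _ nw)// ler_piMl.
have E : \sum_i h 0 i * (u ^+ j * d i P + (if i == ord_max then u ^+ j.+1 * d i P + -1 * (u ^+ j * d i P) else 0))
   = u ^+ j * \sum_i w 0 i * d i P.
  rewrite mulr_sumr; apply: eq_bigr => i _; rewrite /w squeezeE; case: eqP => _; last by ring.
  by rewrite exprS; ring.
under eq_bigr do rewrite /squeezed clamp01_id//.
rewrite E -mulrDr -mulrBr normrM.
apply: (@le_trans _ _ (1 * `|f (P + w) - (f P + \sum_i w 0 i * d i P)|)).
  have /andP[u0 u1] := u01.
  by rewrite ler_wpM2r// ger0_norm ?exprn_ge0// exprn_ile1.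
rewrite mul1r opprD addrA.
apply: (@le_trans _ _ (n.+1%:R * (e / n.+1%:R) * `|w|)).
  by apply: taylor1_le => t; [move=> t01; exact: df (PD ord0 t t01).1|move=> i t01; exact: (PD i t t01).2].
by rewrite [_ * (e / _)]mulrC divfK ?pnatr_eq0// ler_wpM2l// ltW.
Unshelve. all: by end_near. Qed.

(** * Hadamard's lemma and symmetry of second derivatives *)

Lemma open_norm_ball (R : realType) (V : normedModType R) (y0 : V) (r : R) :
  open [set y | `|y0 - y| < r].
Proof. by rewrite (_ : mkset _ = ball y0 r); [exact: ball_open|rewrite -ball_normE]. Qed.

Lemma Ck_int01_squeezed (R : realType) n (y0 : 'rV[R]_n.+1) r k j f :
  smooth_on [set y | `|y0 - y| < r] f ->
  Ck k [set y | `|y0 - y| < r] (fun y => int01 (squeezed (y0 0 ord_max) j f y)).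
Proof.
have oB := open_norm_ball y0 r.
elim: k j f => [|k IH] j f sf.
  move=> y yB; apply: differentiable_continuous.
  have [||//] := @int01_squeezed_diff R n y0 y r j f _ _ yB.
  - exact: (sf 1%N).1.
  - by move=> i; exact: ((sf 1%N).2 _).
have df y : `|y0 - y| < r -> _ := fun yB => @int01_squeezed_diff R n y0 y r j f (sf 1%N).1
  (fun i => (sf 1%N).2 (delta_mx 0 i)) yB.
split=> [y /df[]//|v].
have sd i : smooth_on [set y | `|y0 - y| < r] ('D_(delta_mx 0 i) f).
  by move=> k'; exact: (sf k'.+1).2.
apply: (Ck_ext oB (f := fun y => \sum_i v 0 i * (int01 (squeezed (y0 0 ord_max) j ('D_(delta_mx 0 i) f) y) +
  (if i == ord_max then int01 (squeezed (y0 0 ord_max) j.+1 ('D_(delta_mx 0 i) f) y) -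
     int01 (squeezed (y0 0 ord_max) j ('D_(delta_mx 0 i) f) y) else 0)))).
  by move=> y /df[_ ->].
apply: Ck_sum => // i; apply: CkM => //; first exact: Ck_cst.
apply: CkD => //; first exact: IH.
case: eqP => _; last exact: Ck_cst.
by apply: CkB => //; exact: IH.
Qed.

(** Since [f] vanishes at the projection of [y] on the hyperplane, [f y] is the integral of its
    derivative along the segment from there to [y], whose velocity is [b] times the last basis
    vector. The quotient is thus the integral of the last partial derivative, which is smooth in
    [y]. *)
Lemma hadamard (R : realType) n (y0 : 'rV[R]_n.+1) r (f : 'rV[R]_n.+1 -> R) :
  smooth_on [set y | `|y0 - y| < r] f ->
  (forall y, `|y0 - y| < r -> y 0 ord_max = y0 0 ord_max -> f y = 0) ->
  exists2 q : 'rV[R]_n.+1 -> R, smooth_on [set y | `|y0 - y| < r] q &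
    forall y, `|y0 - y| < r -> f y = (y 0 ord_max - y0 0 ord_max) * q y.
Proof.
move=> sf f0; set c := y0 0 ord_max; pose d := 'D_(delta_mx 0 ord_max) f.
have sd : smooth_on [set y | `|y0 - y| < r] d by move=> k; exact: (sf k.+1).2.
exists (fun y => int01 (squeezed c 0 d y)); first by move=> k; exact: Ck_int01_squeezed.
move=> y yB; set b := y 0 ord_max - c.
have sq0 u : squeezed c 0 d y u = d (squeeze c (clamp01 u) y) by rewrite /squeezed expr0 mul1r.
have csq : continuous (squeezed c 0 d y) by apply: squeezed_continuous yB; exact: (sd 0%N).
have [b0|b0] := eqVneq b 0.
  by rewrite b0 mul0r f0//; apply/eqP; rewrite -subr_eq0 -/c -/b b0.
pose g (u : R) := b^-1 * f (squeeze c u y).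
have -> : int01 (squeezed c 0 d y) = g 1 - g 0.
  apply: int01_unique => // u u01; rewrite sq0 clamp01_id//.
  have sB : `|y0 - squeeze c u y| < r by exact: squeeze_ball.
  have E (s : R) : squeeze c s y = squeeze c 0 y + s *: (b *: delta_mx 0 ord_max).
    by rewrite /squeeze -addrA scalerA -scalerDl; congr (_ + _ *: _); rewrite -/b; ring.
  have df : differentiable f (squeeze c 0 y + u *: (b *: delta_mx 0 ord_max)).
    by rewrite -E; exact: (sf 1%N).1.
  have dl := is_derive_line df; rewrite -E in dl.
  rewrite /g; under eq_fun do rewrite E.
  have -> : d (squeeze c u y) = b^-1 * 'D_(b *: delta_mx 0 ord_max) f (squeeze c u y).
    rewrite -E in df.
    by rewrite /d !(deriveE _ df) linearZ/= /GRing.scale/= mulKf.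
  exact: (@is_deriveZ _ _ _ (fun s : R => f (squeeze c 0 y + s *: (b *: delta_mx 0 ord_max))) b^-1 u 1).
rewrite /g -mulrBr mulVKf//.
have -> : f (squeeze c 0 y) = 0.
  by apply: f0; [apply: squeeze_ball => //; rewrite lexx ler01|rewrite squeezeE eqxx mul0r addr0].
by rewrite subr0 /squeeze subrr mul0r scale0r addr0.
Qed.

Lemma ler_dist_half (R : realType) (a b z e : R) :
  `|a - z| < e / 2 -> `|b - z| < e / 2 -> `|a - b| <= e.
Proof.
move=> az bz; rewrite -(subrKA z) (le_trans (ler_normD _ _))// [leRHS]splitr lerD ?(ltW az)//.
by rewrite distrC ltW.
Qed.

(** The second difference of [f] over a small parallelogram is, by two applications of the mean
    value theorem, [s * s] times either mixed derivative at some point of it. Continuity of both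
    mixed derivatives brings these points back to [x]. *)
Lemma Ck2_derive_comm (R : realType) (V : normedModType R) (O : set V) (f : V -> R)
    (x u v : V) : open O -> Ck 2 O f -> O x ->
  'D_u ('D_v f) x = 'D_v ('D_u f) x.
Proof.
move=> oO [df Df] Ox.
apply/eqP; rewrite -subr_eq0 -normr_le0; apply/ler_addgt0Pr => e e0; rewrite add0r.
have e2 : 0 < e / 2 by rewrite divr_gt0.
have cw w w' : {for x, continuous ('D_w' ('D_w f))} by exact: ((Df w).2 w').
have near_w w w' : \forall z \near x, `|'D_w' ('D_w f) x - 'D_w' ('D_w f) z| < e / 2.
  have : 'D_w' ('D_w f) @ x --> 'D_w' ('D_w f) x := cw w w'.
  by move=> /cvgrPdist_lt/(_ _ e2).
have : \forall z \near x, [/\ O z, `|'D_u ('D_v f) x - 'D_u ('D_v f) z| < e / 2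
   & `|'D_v ('D_u f) x - 'D_v ('D_u f) z| < e / 2].
  have nO : \forall z \near x, O z by exact: open_nbhs_nbhs.
  by apply: filterS3 nO (near_w v u) (near_w u v) => z; split.
move=> /nbhs_ballP[r /= r0 rP]; rewrite -ball_normE/= in rP.
(* This side length keeps the whole parallelogram in the ball of radius [r]; the 1 avoids division
   by 0 when [u] and [v] vanish. *)
pose s := r / (`|u| + `|v| + 1).
have d0 : 0 < `|u| + `|v| + 1 by rewrite ltr_wpDl ?addr_ge0.
have s0 : 0 < s by rewrite divr_gt0.
have inB a b : 0 <= a <= s -> 0 <= b <= s -> `|x - (x + a *: u + b *: v)| < r.
  move=> /andP[a0 as_] /andP[b0 bs].
  rewrite -addrA opprD addNKr normrN (le_lt_trans (ler_normD _ _))// !normrZ !ger0_norm//.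
  apply: (@le_lt_trans _ _ (s * (`|u| + `|v|))); first by rewrite mulrDr lerD// ler_wpM2r.
  by rewrite /s mulrAC ltr_pdivrMr// ltr_pM2l// ltrDl.
have mixed (w w' : V) : (forall a b, 0 <= a <= s -> 0 <= b <= s -> O (x + a *: w + b *: w')) ->
    exists a b, [/\ 0 <= a <= s, 0 <= b <= s &
    f (x + s *: w + s *: w') - f (x + s *: w) - (f (x + s *: w') - f x)
      = 'D_w' ('D_w f) (x + a *: w + b *: w') * s * s].
  move=> inO.
  have ss : 0 <= s <= s by rewrite lexx ltW.
  have s00 : 0 <= (0:R) <= s by rewrite lexx ltW.
  have dg (a : R) : 0 <= a <= s -> is_derive a 1 (fun a : R => f (x + s *: w' + a *: w) - f (x + a *: w))
      ('D_w f (x + s *: w' + a *: w) - 'D_w f (x + a *: w)).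
    move=> as_; apply: is_deriveB1; apply: is_derive_line; apply: df.
      by rewrite addrAC; exact: inO.
    by have := inO a 0 as_ s00; rewrite scale0r addr0.
  have [a as_ Ea] := mean_value (ltW s0) dg.
  have dh (b : R) : 0 <= b <= s -> is_derive b 1 (fun b : R => 'D_w f (x + a *: w + b *: w'))
     ('D_w' ('D_w f) (x + a *: w + b *: w')).
    by move=> bs; apply: is_derive_line; apply: (Df w).1; exact: inO.
  have [b bs Eb] := mean_value (ltW s0) dh.
  exists a, b; split=> //.
  rewrite !scale0r !addr0 !subr0 in Ea Eb.
  by rewrite -Eb [x + s *: w + s *: w']addrAC [x + a *: w + s *: w']addrAC -Ea.
have [|a [b [ha hb E1]]] := mixed u v.
  by move=> a b ha hb; have [] := rP _ (inB a b ha hb).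
have [|a' [b' [ha' hb' E2]]] := mixed v u.
  by move=> a' b' ha' hb'; rewrite addrAC; have [] := rP _ (inB b' a' hb' ha').
have E : 'D_v ('D_u f) (x + a *: u + b *: v) = 'D_u ('D_v f) (x + a' *: v + b' *: u).
  have sn0 : s != 0 by rewrite gt_eqF.
  have EA : x + s *: v + s *: u = x + s *: u + s *: v by rewrite addrAC.
  rewrite EA in E2; clear -E1 E2 sn0; move: E1 E2.
  move: (f (_ + _ + _)) (f (x + s *: u)) (f (x + s *: v)) (f x) => p1 p2 p3 p4.
  move: ('D_v ('D_u f) _) ('D_u ('D_v f) _) => X Y E1 E2.
  by apply: (mulIf sn0); apply: (mulIf sn0); rewrite -E1 -E2; ring.
have [_ _ H1] := rP _ (inB a b ha hb).
have := rP _ (inB b' a' hb' ha'); rewrite addrAC => -[_ H2 _].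
have {}H1 := eq_ind _ (fun z => `|'D_v ('D_u f) x - z| < e / 2) H1 _ E.
exact: ler_dist_half H2 H1.
Qed.

(** * The lemmas of Gronwall and Picard *)

(** The function [E^2 exp(-2 C t)] has a nonpositive derivative and starts from 0. Only continuity
    is asked at 0, where the equations of the curves are singular. *)
Lemma gronwall_zero (R : realType) (E E' : R -> R) (b C : R) :
  {for 0, continuous E} -> E 0 = 0 ->
  (forall s, 0 < s < b -> is_derive s 1 E (E' s) /\ `|E' s| <= C * `|E s|) ->
  forall s, 0 <= s < b -> E s = 0.
Proof.
move=> cE E0 dE s /andP[]; rewrite le_eqVlt => /predU1P[<-//|s0] sb.
pose h (t : R) := E t * E t * expR (- (2 * C) * t).
have dx (t : R) : is_derive t 1 (fun t : R => expR (- (2 * C) * t)) (expR (- (2 * C) * t) * - (2 * C)).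
  have dl : is_derive t 1 (fun t : R => - (2 * C) * t) (- (2 * C)).
    have := @is_deriveZ _ _ _ (@id R) (- (2 * C)) t 1 1 (is_derive_id t 1).
    by rewrite /GRing.scale/= mulr1.
  exact: (@is_derive1_comp R expR (fun t : R => - (2 * C) * t) t _ _ (is_derive_expR _) dl).
have dh (t : R) : 0 < t < b -> is_derive t 1 h (2 * (E t * E' t - C * (E t * E t)) * expR (- (2 * C) * t)).
  move=> /dE[dEt _]; have H := is_deriveM1 (is_deriveM1 dEt dEt) (dx t).
  by apply: (is_derive_eq H); ring.
have ch : {for 0, continuous h}.
  apply: cvgM; first exact: cvgM.
  exact: is_derive1_continuous (dx 0).
have [t ts] : exists2 t, t \in `]0, s[ & h s - h 0 = 2 * (E t * E' t - C * (E t * E t)) * expR (- (2 * C) * t) * (s - 0).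
  apply: (MVT s0).
    by move=> z; rewrite in_itv/= => /andP[z0 zs]; apply: dh; rewrite z0 (lt_trans zs).
  apply: continuous_in_subspaceT => z; rewrite inE/= in_itv/= => /andP[].
  rewrite le_eqVlt => /predU1P[<- _//|z0] zs.
  by apply: is_derive1_continuous; apply: dh; rewrite z0 (le_lt_trans zs).
move: ts; rewrite in_itv/= => /andP[t0 ts].
rewrite {2}/h E0 !mul0r !subr0 => hs.
have /dE[_ Et] : 0 < t < b by rewrite t0 (lt_trans ts).
have : h s <= 0.
  rewrite hs; apply: mulr_le0_ge0 (ltW s0); apply: mulr_le0_ge0 (expR_ge0 _).
  rewrite pmulr_rle0// subr_le0 (le_trans (ler_norm _))// normrM.
  apply: (@le_trans _ _ (`|E t| * (C * `|E t|))); first by rewrite ler_wpM2l.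
  by rewrite mulrCA -normrM ger0_norm// -expr2 sqr_ge0.
rewrite /h pmulr_lle0 ?expR_gt0// => Es; apply/eqP; rewrite -sqrf_eq0 expr2.
by apply/eqP/le_anti; rewrite Es -expr2 sqr_ge0.
Qed.

Lemma half_pow_lt (R : realType) (C e : R) : 0 < e -> exists n, C * 2^-1 ^+ n < e.
Proof.
move=> e0; pose n := Num.truncn (C / e); exists n.
rewrite exprVn ltr_pdivrMr ?exprn_gt0// mulrC -ltr_pdivrMr//.
apply: lt_le_trans (truncnS_gt _) _; rewrite -natrX ler_nat; exact: ltn_expl.
Qed.

Lemma geometric_limit (R : realType) m (u : nat -> 'rV[R]_m) (C : R) :
  (forall n p, `|u (n + p)%N - u n| <= C * 2^-1 ^+ n) ->
  exists v, forall n, `|v - u n| <= C * 2^-1 ^+ n.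
Proof.
move=> uC.
have /choice[v vP] : forall i, exists v : R, forall n, `|v - u n 0 i| <= C * 2^-1 ^+ n.
  move=> i; pose w n := u n 0 i.
  have wC n p : `|w (n + p)%N - w n| <= C * 2^-1 ^+ n.
    by apply: le_trans (uC n p); apply: le_trans (mx_coord_norm _ 0 i); rewrite !mxE.
  have /cauchy_cvgP cw : cauchy (w @ \oo).
    apply: cauchy_exP => e e0; have [n Cn] := half_pow_lt C e0.
    exists (w n), n => // k /= nk; rewrite -ball_normE/= distrC -(subnKC nk).
    exact: le_lt_trans Cn.
  exists (lim (w @ \oo)) => n; apply/ler_addgt0Pr => e e0.
  move: cw => /cvgrPdist_lt/(_ _ e0)[k _ kP].
  rewrite -(subrKA (w (n + k)%N)) (le_trans (ler_normD _ _))// addrC lerD//.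
  by apply/ltW/kP; rewrite /= leq_addl.
exists (\row_i v i) => n; apply/mx_norm_leP.
  by apply: le_trans (normr_ge0 _) (uC n 0).
by move=> i j; rewrite ord1 !mxE; exact: vP.
Qed.

(** Since [L * T <= 1/2], the distance between successive iterates is halved each time. The global
    bounds on [F] keep the iterates [K]-Lipschitz and defined on the whole line, where [primitive]
    needs continuous integrands. *)
Lemma picard (R : realType) m (F : 'rV[R]_m -> 'rV[R]_m) (L K T s0 : R) (y0 : 'rV[R]_m) :
  0 <= L -> 0 <= K -> 0 < T -> L * T <= 2^-1 ->
  (forall x y, `|F x - F y| <= L * `|x - y|) -> (forall x, `|F x| <= K) ->
  exists y : R -> 'rV[R]_m, y s0 = y0 /\
    forall s, `|s - s0| < T -> is_derive s 1 y (F (y s)).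
Proof.
move=> L0 K0 T0 LT FL FK.
have cF : Ck 0 setT F := Ck0_lipschitz FL.
have cFi (x : R -> 'rV[R]_m) i : Ck 0 setT x -> continuous (fun r => F (x r) 0 i).
  move=> cx r; have C0 : Ck 0 setT (fun r => F (x r) 0 i).
    by apply: (Ck_mxP _ _ openT).1 => z _; apply: continuous_comp; [exact: cx|exact: cF].
  exact: (C0 r I).
pose J (x : R -> 'rV[R]_m) (s : R) : 'rV[R]_m :=
  \row_i (y0 0 i + (primitive (fun r => F (x r) 0 i) s - primitive (fun r => F (x r) 0 i) s0)).
have J0 x : J x s0 = y0 by apply/rowP => i; rewrite mxE subrr addr0.
have dJ x (s : R) : Ck 0 setT x -> is_derive s 1 (J x) (F (x s)).
  move=> cx; apply: is_derive_mx => i j; rewrite ord1.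
  rewrite (_ : (fun z => _) = fun z => primitive (fun r => F (x r) 0 j) z -
     (primitive (fun r => F (x r) 0 j) s0 - y0 0 j)); last first.
    by apply/funext => z; rewrite mxE; ring.
  rewrite -[F (x s) 0 j]subr0; apply: is_deriveB1.
  exact: (primitiveP s (cFi x j cx)).
have KJ x (a b : R) : Ck 0 setT x -> `|J x b - J x a| <= K * `|b - a|.
  by move=> cx; apply: (mean_value_le (df := fun z => F (x z))) => // z _; exact: dJ.
have cJ x : Ck 0 setT x -> Ck 0 setT (J x).
  by move=> cx; apply: (Ck0_lipschitz (L := K)) => a b; exact: KJ.
pose X n := iter n J (fun=> y0).
have cX n : Ck 0 setT (X n) by elim: n => [|n IH]; [exact: Ck_cst|exact: cJ].
have between z s : (s0 <= z <= s) || (s <= z <= s0) -> `|z - s0| <= `|s - s0|.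
  move=> /orP[/andP[z0 zx]|/andP[xz z0]]; first by rewrite !ger0_norm ?subr_ge0 ?lerD2r// (le_trans z0).
  by rewrite !ler0_norm ?subr_le0 ?lerN2 ?lerD2r// (le_trans xz).
have JL x y (C s : R) : 0 <= C -> Ck 0 setT x -> Ck 0 setT y ->
    (forall z, `|z - s0| <= T -> `|x z - y z| <= C) -> `|s - s0| <= T ->
    `|J x s - J y s| <= C / 2.
  move=> C0 cx cy xy sT.
  rewrite (_ : J x s - J y s = J x s - J y s - (J x s0 - J y s0)); last first.
    by rewrite !J0 subrr subr0.
  apply: le_trans (_ : L * C * `|s - s0| <= _).
    apply: (mean_value_le (f := fun z => J x z - J y z) (df := fun z => F (x z) - F (y z))).
    - by rewrite mulr_ge0.
    - by move=> z _; apply: is_deriveB; exact: dJ.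
    - move=> z /between zs; apply: (le_trans (FL _ _)); rewrite ler_wpM2l// xy//.
      exact: le_trans sT.
  rewrite mulrAC mulrC ler_wpM2l//; apply: le_trans LT; exact: ler_wpM2l.
have XS n s : `|s - s0| <= T -> `|X n.+1 s - X n s| <= K * T * 2^-1 ^+ n.
  elim: n s => [|n IH] s sT.
    rewrite expr0 mulr1 /= -{2}(J0 (fun=> y0)).
    by apply: le_trans (KJ _ _ _ _) _; [exact: Ck_cst|exact: ler_wpM2l].
  have KT0 : 0 <= K * T * 2^-1 ^+ n by rewrite mulr_ge0 ?exprn_ge0 ?invr_ge0// mulr_ge0// ltW.
  rewrite exprSr mulrA.
  by apply: (JL (X n.+1) (X n) _ s KT0 (cX _) (cX _) _ sT) => z; exact: IH.
have XSp n p s : `|s - s0| <= T -> `|X (n + p)%N s - X n s| <= 2 * K * T * 2^-1 ^+ n.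
  move=> sT; apply: (@le_trans _ _ (2 * K * T * 2^-1 ^+ n * (1 - 2^-1 ^+ p))).
    elim: p => [|p IH]; first by rewrite addn0 subrr normr0 expr0 subrr mulr0.
    rewrite addnS -(subrKA (X (n + p)%N s)) (le_trans (ler_normD _ _))//.
    apply: le_trans (lerD (XS _ _ sT) IH) _.
    by rewrite exprD exprS le_eqVlt; apply/orP; left; apply/eqP; field.
  by rewrite ler_piMr// ?mulr_ge0// ?exprn_ge0 ?invr_ge0 ?ltW// gerBl exprn_ge0.
have [x xP] : exists x : R -> 'rV[R]_m, forall s, `|s - s0| <= T ->
    forall n, `|x s - X n s| <= 2 * K * T * 2^-1 ^+ n.
  have /choice[x xP] : forall s, exists v, `|s - s0| <= T ->
      forall n, `|v - X n s| <= 2 * K * T * 2^-1 ^+ n.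
    move=> s; have [sT|sT] := boolP (`|s - s0| <= T); last by exists 0.
    have [v vP] := geometric_limit (fun n p => XSp n p s sT).
    by exists v.
  by exists x.
have C0 : 0 <= 2 * K * T by rewrite !mulr_ge0// ltW.
have XK n a b : `|X n b - X n a| <= K * `|b - a|.
  by case: n => [|n]; [rewrite subrr normr0 mulr_ge0|exact: KJ].
have xK a b : `|a - s0| <= T -> `|b - s0| <= T -> `|x a - x b| <= K * `|a - b|.
  move=> aT bT; apply/ler_addgt0Pr => e e0.
  have [n Cn] := @half_pow_lt R (2 * K * T) (e / 2) (divr_gt0 e0 (ltr0Sn R 1)).
  rewrite (_ : x a - x b = x a - X n a - (x b - X n b) + (X n a - X n b)); last first.
    by apply/rowP => i; rewrite !mxE; ring.
  rewrite (le_trans (ler_normD _ _))// addrC lerD//.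
  rewrite (le_trans (ler_normB _ _))// [leRHS]splitr lerD//.
    by rewrite (le_trans (xP _ aT n))// ltW.
  by rewrite (le_trans (xP _ bT n))// ltW.
(* The limit [x] is controlled only for [|s - s0| <= T]; composing it with the clamp [cl] gives a
   function continuous on the whole line. *)
pose cl (s : R) := Num.max (s0 - T) (Num.min (s0 + T) s).
have clE s : [\/ s0 - T <= s <= s0 + T /\ cl s = s, s < s0 - T /\ cl s = s0 - T
   | s0 + T < s /\ cl s = s0 + T].
  rewrite /cl; have [h1|h1] := leP s (s0 + T); last first.
    by constructor 3; split=> //; apply: max_r; rewrite -subr_ge0; lra.
  have [h2|h2] := leP (s0 - T) s; first by constructor 1.
  by constructor 2.
have clin s : `|cl s - s0| <= T.
  by rewrite ler_norml; case: (clE s) => -[h ->]; lra.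
have clid s : `|s - s0| <= T -> cl s = s.
  by rewrite ler_norml; case: (clE s) => -[h ->] //; lra.
have cll a b : `|cl a - cl b| <= `|a - b|.
  have n1 := ler_norm (a - b); have n2 := ler_normr (a - b); rewrite ler_norml.
  have {}n2 := ler_norm (- (a - b)); rewrite normrN in n2.
  by case: (clE a) => -[ha ->]; case: (clE b) => -[hb ->]; lra.
pose xh s := x (cl s).
have cxh : Ck 0 setT xh.
  apply: (Ck0_lipschitz (L := K)) => a b; apply: le_trans (xK _ _ _ _) _ => //.
  exact: ler_wpM2l.
have xE s : `|s - s0| <= T -> J xh s = x s.
  move=> sT; apply/eqP; rewrite -subr_eq0 -normr_le0; apply/ler_addgt0Pr => e e0.
  have [n Cn] := @half_pow_lt R (2 * K * T) e e0.
  rewrite add0r -(subrKA (X n.+1 s)) (le_trans (ler_normD _ _))//.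
  have Cn0 : 0 <= 2 * K * T * 2^-1 ^+ n by rewrite mulr_ge0// exprn_ge0// invr_ge0.
  have h1 : `|J xh s - X n.+1 s| <= 2 * K * T * 2^-1 ^+ n / 2.
    by apply: JL => // z zT; rewrite /xh clid//; exact: xP.
  have h2 := xP s sT n.+1; rewrite exprSr mulrA in h2.
  by rewrite distrC in h2; move: h1 h2 Cn0 (ltW Cn); lra.
(* The solution is [J xh] rather than [x]: it is differentiable by construction and coincides with
   [x] on the interval. *)
exists (J xh); split=> // s sT.
have {1}-> : J xh s = xh s by rewrite xE ?ltW// /xh clid// ltW.
exact: dJ.
Qed.

(** Applied to each coordinate it is a 1-Lipschitz retraction on a closed ball of the maximum norm,
    which extends a field given on that ball to a global Lipschitz one. *)
Definition clampr (R : realType) (c r s : R) : R := Num.max (c - r) (Num.min (c + r) s).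

Lemma clamprP (R : realType) (c r s : R) : 0 <= r ->
  [\/ c - r <= s <= c + r /\ clampr c r s = s, s < c - r /\ clampr c r s = c - r
    | c + r < s /\ clampr c r s = c + r].
Proof.
move=> r0; rewrite /clampr; have [h1|h1] := leP s (c + r); last first.
  by constructor 3; split=> //; apply: max_r; lra.
have [h2|h2] := leP (c - r) s; first by constructor 1.
by constructor 2.
Qed.

Lemma clampr_in (R : realType) (c r s : R) : 0 <= r -> `|clampr c r s - c| <= r.
Proof. by move=> r0; rewrite ler_norml; case: (clamprP c s r0) => -[h ->]; lra. Qed.

Lemma clampr_id (R : realType) (c r s : R) : `|s - c| <= r -> clampr c r s = s.
Proof.
move=> sr; have r0 := le_trans (normr_ge0 _) sr.
by move: sr; rewrite ler_norml; case: (clamprP c s r0) => -[h ->] //; lra.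
Qed.

Lemma clampr_lip (R : realType) (c r a b : R) : 0 <= r ->
  `|clampr c r a - clampr c r b| <= `|a - b|.
Proof.
move=> r0; have n1 := ler_norm (a - b); have n2 := ler_norm (- (a - b)).
rewrite normrN in n2; rewrite ler_norml.
by case: (clamprP c a r0) => -[ha ->]; case: (clamprP c b r0) => -[hb ->]; lra.
Qed.

Lemma partials_lipschitz_near (R : realType) m (O : set 'rV[R]_m) (f : 'rV[R]_m -> R)
    (y0 : 'rV[R]_m) : open O -> Ck 1 O f -> O y0 ->
  exists r L : R, [/\ 0 < r, 0 <= L, forall y, `|y0 - y| <= r -> O y &
    forall x y, `|y0 - x| <= r -> `|y0 - y| <= r -> `|f x - f y| <= L * `|x - y|].
Proof.
move=> oO [df Df] Oy0.
pose C i := `|'D_(delta_mx 0 i) f y0| + 1.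
have nC : \forall y \near y0, forall i, `|'D_(delta_mx 0 i) f y| < C i.
  near=> y => i; move: i; near: y; apply: filter_forall => /= i.
  have : 'D_(delta_mx 0 i) f @ y0 --> 'D_(delta_mx 0 i) f y0 := Df _ y0 Oy0.
  by move=> /(@cvgr_norm_lt _ _ _ _ _ _)/(_ (C i)); apply; rewrite ltrDl.
have nO : \forall y \near y0, O y by exact: open_nbhs_nbhs.
have : \forall y \near y0, (forall i, `|'D_(delta_mx 0 i) f y| < C i) /\ O y by exact: filterI.
move=> /nbhs_ballP[r /= r0 rP]; rewrite -ball_normE/= in rP.
exists (r / 2), (m%:R * \sum_i C i).
have C0 i : 0 <= C i by rewrite addr_ge0.
have rr y : `|y0 - y| <= r / 2 -> `|y0 - y| < r.
  by move=> /le_lt_trans; apply; rewrite ltr_pdivrMr// ltr_pMr// ltr1n.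
split; rewrite ?divr_gt0 ?mulr_ge0 ?sumr_ge0//; first by move=> y /rr/rP[].
move=> x y hx hy; have -> : x = y + (x - y) by rewrite addrC subrK.
rewrite [y + _ - y]addrC addKr; set w := x - y.
have ball t : 0 <= t <= 1 -> `|y0 - (y + t *: w)| <= r / 2.
  move=> /andP[t0 t1].
  rewrite (_ : y0 - _ = t *: (y0 - x) + (1 - t) *: (y0 - y)); last first.
    by apply/matrixP => i j; rewrite /w !mxE; ring.
  rewrite (le_trans (ler_normD _ _))// !normrZ !ger0_norm ?subr_ge0//.
  have -> : r / 2 = t * (r / 2) + (1 - t) * (r / 2) by ring.
  by rewrite lerD// ler_wpM2l// subr_ge0.
apply: lipschitz_of_partials.
- by rewrite sumr_ge0.
- by move=> t /ball/rr/rP[_ /df].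
- move=> t i /ball/rr/rP[/(_ i) /ltW h _]; apply: le_trans h _.
  by rewrite (bigD1 i)//= lerDl sumr_ge0.
Unshelve. all: by end_near. Qed.

Lemma gronwall_two_sided (R : realType) (E E' : R -> R) (a b C : R) : a < 0 < b ->
  {for 0, continuous E} -> E 0 = 0 ->
  (forall s, a < s < b -> s != 0 -> is_derive s 1 E (E' s) /\ `|E' s| <= C * `|E s|) ->
  forall s, a < s < b -> E s = 0.
Proof.
move=> /andP[a0 b0] cE E0 dE s /andP[as_ sb]; have [s0|s0] := leP 0 s.
  apply: (gronwall_zero (b := b) (E' := E') (C := C) cE E0); last by rewrite s0.
  by move=> z /andP[z0 zb]; apply: dE; [rewrite (lt_trans a0)|rewrite gt_eqF].
have -> : E s = E (- (- s)) by rewrite opprK.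
apply: (@gronwall_zero R (fun z => E (- z)) (fun z => - E' (- z)) (- a) C).
- have cN : {for 0, continuous (fun z : R => - z)} by apply: continuousN; exact: cvg_id.
  by apply: (continuous_comp cN); rewrite oppr0.
- by rewrite oppr0.
- move=> z /andP[z0 za]; have nz : - z != 0 by rewrite oppr_eq0 gt_eqF.
  have zab : a < - z < b by rewrite ltrNr za (lt_trans _ b0)// oppr_lt0.
  have [dz Ez] := dE _ zab nz; split; last by rewrite normrN.
  have dN : is_derive z 1 (fun z : R => - z) (- 1) by exact: is_deriveNid.
  by have := @is_derive1_comp R E (fun z => - z) z _ _ dz dN; rewrite mulrN1.
- by rewrite oppr_ge0 (ltW s0) ltrN2.
Qed.

Lemma bounded_on_segment (R : realType) m n (f : R -> 'M[R]_(m, n)) (a b : R) : a <= b ->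
  (forall s, a <= s <= b -> {for s, continuous f}) ->
  exists2 C, 0 <= C & forall s, a <= s <= b -> `|f s| <= C.
Proof.
move=> ab cf.
have [|c _ cP] := @EVT_max R (fun s => `|f s|) a b ab.
  apply: continuous_in_subspaceT => s; rewrite inE/= in_itv/= => /cf cs.
  by apply: (continuous_comp cs); exact: norm_continuous.
exists `|f c| => // s sab; apply: cP; by rewrite in_itv.
Qed.

(** * Norms and derivatives of matrix products and composites *)

Lemma mulmx_norm_le (R : realType) m n p (A : 'M[R]_(m, n)) (B : 'M[R]_(n, p)) :
  `|A *m B| <= n%:R * `|A| * `|B|.
Proof.
apply/mx_norm_leP; first by rewrite !mulr_ge0.
move=> i j; rewrite mxE (le_trans (ler_norm_sum _ _ _))//.
apply: (@le_trans _ _ (\sum_(k < n) `|A| * `|B|)); last first.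
  by rewrite sumr_const card_ord -[leLHS]mulr_natl mulrA.
by apply: ler_sum => k _; rewrite normrM ler_pM// mx_coord_norm.
Qed.

Lemma is_derive_mxP (R : realType) (V : normedModType R) m n (f : V -> 'M[R]_(m, n))
    (df : 'M[R]_(m, n)) (x v : V) :
  (forall i j, is_derive x v (fun y => f y i j) (df i j)) <-> is_derive x v f df.
Proof.
split=> [H|[dv <-] i j].
  have dv : derivable f x v by apply/derivable_mxP => i j; case: (H i j).
  by split=> //; rewrite derive_mx//; apply/matrixP => i j; rewrite mxE; case: (H i j).
by split; [exact: (derivable_mxP _ _ _).1|rewrite derive_coord].
Qed.

Lemma is_derive_sum1 (R : realType) (V W : normedModType R) m (h : 'I_m -> V -> W)
    (dh : 'I_m -> W) (x v : V) : (forall i, is_derive x v (h i) (dh i)) ->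
  is_derive x v (fun y => \sum_i h i y) (\sum_i dh i).
Proof.
move=> H; have := is_derive_sum (h := h) (dh := dh) (x := x) (v := v).
rewrite (_ : \sum_(i < m) h i = fun y => \sum_i h i y); first exact.
by apply/funext => y; rewrite fct_sumE.
Qed.

Lemma is_derive_mulmx (R : realType) (V : normedModType R) m n p (f : V -> 'M[R]_(m, n))
    (g : V -> 'M[R]_(n, p)) df dg (x v : V) :
  is_derive x v f df -> is_derive x v g dg ->
  is_derive x v (fun y => f y *m g y) (df *m g x + f x *m dg).
Proof.
move=> /is_derive_mxP Df /is_derive_mxP Dg; apply/is_derive_mxP => i j.
rewrite !mxE -big_split /=; under eq_fun do rewrite mxE.
apply: is_derive_sum1 => k.
have H := @is_deriveM _ _ (fun y => f y i k) (fun y => g y k j) x v _ _ (Df i k) (Dg k j).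
by apply: (is_derive_eq H); rewrite /GRing.scale/=; ring.
Qed.

Lemma is_derive_tr (R : realType) (V : normedModType R) m n (f : V -> 'M[R]_(m, n))
    df (x v : V) : is_derive x v f df -> is_derive x v (fun y => (f y)^T) df^T.
Proof.
by move=> /is_derive_mxP Df; apply/is_derive_mxP => i j; rewrite mxE; under eq_fun do rewrite mxE.
Qed.

Lemma is_derive_comp_rV (R : realType) m (f : 'rV[R]_m -> R) (y : R -> 'rV[R]_m) u (s : R) :
  is_derive s 1 y u -> differentiable f (y s) ->
  is_derive s 1 (fun z => f (y z)) (\sum_i u 0 i * 'D_(delta_mx 0 i) f (y s)).
Proof.
move=> [dy yE] df; have {}dy : differentiable y s by exact/derivable1_diffP.
have dfy : differentiable (f \o y) s by exact: differentiable_comp.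
split; first exact/derivable1_diffP.
rewrite derive_comp_rV//; apply: eq_bigr => i _; congr (_ * _).
by rewrite -yE derive_coord//; exact: diff_derivable.
Qed.

Lemma is_derive_comp_mx (R : realType) m p q (f : 'rV[R]_m -> 'M[R]_(p, q))
    (y : R -> 'rV[R]_m) u (s : R) :
  is_derive s 1 y u -> differentiable f (y s) ->
  is_derive s 1 (fun z => f (y z)) (\sum_i u 0 i *: 'D_(delta_mx 0 i) f (y s)).
Proof.
move=> dy df; apply/is_derive_mxP => i j.
have dfij : differentiable (fun x => f x i j) (y s).
  exact: (differentiable_comp df (differentiable_coord _ i j)).
apply: (is_derive_eq (is_derive_comp_rV dy dfij)).
rewrite summxE; apply: eq_bigr => k _.
by rewrite mxE derive_coord//; exact: diff_derivable.
Qed.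

Lemma diff_is_derive (R : realType) (V W : normedModType R) (f : V -> W) (x v : V) :
  differentiable f x -> is_derive x v f ('D_v f x).
Proof. by move=> df; split=> //; exact: diff_derivable. Qed.

(** * Pregeodesics and momenta *)

(** Multiplication by [G] cancels the inverse metric in the Christoffel symbols, and their first two
    terms agree once contracted with the symmetric product of [u] with itself. *)
Lemma christoffel_lower (R : realType) m (G : 'M[R]_m) (dG : 'I_m -> 'M[R]_m) (u : 'rV[R]_m) :
  G \in unitmx -> G^T = G ->
  (\row_k \sum_(i < m) \sum_(j < m) (\sum_(l < m) 2^-1 * invmx G k l *
     (dG i j l + dG j i l - dG l i j)) * u 0 i * u 0 j) *m G =
  \row_l ((u *m \sum_k u 0 k *: dG k) 0 l - 2^-1 * (u *m dG l *m u^T) 0 0).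
Proof.
move=> uG sG.
pose w : 'rV[R]_m := \row_l \sum_i \sum_j 2^-1 * (dG i j l + dG j i l - dG l i j) * u 0 i * u 0 j.
rewrite (_ : (\row_k _) = w *m invmx G); last first.
  apply/rowP => k; rewrite !mxE.
  under [RHS]eq_bigr do rewrite mxE mulr_suml.
  rewrite [RHS]exchange_big; apply: eq_bigr => i _ /=.
  under [RHS]eq_bigr do rewrite mulr_suml.
  rewrite [RHS]exchange_big; apply: eq_bigr => j _ /=.
  rewrite !mulr_suml; apply: eq_bigr => l _.
  have -> : invmx G k l = invmx G l k by rewrite -{1}sG -trmx_inv mxE.
  by ring.
rewrite mulmxKV//; apply/rowP => l; rewrite !mxE.
have -> : (\sum_j u 0 j * (\sum_k u 0 k *: dG k) j l) = \sum_i \sum_j dG i j l * u 0 i * u 0 j.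
  rewrite exchange_big; apply: eq_bigr => j _ /=; rewrite summxE mulr_sumr.
  by apply: eq_bigr => i _; rewrite mxE; ring.
have -> : \sum_j (u *m dG l) 0 j * u^T j 0 = \sum_i \sum_j dG l i j * u 0 i * u 0 j.
  rewrite exchange_big; apply: eq_bigr => j _ /=; rewrite !mxE mulr_suml.
  by apply: eq_bigr => i _; ring.
have E : \sum_i \sum_j dG j i l * u 0 i * u 0 j = \sum_i \sum_j dG i j l * u 0 i * u 0 j.
  rewrite exchange_big; apply: eq_bigr => j _; apply: eq_bigr => i _ /=; ring.
rewrite (_ : \sum_i _ = 2^-1 * (\sum_i \sum_j dG i j l * u 0 i * u 0 j +
   \sum_i \sum_j dG j i l * u 0 i * u 0 j - \sum_i \sum_j dG l i j * u 0 i * u 0 j)).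
  by rewrite E; lra.
rewrite -big_split -sumrB mulr_sumr; apply: eq_bigr => i _ /=.
rewrite -big_split -sumrB mulr_sumr; apply: eq_bigr => j _ /=; ring.
Qed.

(** In the product rule for [u G], the derivative of [G] along the curve is the first term of
    [christoffel_lower]. Only the half with the derivative in the free direction [l] remains beside
    the lowered acceleration. *)
Lemma is_derive_momentum (R : realType) (M : topologicalType) m (c : chart R M m)
    (g : chart R M m -> M -> 'M[R]_m) (gam : R -> M) (s : R) :
  let G z := g c (cinv c z) in let u := velocity c gam in
  cinv c (c (gam s)) = gam s -> g c (gam s) \in unitmx -> (g c (gam s))^T = g c (gam s) ->
  differentiable G (c (gam s)) ->
  is_derive s 1 (c \o gam) (u s) -> is_derive s 1 u (derive1 u s) ->
  is_derive s 1 (fun r => u r *m G (c (gam r)))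
    (covariant_acceleration g c gam s *m g c (gam s) +
     \row_l (2^-1 * (u s *m 'D_(delta_mx 0 l) G (c (gam s)) *m (u s)^T) 0 0)).
Proof.
move=> G u cK uG sG dG dy du.
have := is_derive_mulmx du (is_derive_comp_mx dy dG).
move=> /is_derive_eq; apply; rewrite /covariant_acceleration -/u mulmxDl -addrA /=.
have EG : G (c (gam s)) = g c (gam s) by rewrite /G cK.
rewrite EG; congr (_ + _).
pose d l := 'D_(delta_mx 0 l) G (c (gam s)).
rewrite -/(d _) (_ : (\row_k _) *m _ = \row_l ((u s *m \sum_k u s 0 k *: d k) 0 l - 2^-1 * (u s *m d l *m (u s)^T) 0 0)).
  have rowB (a b : 'I_m -> R) : (\row_l (a l - b l)) + \row_l b l = \row_l a l :> 'rV_m.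
    by apply/rowP => l; rewrite !mxE subrK.
  by rewrite rowB; apply/rowP => l; rewrite [RHS]mxE.
rewrite -(christoffel_lower d (u s) uG sG); congr (_ *m _); apply/rowP => k; rewrite !mxE.
apply: eq_bigr => i _; apply: eq_bigr => j _; congr (_ * _ * _).
rewrite /christoffel; apply: eq_bigr => l _.
have dE a p q : 'D_(delta_mx 0 a) (fun y => g c (cinv c y) p q) (c (gam s)) = d a p q.
  by rewrite /d derive_coord//; exact: diff_derivable.
by rewrite !dE.
Qed.

Lemma is_derive_unique (R : realType) (V W : normedModType R) (f : V -> W) (x v : V) a b :
  is_derive x v f a -> is_derive x v f b -> a = b.
Proof. by move=> [_ <-] [_ <-]. Qed.

(** Differentiating [H G = 1] gives [dG = - G dH G]. This moves derivatives from the metric,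
    singular at the end, to its dual, which is smooth there. *)
Lemma dual_derive (R : realType) (V : normedModType R) m (G H : V -> 'M[R]_m) (x v : V)
    (u P : 'rV[R]_m) :
  (\forall z \near x, H z *m G z = 1%:M) -> differentiable G x -> differentiable H x ->
  (G x)^T = G x -> P = u *m G x ->
  u *m 'D_v G x *m u^T = - (P *m 'D_v H x *m P^T).
Proof.
move=> HG dG dH sG ->.
have E : 'D_v H x *m G x + H x *m 'D_v G x = 0.
  apply: (is_derive_unique (is_derive_mulmx (diff_is_derive v dH) (diff_is_derive v dG))).
  have n1 : \forall z \near x, (fun=> 1%:M) z = H z *m G z by apply: filterS HG => z ->.
  exact: (near_eq_is_derive n1 (is_derive_cst _ _ _)).
have GH : G x *m H x = 1%:M by apply: mulmx1C; exact: nbhs_singleton HG.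
have E1 : 'D_v H x *m G x = - (H x *m 'D_v G x).
  by apply/eqP; rewrite -subr_eq0 opprK E.
rewrite trmx_mul sG -(mulmxA _ ('D_v H x)) (mulmxA ('D_v H x)) E1 mulNmx mulmxN opprK.
by rewrite !mulmxA -(mulmxA u (G x)) GH mulmx1.
Qed.

(* Along the curve the momentum is P = dT / T. Its covariant derivative has the
   components P_l' + 1/2 P (d_l H) P^T, and differentiating dT H dT^T = T, with the
   symmetry of the second derivatives of T, turns them into a multiple of P. *)
Lemma gradient_curve_pregeodesic (R : realType) (M : topologicalType) m (c : chart R M m)
    (g : chart R M m -> M -> 'M[R]_m) (gam : R -> M) (s : R) (O : set 'rV[R]_m)
    (T : 'rV[R]_m -> R) (H : 'rV[R]_m -> 'M[R]_m) :
  let G z := g c (cinv c z) in let y := c \o gam in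
  let dT z : 'rV[R]_m := \row_l 'D_(delta_mx 0 l) T z in
  open O -> O (y s) -> Ck 2 O T -> differentiable G (y s) -> differentiable H (y s) ->
  (forall z, O z -> H z *m G z = 1%:M) -> (forall z, O z -> (H z)^T = H z) ->
  (forall z, O z -> (dT z *m H z *m (dT z)^T) 0 0 = T z) -> T (y s) != 0 ->
  cinv c (c (gam s)) = gam s ->
  (\forall r \near s, is_derive (r : R) 1 y ((T (y r))^-1 *: (dT (y r) *m H (y r)))) ->
  (\forall r \near s, O (y r)) ->
  covariant_acceleration g c gam s = - (2 * T (y s))^-1 *: velocity c gam s.
Proof.
move=> G y dT oO Oy CT dG dH HG sH HT T0 cK yD nO.
set u := velocity c gam.
have uE : \forall r \near s, u r = (T (y r))^-1 *: (dT (y r) *m H (y r)).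
  by apply: filterS yD => r [_ <-]; rewrite /u /velocity derive1E.
have us := nbhs_singleton uE.
have ys : is_derive s 1 y (u s) by rewrite us; exact: nbhs_singleton yD.
have dT1 z : O z -> differentiable T z by exact: CT.1.
have ddT i z : O z -> differentiable ('D_(delta_mx 0 i) T) z by exact: (CT.2 _).1.
have ddTm z : O z -> differentiable dT z.
  move=> Oz; apply: differentiable_mx => i j; rewrite /dT.
  by under eq_fun do rewrite mxE; exact: ddT.
have GH z : O z -> G z *m H z = 1%:M by move=> Oz; apply: mulmx1C; exact: HG.
have unitG : G (y s) \in unitmx by case/mulmx1_unit: (GH _ Oy).
have sG : (G (y s))^T = G (y s).
  have : (G (y s))^T *m H (y s) = 1%:M by rewrite -(sH _ Oy) -trmx_mul HG// trmx1.
  move=> E; rewrite -[LHS]mulmx1 -(HG _ Oy) mulmxA E mul1mx //.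
have uT : (u s *m (dT (y s))^T) 0 0 = 1.
  by rewrite us -scalemxAl mxE HT// mulVf.
have dTy : is_derive s 1 (fun r => T (y r)) 1.
  apply: (is_derive_eq (is_derive_comp_rV ys (dT1 _ Oy))).
  by rewrite -uT mxE; apply: eq_bigr => i _; rewrite !mxE.
have dV : is_derive s 1 (fun r => (T (y r))^-1) (- (T (y s)) ^- 2).
  split; first exact: derivableV.
  by rewrite deriveV//; case: dTy => _ ->; rewrite /GRing.scale/= mulr1.
have du : is_derive s 1 u (derive1 u s).
  have ddTy := is_derive_mulmx (is_derive_comp_mx ys (ddTm _ Oy)) (is_derive_comp_mx ys dH).
  have dd : derivable u s 1.
    apply: (near_eq_derivable (f := fun r => (T (y r))^-1 *: (dT (y r) *m H (y r)))).
      by apply: filterS uE => r ->.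
    apply/derivable_mxP => i j; under eq_fun do rewrite mxE.
    move/is_derive_mxP: ddTy => /(_ i j) Dij; exact: derivableM.
  have -> : derive1 u s = 'D_1 u s by exact: derive1E.
  exact: (DeriveDef dd erefl).
have Gy : g c (gam s) = G (y s) by rewrite /G /y /= cK.
have acc := is_derive_momentum (g := g) (c := c) (gam := gam) (s := s) cK.
rewrite Gy in acc; have {}acc := acc unitG sG dG ys du.
have PE : \forall r \near s, u r *m G (y r) = (T (y r))^-1 *: dT (y r).
  by apply: filterS2 uE nO => r -> Or; rewrite -scalemxAl -mulmxA HG// mulmx1.
have Ps := nbhs_singleton PE.
pose S l := \sum_i u s 0 i * 'D_(delta_mx 0 i) ('D_(delta_mx 0 l) T) (y s).
have PD l : is_derive s 1 (fun r => (u r *m G (y r)) 0 l)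
    ((T (y s))^-1 * S l - 'D_(delta_mx 0 l) T (y s) * (T (y s)) ^- 2).
  have nE : \forall r \near s, (T (y r))^-1 * 'D_(delta_mx 0 l) T (y r) = (u r *m G (y r)) 0 l.
    by apply: filterS PE => r ->; rewrite !mxE.
  apply: (near_eq_is_derive nE).
  have H1 := is_deriveM1 dV (is_derive_comp_rV ys (ddT l _ Oy)).
  by rewrite mulrN in H1; exact: H1.
have accl l := is_derive_unique ((is_derive_mxP _ _ _ _).2 acc 0 l) (PD l).
have nHG : \forall z \near y s, H z *m G z = 1%:M.
  by have : \forall z \near y s, O z by [exact: open_nbhs_nbhs]; apply: filterS => z /HG.
have HTl l : 2 * T (y s) * S l + (dT (y s) *m 'D_(delta_mx 0 l) H (y s) *m (dT (y s))^T) 0 0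
    = 'D_(delta_mx 0 l) T (y s).
  have ddTy := diff_is_derive (delta_mx 0 l) (ddTm _ Oy).
  have dHl := diff_is_derive (delta_mx 0 l) dH.
  have /is_derive_mxP/(_ 0 0) D1 := is_derive_mulmx (is_derive_mulmx ddTy dHl) (is_derive_tr ddTy).
  have nT : \forall z \near y s, (dT z *m H z *m (dT z)^T) 0 0 = T z.
    by have : \forall z \near y s, O z by [exact: open_nbhs_nbhs]; apply: filterS => z /HT.
  have := is_derive_unique (near_eq_is_derive nT D1) (diff_is_derive (delta_mx 0 l) (dT1 _ Oy)).
  move=> <-; set d := 'D_(delta_mx 0 l) dT (y s).
  have addE (X Y Z : 'M[R]_1) : (X + Y + Z) 0 0 = X 0 0 + Y 0 0 + Z 0 0 by rewrite !mxE.
  have tr00 (X : 'M[R]_1) : X 0 0 = X^T 0 0 by rewrite mxE.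
  rewrite mulmxDl addE.
  have uTE : dT (y s) *m H (y s) = T (y s) *: u s by rewrite us scalerA mulfV// scale1r.
  have -> : (d *m H (y s) *m (dT (y s))^T) 0 0 = (dT (y s) *m H (y s) *m d^T) 0 0.
    by rewrite tr00 !trmx_mul trmxK (sH _ Oy) mulmxA.
  have scE (a : R) (X : 'M[R]_1) : (a *: X) 0 0 = a * X 0 0 by rewrite mxE.
  rewrite uTE -scalemxAl !scE.
  have -> : (u s *m d^T) 0 0 = S l.
    rewrite mxE; apply: eq_bigr => i _; rewrite mxE /d; congr (_ * _).
    rewrite [RHS](Ck2_derive_comm _ _ oO CT Oy).
    rewrite (derive_coord 0 i (diff_derivable (ddTm _ Oy))).
    by congr ('D__ _ _); apply/funext => z; rewrite mxE.
  by ring.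
(* By [HTl], the Hessian term [S l / T] and the term with the derivative of [H] add up to half of
   [dT / T^2], while the derivative of [1 / T] contributes [- dT / T^2]. What is left is
   [- 1 / (2 T)] times [P = dT / T]. *)
have : covariant_acceleration g c gam s *m G (y s) = - (2 * T (y s))^-1 *: (u s *m G (y s)).
  apply/rowP => l; have := accl l; rewrite [in X in X -> _]mxE.
  rewrite [X in _ + X = _](_ : _ = - 2^-1 * (T (y s)) ^- 2 * (dT (y s) *m 'D_(delta_mx 0 l) H (y s) *m (dT (y s))^T) 0 0).
    move=> E; rewrite [RHS]mxE Ps [X in _ = _ * X]mxE [X in _ = _ * (_ * X)]mxE.
    rewrite -HTl -/(y s); move: E; rewrite -HTl.
    move: (_ 0 l) (S l) ((dT _ *m _ *m _) 0 0) T0 => a1 S1 X1; move: (T (y s)) => t t0 E.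
    have -> : a1 = t^-1 * S1 - (2 * t * S1 + X1) / t ^+ 2 - - 2^-1 / t ^+ 2 * X1 by rewrite -E; ring.
    by field.
  rewrite mxE (dual_derive (P := u s *m G (y s)) _ nHG dG dH sG erefl) Ps.
  rewrite linearZ/= -!scalemxAl -scalemxAr !mxE.
  by rewrite expr2 invfM; ring.
by move=> /(congr1 (mulmx^~ (invmx (G (y s))))); rewrite -scalemxAl !mulmxK.
Qed.

(** * Regular level sets and flows through a hyperplane *)

Lemma delta_norm_le1 (R : realType) m (i : 'I_m) : `|(delta_mx 0 i : 'rV[R]_m)| <= 1.
Proof.
apply/mx_norm_leP => // k j; rewrite mxE.
by case: (_ && _); rewrite ?normr1 ?normr0.
Qed.

(* A point y is at distance O(|d y|) from a zero of d, in the direction of the last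
   axis. The other partial derivatives vanish there, so they are O(|d y|) at y, and
   Gronwall's lemma gives d = 0 on the hyperplane. *)
Lemma regular_level_set_pos (R : realType) n (O : set 'rV[R]_n.+1) (d : 'rV[R]_n.+1 -> R)
    (y0 : 'rV[R]_n.+1) : open O -> O y0 -> Ck 2 O d -> d y0 = 0 ->
  (forall y, O y -> d y = 0 -> forall i, i != ord_max -> 'D_(delta_mx 0 i) d y = 0) ->
  0 < 'D_(delta_mx 0 ord_max) d y0 ->
  exists2 r : R, 0 < r & forall y, `|y0 - y| < r -> O y /\ (d y = 0 <-> y 0 ord_max = y0 0 ord_max).
Proof.
move=> oO Oy0 Cd d0 hd dn; set e : 'rV[R]_n.+1 := delta_mx 0 ord_max in dn *.
have n0 : n.+1%:R != 0 :> R by rewrite pnatr_eq0.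
have df y : O y -> differentiable d y by exact: Cd.1.
pose c := 'D_e d y0 / 2.
have c0 : 0 < c by rewrite divr_gt0.
have [rd [Ld [rd0 Ld0 rdO Ldl]]] := partials_lipschitz_near oO (CkW Cd) Oy0.
have /choice[rL rLP] : forall i, exists rL : R * R, [/\ 0 < rL.1, 0 <= rL.2 &
    forall x y, `|y0 - x| <= rL.1 -> `|y0 - y| <= rL.1 ->
      `|'D_(delta_mx 0 i) d x - 'D_(delta_mx 0 i) d y| <= rL.2 * `|x - y|].
  move=> i; have [r [L [r0 L0 _ rLP]]] := partials_lipschitz_near oO (Cd.2 (delta_mx 0 i)) Oy0.
  by exists (r, L).
pose L := \sum_i (rL i).2.
have L0 : 0 <= L by apply: sumr_ge0 => i _; have [] := rLP i.
have LE i : (rL i).2 <= L.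
  by rewrite /L (bigD1 i)//= lerDl sumr_ge0// => j _; have [] := rLP j.
have [r1 r10 r1P] : exists2 r1 : R, 0 < r1 & forall y, `|y0 - y| < r1 ->
    [/\ `|y0 - y| <= rd, forall i, `|y0 - y| <= (rL i).1 & c < 'D_e d y].
  have n1 : \forall y \near y0, `|y0 - y| <= rd.
    by apply/nbhs_ballP; exists rd => // y; rewrite -ball_normE; exact: ltW.
  have n2 : \forall y \near y0, forall i, `|y0 - y| <= (rL i).1.
    near=> y => i; move: i; near: y; apply: filter_forall => /= i.
    have [ri _ _] := rLP i.
    by apply/nbhs_ballP; exists (rL i).1 => // y; rewrite -ball_normE; exact: ltW.
  have n3 : \forall y \near y0, c < 'D_e d y.
    have cD : 'D_e d @ y0 --> 'D_e d y0 := @CkW _ _ _ 0 _ _ (Cd.2 e) y0 Oy0.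
    by apply: (cvgr_gt _ cD); rewrite /c ltr_pdivrMr// ltr_pMr// ltr1n.
  have : \forall y \near y0, [/\ `|y0 - y| <= rd, forall i, `|y0 - y| <= (rL i).1 & c < 'D_e d y].
    by apply: filterS3 n1 n2 n3 => y.
  move=> /nbhs_ballP[r1 r10 r1P]; exists r1 => // y yr; apply: r1P.
  by rewrite -ball_normE.
have r1h : r1 / 2 < r1 by rewrite ltr_pdivrMr// ltr_pMr// ltr1n.
have shift y t : `|y0 - y| < r1 / 2 -> `|t| < r1 / 2 -> `|y0 - (y + t *: e)| < r1.
  move=> h1 h2; rewrite opprD addrA (le_lt_trans (ler_normB _ _))// [ltRHS]splitr ltrD//.
  rewrite normrZ (le_lt_trans _ h2)// ler_piMr//; exact: delta_norm_le1.
have mono y t : `|y0 - y| < r1 / 2 -> `|t| < r1 / 2 ->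
    exists2 k, c <= k & d (y + t *: e) - d y = k * t.
  move=> h1 h2.
  have inO z : 0 <= z <= 1 -> `|y0 - (y + z *: (t *: e))| < r1.
    move=> /andP[z0 z1]; rewrite scalerA; apply: shift => //.
    by rewrite normrM ger0_norm// (le_lt_trans _ h2)// ler_piMl.
  have [z z01] := mean_value ler01 (fun z hz => is_derive_line (df _ (rdO _ (let: And3 p _ _ := r1P _ (inO z hz) in p)))).
  rewrite scale1r scale0r addr0 subr0 mulr1 => ->.
  have [h _ hc] := r1P _ (inO _ z01).
  exists ('D_e d (y + z *: (t *: e))); first exact: ltW.
  rewrite !deriveE; [|exact/df/rdO|exact/df/rdO].
  by rewrite linearZ /GRing.scale/= mulrC.
pose eta := r1 / 4.
have eta0 : 0 < eta by rewrite divr_gt0.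
have etar : `|eta| < r1 / 2 by rewrite gtr0_norm// /eta; lra.
have etar' : `|- eta| < r1 / 2 by rewrite normrN.
have r20 : 0 < r1 / 2 by rewrite divr_gt0.
have y0r : `|y0 - y0| < r1 / 2 by rewrite subrr normr0.
(* On the axis through [y0], at the parameters [eta] and [- eta], [d] has opposite signs and size at
   least [c * eta]. A displacement of the axis by less than [r2] changes [d] by less than that, so
   the signs persist and the intermediate value theorem applies. *)
pose r2 := Num.min eta (c * eta / (Ld + 1)).
have Ld1 : 0 < Ld + 1 by rewrite ltr_wpDl.
have r2eta : r2 <= eta by rewrite ge_min lexx.
have r2L : (Ld + 1) * r2 <= c * eta by rewrite mulrC -ler_pdivlMr// ge_min lexx orbT.
have r2p : 0 < r2 by rewrite lt_min eta0/= !divr_gt0 ?mulr_gt0.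
have r2r1 y : `|y0 - y| < r2 -> `|y0 - y| < r1 / 2.
  by move=> /lt_le_trans; apply; rewrite (le_trans r2eta)// /eta; lra.
have zero y : `|y0 - y| < r2 -> exists2 t, `|t| < r1 / 2 & d (y + t *: e) = 0.
  move=> yr.
  have lip t : `|t| < r1 / 2 -> `|d (y + t *: e) - d (y0 + t *: e)| < c * eta.
    move=> tr.
    have [h1 _ _] := r1P _ (shift y t (r2r1 _ yr) tr).
    have [h2 _ _] := r1P _ (shift y0 t y0r tr).
    apply: le_lt_trans (Ldl _ _ h1 h2) _; apply: lt_le_trans r2L.
    rewrite opprD addrACA subrr addr0 distrC (le_lt_trans (_ : _ <= (Ld + 1) * `|y0 - y|))//.
      by rewrite ler_wpM2r// lerDl.
    by rewrite ltr_pM2l.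
  have [k1 ck1 E1] := mono y0 eta y0r etar.
  have [k2 ck2 E2] := mono y0 (- eta) y0r etar'.
  have p1 : 0 < d (y + eta *: e).
    have := lip _ etar; rewrite ltr_norml => /andP[+ _].
    rewrite d0 subr0 in E1; rewrite E1.
    have : c * eta <= k1 * eta by rewrite ler_wpM2r// ltW.
    lra.
  have p2 : d (y + (- eta) *: e) < 0.
    have := lip _ etar'; rewrite ltr_norml => /andP[_ +].
    rewrite d0 subr0 in E2; rewrite E2.
    have : c * eta <= k2 * eta by rewrite ler_wpM2r// ltW.
    lra.
  have [|||t tin t0] := @IVT R (fun t => d (y + t *: e)) (- eta) eta 0.
  - by rewrite ge0_cp// ltW.
  - apply: continuous_in_subspaceT => t; rewrite inE/= in_itv/= => tin.
    apply: (is_derive1_continuous (is_derive_line _)); apply: df; apply: rdO.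
    have tr : `|t| < r1 / 2.
      by rewrite (le_lt_trans _ etar)// (gtr0_norm eta0) ler_norml.
    by have [] := r1P _ (shift y t (r2r1 _ yr) tr).
  - by rewrite ge_min le_max (ltW p1) (ltW p2) !orbT.
  - exists t => //; move: tin; rewrite in_itv/= => tin.
    by rewrite (le_lt_trans _ etar)// (gtr0_norm eta0) ler_norml.
have ond y : `|y0 - y| < r2 / 2 -> y 0 ord_max = y0 0 ord_max -> d y = 0.
  move=> yr yn; pose v := y - y0.
  have vn : v 0 ord_max = 0 by rewrite !mxE yn subrr.
  have vr : `|v| < r2 / 2 by rewrite distrC.
  (* The segment from [y0] to [y] is prolonged to the parameters between -1 and 2, so that [E] is
     differentiable at its ends; the factor 2 lost is the one in [r2 / 2]. *)
  pose E (z : R) := d (y0 + z *: v).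
  have inB z : -1 < z < 2 -> `|y0 - (y0 + z *: v)| < r2.
    move=> /andP[z1 z2]; rewrite opprD addNKr normrN normrZ.
    have z3 : `|z| < 2 by rewrite ltr_norml z2 (lt_trans _ z1)// ltrN2 ltr1n.
    apply: (@le_lt_trans _ _ (2 * `|v|)); first by rewrite ler_wpM2r// ltW.
    by rewrite mulrC -ltr_pdivlMr.
  have inO z : -1 < z < 2 -> O (y0 + z *: v).
    by move=> /inB/r2r1 h; apply: rdO; have [] := r1P _ (lt_trans h r1h).
  have dE (z : R) : -1 < z < 2 -> is_derive z 1 E ('D_v d (y0 + z *: v)).
    by move=> zz; apply: is_derive_line; apply: df; exact: inO.
  have z0 : -1 < (0 : R) < 2 by rewrite oppr_lt0 ltr01 ltr0n.
  have -> : d y = E 1 by rewrite /E scale1r /v addrC subrK.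
  apply: (gronwall_zero (E' := fun z => 'D_v d (y0 + z *: v)) (b := 2) (C := n.+1%:R * `|v| * L / c)).
  - exact: is_derive1_continuous (dE _ z0).
  - by rewrite /E scale0r addr0.
  - move=> z /andP[zp z2]; have zz : -1 < z < 2 by rewrite z2 (lt_trans _ zp)// oppr_lt0.
    split; first exact: dE.
    have [t tr t0] := zero _ (inB _ zz).
    have h1 := r2r1 _ (inB _ zz).
    have [k ck Ek] := mono _ t h1 tr.
    have Etk : `|t| <= `|E z| / c.
      rewrite ler_pdivlMr// mulrC -normrN -(normrN (E z)) normrN.
      have -> : - E z = k * t by rewrite -Ek t0 sub0r.
      by rewrite normrM (gtr0_norm (lt_le_trans c0 ck)) ler_wpM2r.
    rewrite derive_partials; last exact/df/inO.
    rewrite (le_trans (ler_norm_sum _ _ _))//.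
    apply: (@le_trans _ _ (\sum_(i < n.+1) `|v| * (L * (`|E z| / c)))); last first.
      rewrite sumr_const card_ord -[leLHS]mulr_natl le_eqVlt; apply/orP; left; apply/eqP; ring.
    apply: ler_sum => i _; rewrite normrM.
    have [->|im] := eqVneq i ord_max.
      by rewrite vn normr0 mul0r !mulr_ge0// invr_ge0 ltW.
    rewrite ler_pM//; first exact: mx_coord_norm.
    have h2 := shift _ _ h1 tr.
    have [rdz rLz _] := r1P _ h2.
    have [_ rLz' _] := r1P _ (lt_trans h1 r1h).
    have [_ Li0 Li] := rLP i.
    have := Li _ _ (rLz' i) (rLz i); rewrite (hd _ (rdO _ rdz) t0 i im) subr0.
    move=> /le_trans; apply; apply: ler_pM; [exact: Li0|exact: normr_ge0|exact: LE|].
    rewrite opprD addNKr normrN normrZ (le_trans _ Etk)// ler_piMr//; exact: delta_norm_le1.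
  - by rewrite ler01 ltr1n.
exists (r2 / 2); first by rewrite divr_gt0.
move=> y yr; have yr2 : `|y0 - y| < r2 by rewrite (lt_trans yr)// ltr_pdivrMr// ltr_pMr// ltr1n.
split; first by apply: rdO; have [] := r1P y (lt_trans (r2r1 _ yr2) r1h).
split=> [dy|]; last exact: ond.
have z0 : 0 <= (0 : R) <= 1 by rewrite lexx ler01.
(* [y'] is the projection of [y] on the hyperplane, where [d] already vanishes. Along the axis [d]
   increases with slope at least [c], so it has no second zero there. *)
pose y' := squeeze (y0 0 ord_max) 0 y.
have y'r : `|y0 - y'| < r2 / 2 by exact: squeeze_ball.
have dy' : d y' = 0 by apply: ond => //; rewrite squeezeE eqxx mul0r addr0.
pose t := y 0 ord_max - y0 0 ord_max.
have yE : y = y' + t *: e by rewrite /y' /squeeze -addrA -scalerDl sub0r mulN1r addNr scale0r addr0.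
have tr : `|t| < r1 / 2.
  rewrite -normrN opprB (le_lt_trans _ (r2r1 _ yr2))//.
  by have := mx_coord_norm (y0 - y) 0 ord_max; rewrite !mxE.
have y'r1 : `|y0 - y'| < r1 / 2 by apply: r2r1; rewrite (lt_trans y'r)// ltr_pdivrMr// ltr_pMr// ltr1n.
have [k ck Ek] := mono _ t y'r1 tr.
move: Ek; rewrite -yE dy dy' subrr => /esym/eqP.
by rewrite mulf_eq0 (gt_eqF (lt_le_trans c0 ck))/= subr_eq0 => /eqP.
Unshelve. all: by end_near. Qed.

Lemma regular_level_set (R : realType) n (O : set 'rV[R]_n.+1) (d : 'rV[R]_n.+1 -> R)
    (y0 : 'rV[R]_n.+1) : open O -> O y0 -> Ck 2 O d -> d y0 = 0 ->
  (forall y, O y -> d y = 0 -> forall i, i != ord_max -> 'D_(delta_mx 0 i) d y = 0) ->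
  'D_(delta_mx 0 ord_max) d y0 != 0 ->
  exists2 r : R, 0 < r & forall y, `|y0 - y| < r -> O y /\ (d y = 0 <-> y 0 ord_max = y0 0 ord_max).
Proof.
move=> oO Oy0 Cd d0 hd; rewrite neq_lt => /orP[dn|dn]; last exact: (regular_level_set_pos oO).
have DN y v : O y -> 'D_v (fun y => - d y) y = - 'D_v d y.
  by move=> Oy; rewrite deriveN//; apply: diff_derivable; exact: Cd.1.
have [|||r r0 rP] := @regular_level_set_pos R n O (fun y => - d y) y0 oO Oy0 (CkN oO Cd).
- by rewrite d0 oppr0.
- by move=> y Oy /eqP; rewrite oppr_eq0 => /eqP dy i im; rewrite DN// hd// oppr0.
- by rewrite DN// oppr_gt0.
- exists r => // y /rP[Oy dy]; split=> //; rewrite -dy.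
  by split=> [->|/eqP]; rewrite ?oppr0// oppr_eq0 => /eqP.
Qed.

(* When K bounds |N|, the integral curve of N through a point of the slab stays in
   the slab until it meets the hyperplane y_n = (y0)_n. *)
Definition slab (R : realType) n (y0 : 'rV[R]_n.+1) (K r : R) : set 'rV[R]_n.+1 :=
  [set y | `|y0 - y| + K * `|y 0 ord_max - y0 0 ord_max| < r].

Lemma Ck0_norm (R : realType) (V W : normedModType R) (O : set V) (f : V -> W) :
  Ck 0 O f -> Ck 0 O (fun y => `|f y|).
Proof. by move=> cf y Oy; apply: (continuous_comp (cf y Oy)); exact: norm_continuous. Qed.

Lemma open_slab (R : realType) n (y0 : 'rV[R]_n.+1) (K r : R) : open (slab y0 K r).
Proof.
pose f (y : 'rV[R]_n.+1) := `|y0 - y| + K * `|y 0 ord_max - y0 0 ord_max|.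
have cf : Ck 0 setT f.
  apply: (CkD openT).
    apply: Ck0_norm; apply: (Ck0_lipschitz (L := 1)) => x y.
    by rewrite opprD addrACA subrr add0r opprK addrC distrC mul1r.
  apply: (CkM openT); first exact: Ck_cst.
  by apply: Ck0_norm; apply: (CkB openT); [exact: (Ck_coord _ _ _ openT)|exact: Ck_cst].
have -> : slab y0 K r = f @^-1` [set x | x < r] by [].
apply: open_comp; last exact: open_lt.
by move=> y _; exact: (cf y I).
Qed.

Lemma slab_ball (R : realType) n (y0 y : 'rV[R]_n.+1) (K r : R) : 0 <= K ->
  slab y0 K r y -> `|y0 - y| < r.
Proof. by move=> K0; apply: le_lt_trans; rewrite lerDl mulr_ge0. Qed.

(** The last component of [N] is [eps], so [tau] grows with slope [eps * eps = 1] along integral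
    curves. Starting at time [tau y] therefore makes the parameter equal to [tau], and the curve
    meets the hyperplane at time 0. *)
Lemma flow_through_slab (R : realType) n (O : set 'rV[R]_n.+1)
    (N : 'rV[R]_n.+1 -> 'rV[R]_n.+1) (y0 : 'rV[R]_n.+1) (eps : R) :
  open O -> O y0 -> Ck 1 O N -> (forall y, O y -> N y 0 ord_max = eps) -> eps * eps = 1 ->
  exists K r : R, [/\ 0 <= K, 0 < r & forall r', 0 < r' <= r ->
    slab y0 K r' `<=` O /\
    forall y, slab y0 K r' y -> exists a b z s, [/\ a < 0 < b, a < s < b, z s = y &
      forall t : R, a < t < b -> [/\ slab y0 K r' (z t), is_derive t 1 z (N (z t)) &
        eps * (z t 0 ord_max - y0 0 ord_max) = t]]].
Proof.
move=> oO Oy0 CN Ne eps2.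
have /choice[rL rLP] : forall i, exists rL : R * R, [/\ 0 < rL.1, 0 <= rL.2,
    forall y, `|y0 - y| <= rL.1 -> O y &
    forall x y, `|y0 - x| <= rL.1 -> `|y0 - y| <= rL.1 ->
      `|N x 0 i - N y 0 i| <= rL.2 * `|x - y|].
  move=> i; have [r [L [r0 L0 rO rLP]]] := partials_lipschitz_near oO ((Ck_mxP _ _ oO).1 CN 0 i) Oy0.
  by exists (r, L).
pose L := \sum_i (rL i).2.
have L0 : 0 <= L by apply: sumr_ge0 => i _; have [] := rLP i.
have LE i : (rL i).2 <= L.
  by rewrite /L (bigD1 i)//= lerDl sumr_ge0// => j _; have [] := rLP j.
have [r1 r10 r1P] : exists2 r1 : R, 0 < r1 & forall y, `|y0 - y| <= r1 -> forall i, `|y0 - y| <= (rL i).1.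
  have : \forall y \near y0, forall i, `|y0 - y| <= (rL i).1.
    near=> y => i; move: i; near: y; apply: filter_forall => /= i.
    have [ri _ _ _] := rLP i.
    by apply/nbhs_ballP; exists (rL i).1 => // y; rewrite -ball_normE; exact: ltW.
  move=> /nbhs_ballP[r1 /= r10 r1P]; exists (r1 / 2); first by rewrite divr_gt0.
  move=> y yr; apply: r1P; rewrite -ball_normE /=.
  by rewrite (le_lt_trans yr)// ltr_pdivrMr// ltr_pMr// ltr1n.
have inO y : `|y0 - y| <= r1 -> O y by move=> /r1P/(_ ord_max); have [_ _ h _] := rLP ord_max; exact: h.
have NL x y : `|y0 - x| <= r1 -> `|y0 - y| <= r1 -> `|N x - N y| <= L * `|x - y|.
  move=> /r1P hx /r1P hy; apply/mx_norm_leP; first by rewrite mulr_ge0.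
  move=> i j; rewrite ord1 !mxE; have [_ _ _ h] := rLP j.
  by apply: le_trans (h _ _ (hx j) (hy j)) _; rewrite ler_wpM2r.
(* [picard] requires a globally Lipschitz and bounded field, so [N] is composed with the retraction
   on the ball of radius [r1]. *)
pose pr (x : 'rV[R]_n.+1) : 'rV[R]_n.+1 := \row_i clampr (y0 0 i) r1 (x 0 i).
have prB x : `|y0 - pr x| <= r1.
  apply/mx_norm_leP; first exact: ltW.
  by move=> i j; rewrite ord1 !mxE distrC clampr_in// ltW.
have prI x : `|y0 - x| <= r1 -> pr x = x.
  move=> xr; apply/rowP => i; rewrite mxE clampr_id//.
  by rewrite distrC (le_trans _ xr)//; have := mx_coord_norm (y0 - x) 0 i; rewrite !mxE.
have prL x y : `|pr x - pr y| <= `|x - y|.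
  apply/mx_norm_leP => // i j; rewrite ord1 !mxE.
  apply: le_trans (clampr_lip _ _ _ (ltW r10)) _.
  by have := mx_coord_norm (x - y) 0 j; rewrite !mxE.
pose F x := N (pr x).
have FL x y : `|F x - F y| <= L * `|x - y|.
  by apply: le_trans (NL _ _ (prB x) (prB y)) _; rewrite ler_wpM2l.
(* The first two terms bound the field; the summand 1 ensures [|s0| <= K * |s0| < r], which bounds
   the time needed to reach the hyperplane. *)
pose K := L * r1 + `|N y0| + 1.
have K1 : 1 <= K by rewrite lerDr addr_ge0// mulr_ge0// ltW.
have K0 : 0 < K by exact: lt_le_trans K1.
have FK x : `|F x| <= K.
  rewrite /F -(subrK (N y0) (N (pr x))) (le_trans (ler_normD _ _))// /K -[leLHS]addr0 lerD// lerD//.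
  have y0r : `|y0 - y0| <= r1 by rewrite subrr normr0 ltW.
  apply: le_trans (NL _ _ (prB x) y0r) _; rewrite ler_wpM2l// distrC; exact: prB.
exists K, (Num.min r1 (4 * (L + 1))^-1); split; first exact: ltW.
  by rewrite lt_min r10 invr_gt0 mulr_gt0// ltr_wpDl.
move=> r /andP[r0 rr]; have rr1 : r <= r1 by rewrite (le_trans rr)// ge_min lexx.
have LT : L * (2 * r) <= 2^-1.
  have : r <= (4 * (L + 1))^-1 by rewrite (le_trans rr)// ge_min lexx orbT.
  have L1 : 0 < L + 1 by rewrite ltr_wpDl.
  rewrite -[X in _ <= X]div1r ler_pdivlMr; last by rewrite mulr_gt0.
  move=> h; have : L * r <= (L + 1) * r by rewrite ler_wpM2r ?lerDl// ltW.
  have -> : (L + 1) * r = r * (4 * (L + 1)) / 4 by field.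
  by move: h; lra.
have Wr y : slab y0 K r y -> `|y0 - y| <= r1.
  by move=> /(slab_ball (ltW K0)) /ltW h; exact: le_trans rr1.
split; first by move=> y /Wr; exact: inO.
move=> y Wy; pose tau (x : 'rV[R]_n.+1) := eps * (x 0 ord_max - y0 0 ord_max).
have eps1 : `|eps| = 1.
  by apply/eqP; rewrite -sqrp_eq1// real_normK ?num_real// expr2 eps2.
have tauN x : `|tau x| = `|x 0 ord_max - y0 0 ord_max| by rewrite normrM eps1 mul1r.
pose s0 := tau y.
have T0 : 0 < 2 * r by rewrite mulr_gt0.
have [z [zs0 dz]] := @picard R n.+1 F L K (2 * r) s0 y L0 (ltW K0) T0 LT FL FK.
pose mu := r - (`|y0 - y| + K * `|s0|).
have mu0 : 0 < mu by rewrite subr_gt0 tauN.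
(* [mu] is the room left at [y] in the slab. Running past 0 and [s0] by less than [eta] consumes at
   most [2 * K * eta], half of it. *)
pose eta := mu / (4 * K).
have eta0 : 0 < eta by rewrite divr_gt0// mulr_gt0.
have Keta : 4 * (K * eta) = mu by rewrite mulrA /eta mulrC divfK// gt_eqF// mulr_gt0.
clearbody eta.
have s0r : `|s0| + eta < r.
  have : eta <= K * eta by rewrite ler_peMl// ltW.
  have : `|s0| <= K * `|s0| by rewrite ler_peMl.
  have := normr_ge0 (y0 - y); move: Keta mu0; rewrite /mu.
  move: `|y0 - y| `|s0| (K * `|s0|) (K * eta) => p q Kq Ke; lra.
have dist (t : R) : `|t - s0| < 2 * r -> `|z t - y| <= K * `|t - s0|.
  move=> tr; rewrite -zs0; apply: (mean_value_le (df := fun t => F (z t))) => //; first exact: ltW.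
  move=> w hw; apply: dz; apply: le_lt_trans tr; case/orP: hw => /andP[h1 h2].
    by rewrite !ger0_norm ?subr_ge0 ?lerD2r// (le_trans h1).
  by rewrite !ler0_norm ?subr_le0 ?lerN2 ?lerD2r// (le_trans h1).
have tauz (t : R) : `|t - s0| < 2 * r -> tau (z t) = t.
  move=> tr.
  pose h (w : R) := tau (z w) - w.
  have dh (w : R) : `|w - s0| < 2 * r -> is_derive w 1 h 0.
    move=> wr; have /is_derive_mxP/(_ 0 ord_max) dzi := dz w wr.
    have dc : is_derive w 1 (fun w => z w 0 ord_max - y0 0 ord_max) (F (z w) 0 ord_max - 0).
      exact: is_deriveB1 dzi (is_derive_cst _ _ _).
    have dt : is_derive w 1 (fun w => tau (z w)) 1.
      have E : eps *: (F (z w) 0 ord_max - 0) = 1 :> R.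
        by rewrite subr0 /F Ne; [exact: eps2|exact/inO].
      have H := @is_deriveZ _ _ _ (fun w => z w 0 ord_max - y0 0 ord_max) eps w 1 _ dc.
      exact: (is_derive_eq H E).
    by have := is_deriveB1 dt (is_derive_id w (1 : R)); rewrite subrr.
  have h0 : h s0 = 0 by rewrite /h zs0 -/s0 subrr.
  have := @mean_value_le1 R h (fun=> 0) s0 t 0 (lexx 0).
  rewrite mul0r h0 subr0 => H; apply/eqP; rewrite -subr_eq0 -normr_le0; apply: H; last by move=> w _; rewrite normr0.
  move=> w hw; apply: dh; apply: le_lt_trans tr; case/orP: hw => /andP[h1 h2].
    by rewrite !ger0_norm ?subr_ge0 ?lerD2r// (le_trans h1).
  by rewrite !ler0_norm ?subr_le0 ?lerN2 ?lerD2r// (le_trans h1).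
pose a := Num.min 0 s0 - eta; pose b := Num.max 0 s0 + eta.
exists a, b, z, s0; split => //.
- by rewrite subr_lt0 ltr_pwDr// ?ge_min ?le_max ?lexx// andbT (le_lt_trans _ eta0)// ge_min lexx.
- rewrite ltrBlDr ltr_pwDr//= ?ge_min ?lexx ?orbT//.
  by rewrite (le_lt_trans (_ : _ <= Num.max 0 s0)) ?le_max ?lexx ?orbT// ltrDl.
move=> t /andP[ta tb].
have tr : `|t - s0| < 2 * r /\ `|t - s0| + `|t| <= `|s0| + 2 * eta.
  have := ta; have := tb; rewrite /a /b; move: s0r eta0; clear.
  have [h|h] := leP 0 s0.
    rewrite (ger0_norm h).
    have [h1|h1] := leP 0 t; have [h2|h2] := leP 0 (t - s0);
      rewrite ?(ger0_norm h1) ?(ltr0_norm h1) ?(ger0_norm h2) ?(ltr0_norm h2); split; lra.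
  rewrite (ltr0_norm h).
  have [h1|h1] := leP 0 t; have [h2|h2] := leP 0 (t - s0);
    rewrite ?(ger0_norm h1) ?(ltr0_norm h1) ?(ger0_norm h2) ?(ltr0_norm h2); split; lra.
have [tr1 tr2] := tr.
have Wt : slab y0 K r (z t).
  rewrite /slab /= -tauN tauz//.
  have h1 := dist t tr1.
  rewrite -(subrKA y) (le_lt_trans (_ : _ <= `|y0 - y| + K * (`|s0| + 2 * eta)))//.
    apply: le_trans (_ : `|y0 - y| + K * `|t - s0| + K * `|t| <= _).
      by rewrite lerD2r (le_trans (ler_normD _ _))// lerD2l distrC.
    by rewrite -addrA -mulrDr lerD2l ler_wpM2l// ltW.
  by move: Keta mu0; rewrite mulrDr (mulrCA K) /mu; move: (K * eta) (K * `|s0|) `|y0 - y| => Ke p q; lra.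
split=> //; last exact: tauz.
by have := dz t tr1; rewrite /F prI//; exact: Wr.
Unshelve. all: by end_near. Qed.

(** * Canonical curves are integral curves of the gradient *)

(** In a flat chart the last basis covector is dt, so a momentum is a multiple of dtau exactly when
    this part vanishes. *)
Definition horizontal (R : realType) n (P : 'rV[R]_n.+1) : 'rV[R]_n.+1 :=
  P - P 0 ord_max *: delta_mx 0 ord_max.

Lemma horizontalE (R : realType) n (P : 'rV[R]_n.+1) i :
  horizontal P 0 i = if i == ord_max then 0 else P 0 i.
Proof.
rewrite !mxE eqxx /=; case: eqP => [->|_]; first by rewrite mulr1 subrr.
by rewrite mulr0 subr0.
Qed.

Lemma horizontal_norm (R : realType) n (P : 'rV[R]_n.+1) : `|horizontal P| <= `|P|.
Proof.
apply/mx_norm_leP => // i j; rewrite ord1 horizontalE; case: eqP => _; first by rewrite normr0.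
exact: mx_coord_norm.
Qed.

Lemma tr_norm (R : realType) m n (A : 'M[R]_(m, n)) : `|A^T| = `|A|.
Proof.
apply/le_anti/andP; split; apply/mx_norm_leP => // i j.
  by rewrite mxE mx_coord_norm.
by rewrite -[A]trmxK mxE trmxK mx_coord_norm.
Qed.

(** In [x = w K0^-1 + x (K0 - K) K0^-1] the last term is at most half of [|x|] and is absorbed on
    the left. *)
Lemma norm_inv_perturb (R : realType) m n (x w : 'M[R]_(m, n)) (K0 K : 'M[R]_n) :
  K0 \in unitmx -> x *m K = w -> n%:R * (n%:R * `|K0 - K| * `|invmx K0|) <= 2^-1 ->
  `|x| <= 2 * (n%:R * `|w| * `|invmx K0|).
Proof.
move=> uK xK small.
have E : x = w *m invmx K0 + x *m ((K0 - K) *m invmx K0).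
  by rewrite mulmxA mulmxBr xK mulmxBl mulmxK// addrC subrK.
have h1 : `|x| <= n%:R * `|w| * `|invmx K0| + `|x| * 2^-1.
  rewrite {1}E (le_trans (ler_normD _ _))// lerD ?mulmx_norm_le//.
  apply: (le_trans (mulmx_norm_le _ _)); rewrite -mulrA mulrCA ler_wpM2l//.
  by apply: le_trans small; rewrite ler_wpM2l// mulmx_norm_le.
by lra.
Qed.

Lemma row_split (R : realType) n (P : 'rV[R]_n.+1) :
  P = horizontal P + P 0 ord_max *: delta_mx 0 ord_max.
Proof. by rewrite /horizontal subrK. Qed.

Lemma mx11_norm (R : realType) m n (x : 'rV[R]_m) (A : 'M[R]_(m, n)) (y : 'rV[R]_n) :
  `|(x *m A *m y^T) 0 0| <= n%:R * (m%:R * `|x| * `|A|) * `|y|.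
Proof.
apply: le_trans (mx_coord_norm _ 0 0) _; apply: (le_trans (mulmx_norm_le _ _)).
by rewrite tr_norm ler_wpM2r// ler_wpM2l// mulmx_norm_le.
Qed.

Lemma row_dot_norm (R : realType) n (x y : 'rV[R]_n) :
  `|(x *m y^T) 0 0| <= n%:R * `|x| * `|y|.
Proof.
apply: le_trans (mx_coord_norm _ 0 0) _; apply: (le_trans (mulmx_norm_le _ _)).
by rewrite tr_norm.
Qed.

(** The norm of rows is the maximum norm, which is not differentiable. The Euclidean square takes
    its place in the Gronwall estimate and dominates it. *)
Lemma sqr_norm_le_dot (R : realType) n (x : 'rV[R]_n) : `|x| ^+ 2 <= (x *m x^T) 0 0.
Proof.
have S0 : 0 <= (x *m x^T) 0 0.
  by rewrite mxE sumr_ge0// => i _; rewrite mxE -expr2 sqr_ge0.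
rewrite -[leRHS]sqr_sqrtr// ler_sqr ?nnegrE ?sqrtr_ge0//.
apply/mx_norm_leP; first exact: sqrtr_ge0.
move=> i j; rewrite ord1 -sqrtr_sqr ler_wsqrtr// mxE (bigD1 j)//= mxE -expr2 lerDl.
by apply: sumr_ge0 => k _; rewrite mxE -expr2 sqr_ge0.
Qed.

(** At [f = 0], the equation [P H = u] says nothing about the component of [P] along [e]. The matrix
    [f N^T N] has the same last row and column as [H], so the difference kills [e], and adding
    [e^T e] makes it invertible near the end without affecting horizontal rows. *)
Lemma horizontal_equation (R : realType) n (H : 'M[R]_n.+1) (N u P : 'rV[R]_n.+1)
    (f eps : R) :
  let e : 'rV[R]_n.+1 := delta_mx 0 ord_max in eps * eps = 1 -> H^T = H ->
  eps *: (e *m H) = f *: N -> N 0 ord_max = eps -> P *m H = u ->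
  [/\ eps * f * P 0 ord_max = eps * u 0 ord_max - f * (horizontal P *m N^T) 0 0 &
    horizontal P *m (H - f *: (N^T *m N) + e^T *m e) = u - (eps * u 0 ord_max) *: N].
Proof.
move=> e eps2 sH HE Ne PH; set Pn := P 0 ord_max; set q := horizontal P.
have eH : e *m H = (eps * f) *: N by rewrite -scalerA -HE scalerA eps2 scale1r.
have He : H *m e^T = (eps * f) *: N^T by rewrite -{1}sH -trmx_mul eH linearZ.
have PN : (P *m N^T) 0 0 = (q *m N^T) 0 0 + Pn * eps.
  rewrite {1}(row_split P) mulmxDl -scalemxAl [LHS]mxE; congr (_ + _).
  by rewrite mxE -rowE !mxE Ne.
have un : u 0 ord_max = eps * f * (P *m N^T) 0 0.
  have -> : u 0 ord_max = (u *m e^T) 0 0.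
    by rewrite /e trmx_delta -colE mxE.
  by rewrite -PH -mulmxA He -scalemxAr mxE.
have E1 : eps * f * Pn = eps * u 0 ord_max - f * (q *m N^T) 0 0.
  by rewrite un PN [eps * (_ * (_ + _))]mulrA [eps * (eps * f)]mulrA eps2; ring.
split=> //.
rewrite mulmxDr mulmxBr -/q.
have qe : q *m (e^T *m e) = 0.
  rewrite mulmxA (_ : q *m e^T = 0) ?mul0mx// /e trmx_delta -colE.
  by apply/matrixP => i j; rewrite mxE !ord1 horizontalE eqxx mxE.
have qH : q *m H = u - (eps * f * Pn) *: N.
  by rewrite /q /horizontal mulmxBl PH -scalemxAl eH scalerA; congr (_ - _ *: _); rewrite mulrC.
have qNN : q *m (f *: (N^T *m N)) = (f * (q *m N^T) 0 0) *: N.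
  rewrite -scalemxAr mulmxA -scalerA; congr (_ *: _).
  by rewrite {1}[q *m N^T]mx11_scalar mul_scalar_mx.
by rewrite qe addr0 qH qNN E1 -addrA -opprD -scalerDl subrK.
Qed.

(** Near [s = 0] the horizontal part solves a system whose matrix is close to the invertible
    [H + e^T e] at [y 0], with a bounded right-hand side. Away from 0, [P] is continuous on two
    compact intervals. *)
Lemma horizontal_momentum_bounded (R : realType) n (O : set 'rV[R]_n.+1)
    (H : 'rV[R]_n.+1 -> 'M[R]_n.+1) (N : 'rV[R]_n.+1 -> 'rV[R]_n.+1) (c eps a b : R)
    (y u P : R -> 'rV[R]_n.+1) :
  let e : 'rV[R]_n.+1 := delta_mx 0 ord_max in
  let tau (z : 'rV[R]_n.+1) := eps * (z 0 ord_max - c) in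
  Ck 0 O H -> Ck 0 O N -> eps * eps = 1 -> (forall z, O z -> (H z)^T = H z) ->
  (forall z, O z -> eps *: (e *m H z) = tau z *: N z) ->
  (forall z, O z -> N z 0 ord_max = eps) ->
  (forall z, O z -> tau z = 0 -> H z + e^T *m e \in unitmx) ->
  a < 0 < b -> (forall s, a <= s <= b -> O (y s)) ->
  (forall s, a <= s <= b -> {for s, continuous y}) ->
  (forall s, a <= s <= b -> {for s, continuous u}) -> tau (y 0) = 0 ->
  (forall s, a <= s <= b -> s != 0 -> {for s, continuous P}) ->
  (forall s, a <= s <= b -> s != 0 -> P s *m H (y s) = u s) ->
  exists2 C, 0 <= C & forall s, a <= s <= b -> s != 0 -> `|horizontal (P s)| <= C.
Proof.
move=> e tau cH cN eps2 sH HE Ne uH /andP[a0 b0] yO cy cu t0 cP PH.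
have z0 : a <= 0 <= b by rewrite !ltW.
pose K s := H (y s) - tau (y s) *: ((N (y s))^T *m N (y s)) + e^T *m e.
pose w s := u s - (eps * u s 0 ord_max) *: N (y s).
have ab : a <= b by rewrite ltW// (lt_trans a0).
have PK s : a <= s <= b -> s != 0 -> horizontal (P s) *m K s = w s.
  by move=> sab sn0; have [] := horizontal_equation eps2 (sH _ (yO _ sab)) (HE _ (yO _ sab)) (Ne _ (yO _ sab)) (PH _ sab sn0).
have K0 : K 0 = H (y 0) + e^T *m e by rewrite /K t0 scale0r subr0.
have uK : K 0 \in unitmx by rewrite K0; apply: uH => //; exact: yO.
have cN' s i : a <= s <= b -> {for s, continuous (fun s => N (y s) 0 i)}.
  move=> sab; have cNy : {for s, continuous (fun s => N (y s))}.
    by apply: continuous_comp; [exact: cy|exact/cN/yO].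
  exact: (continuous_mxP _ _).1 cNy 0 i.
have cw s : a <= s <= b -> {for s, continuous w}.
  move=> sab; apply/continuous_mxP => i j; rewrite ord1.
  have -> : (fun s => w s 0 j) = fun s => u s 0 j - eps * u s 0 ord_max * N (y s) 0 j.
    by apply/funext => r; rewrite !mxE.
  have cui k : {for s, continuous (fun s => u s 0 k)}.
    exact: (continuous_mxP _ _).1 (cu s sab) 0 k.
  apply: cvgB; first exact: cui.
  by apply: cvgM; [apply: cvgM; [exact: cvg_cst|exact: cui]|exact: cN'].
have cK : {for 0, continuous K}.
  apply/continuous_mxP => i j.
  have -> : (fun s => K s i j) = fun s => H (y s) i j - eps * (y s 0 ord_max - c) *
      (N (y s) 0 i * N (y s) 0 j) + (e^T *m e) i j.
    apply/funext => r; rewrite [LHS]mxE [X in X + _ = _]mxE [X in _ + X + _ = _]mxE.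
    by rewrite [X in _ - X + _ = _]mxE [X in _ - _ * X + _ = _]mxE big_ord1 !mxE.
  have cHy : {for 0, continuous (fun s => H (y s))}.
    by apply: continuous_comp; [exact: cy|exact/cH/yO].
  have cyi := (continuous_mxP _ _).1 (cy 0 z0) 0 ord_max.
  apply: cvgD; last exact: cvg_cst.
  apply: cvgB; first exact: (continuous_mxP _ _).1 cHy i j.
  apply: cvgM; last by apply: cvgM; exact: cN'.
  apply: cvgM; first exact: cvg_cst.
  by apply: cvgB; [exact: cyi|exact: cvg_cst].
have [Cw Cw0 wC] := bounded_on_segment ab cw.
have [eta eta0 etaP] : exists2 eta : R, 0 < eta & forall s, `|s| < eta ->
    n.+1%:R * (n.+1%:R * `|K 0 - K s| * `|invmx (K 0)|) <= 2^-1.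
  pose k := n.+1%:R * n.+1%:R * (`|invmx (K 0)| + 1).
  have k0 : 0 < k by rewrite !mulr_gt0// ltr_wpDl.
  have k20 : 0 < (2 * k)^-1 by rewrite invr_gt0 mulr_gt0.
  have : \forall s \near 0, `|K 0 - K s| < (2 * k)^-1.
    have : K @ 0 --> K 0 := cK.
    by move=> /cvgrPdist_lt/(_ _ k20).
  move=> /nbhs_ballP[eta /= eta0 etaP]; exists eta => // s seta.
  have {}etaP : `|K 0 - K s| < (2 * k)^-1 by apply: etaP; rewrite /ball/= sub0r normrN.
  have -> : 2^-1 = k * (2 * k)^-1 by field; rewrite gt_eqF.
  have -> (p q r : R) : p * (p * q * r) = p * p * r * q by ring.
  apply: ler_pM; [by rewrite !mulr_ge0|exact: normr_ge0| |exact: ltW].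
  by rewrite /k ler_wpM2l ?lerDl// mulr_ge0.
pose e2 := eta / 2.
have e20 : 0 < e2 by rewrite divr_gt0.
have nC s : a <= s <= b -> s != 0 -> `|s| < eta ->
    `|horizontal (P s)| <= 2 * (n.+1%:R * Cw * `|invmx (K 0)|).
  move=> sab sn0 /etaP small; apply: le_trans (norm_inv_perturb uK (PK s sab sn0) small) _.
  by rewrite ler_wpM2l// ler_wpM2r// ler_wpM2l// wC.
have side (a' b' : R) : a <= a' -> b' <= b -> (forall s, a' <= s <= b' -> s != 0) ->
    exists2 C, 0 <= C & forall s, a' <= s <= b' -> `|horizontal (P s)| <= C.
  move=> aa bb n0; have [ab'|ba'] := leP a' b'; last first.
    by exists 0 => // s /andP[h1 h2]; move: (lt_le_trans ba' (le_trans h1 h2)); rewrite ltxx.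
  have [|C C0 CP] := @bounded_on_segment R _ _ P a' b' ab'.
    move=> s /[dup]/n0 sn0 /andP[h1 h2]; apply: cP => //.
    by rewrite (le_trans aa)// (le_trans h2).
  by exists C => // s /CP; apply: le_trans; exact: horizontal_norm.
have [||C1 C10 C1P] := side a (- e2) (lexx _) _.
- by rewrite (le_trans _ (ltW b0))// oppr_le0 ltW.
- by move=> s /andP[_ h]; rewrite lt_eqF// (le_lt_trans h)// oppr_lt0.
have [||C2 C20 C2P] := side e2 b _ (lexx _).
- by rewrite (le_trans (ltW a0))// ltW.
- by move=> s /andP[h _]; rewrite gt_eqF// (lt_le_trans e20).
exists (2 * (n.+1%:R * Cw * `|invmx (K 0)|) + C1 + C2).
  by rewrite !addr_ge0// !mulr_ge0.
move=> s /[dup] sab /andP[h1 h2] sn0; set C3 := 2 * _.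
have C30 : 0 <= C3 by rewrite !mulr_ge0.
have [se|se] := ltP `|s| eta.
  by rewrite -addrA (le_trans (nC s sab sn0 se))// lerDl addr_ge0.
have [sp|sp] := leP 0 s.
  rewrite (ger0_norm sp) in se; apply: le_trans (C2P s _) _; last by rewrite lerDr addr_ge0.
  by rewrite h2 andbT (le_trans _ se)// ler_pdivrMr// ler_pMr// ler1n.
rewrite (ltr0_norm sp) in se; apply: le_trans (C1P s _) _; last by rewrite addrAC lerDr addr_ge0.
by rewrite h1 lerNr/= (le_trans _ se)// ler_pdivrMr// ler_pMr// ler1n.
Qed.

Lemma is_derive_horizontal_dot (R : realType) n (P : R -> 'rV[R]_n.+1) (dP : 'rV[R]_n.+1) (s : R) :
  (forall l, l != ord_max -> is_derive s 1 (fun r => P r 0 l) (dP 0 l)) ->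
  is_derive s 1 (fun r => r * (horizontal (P r) *m (horizontal (P r))^T) 0 0)
    ((horizontal (P s) *m (horizontal (P s))^T) 0 0 +
      2 * s * (horizontal (P s) *m (horizontal dP)^T) 0 0).
Proof.
move=> dPl.
have dh l : is_derive s 1 (fun r => horizontal (P r) 0 l) (horizontal dP 0 l).
  under eq_fun do rewrite horizontalE; rewrite horizontalE.
  have [_|lm] := eqVneq l ord_max; first exact: is_derive_cst.
  exact: dPl.
have dq : is_derive s 1 (fun r => (horizontal (P r) *m (horizontal (P r))^T) 0 0)
    (\sum_l (horizontal (P s) 0 l * horizontal dP 0 l + horizontal (P s) 0 l * horizontal dP 0 l)).
  under eq_fun do rewrite mxE.
  apply: is_derive_sum1 => l.
  under eq_fun do rewrite [X in _ * X]mxE.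
  exact: is_deriveM1.
have did : is_derive s 1 (fun r : R => r) 1 by exact: is_derive_id.
apply: (is_derive_eq (is_deriveM1 did dq)).
rewrite mulr1 addrC; congr (_ + _).
rewrite big_split/= (_ : (_ *m _) 0 0 = \sum_l horizontal (P s) 0 l * horizontal dP 0 l); first by ring.
by rewrite mxE; apply: eq_bigr => l _; rewrite [X in _ * X = _]mxE.
Qed.

(** The last entry [p] of [P] may be unbounded at the end. It enters linearly only through
    [eps * f * p], which the hypothesis expresses by [f1] and [q], and its square has the factor
    [dN 0 ord_max = 0]. Every term that remains contains [q]. *)
Lemma momentum_force_split (R : realType) n (dH : 'M[R]_n.+1) (N dN P : 'rV[R]_n.+1) (f f1 eps : R) :
  let e : 'rV[R]_n.+1 := delta_mx 0 ord_max in let q := horizontal P in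
  eps * eps = 1 -> dH^T = dH -> eps *: (e *m dH) = f *: dN -> dN 0 ord_max = 0 ->
  eps * f * P 0 ord_max = f1 - f * (q *m N^T) 0 0 ->
  (P *m dH *m P^T) 0 0 =
    (q *m dH *m q^T) 0 0 + 2 * ((f1 - f * (q *m N^T) 0 0) * (dN *m q^T) 0 0).
Proof.
move=> e q eps2 sH eH dNn fP.
have {}eH : e *m dH = (eps * f) *: dN by rewrite -scalerA -eH scalerA eps2 scale1r.
rewrite -fP; set p := P 0 ord_max.
have PE : P = q + p *: e := row_split P.
have PdH : P *m dH = q *m dH + (eps * f * p) *: dN.
  by rewrite {1}PE mulmxDl -scalemxAl eH scalerA [p * _]mulrC.
have tr00 (X : 'M[R]_1) : X 0 0 = X^T 0 0 by rewrite mxE.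
have qHe : (q *m dH *m e^T) 0 0 = eps * f * (dN *m q^T) 0 0.
  by rewrite tr00 !trmx_mul trmxK sH mulmxA eH -scalemxAl mxE.
have dNe : (dN *m e^T) 0 0 = 0 by rewrite /e trmx_delta -colE mxE dNn.
have addE (X Y : 'M[R]_1) : (X + Y) 0 0 = X 0 0 + Y 0 0 by rewrite mxE.
have scE (k : R) (X : 'M[R]_1) : (k *: X) 0 0 = k * X 0 0 by rewrite mxE.
have PT : P^T = q^T + p *: e^T by rewrite {1}PE linearD linearZ.
clearbody q; rewrite PdH PT !mulmxDr !mulmxDl -!scalemxAl -!scalemxAr !(addE, scE) qHe dNe.
by ring.
Qed.

Lemma horizontal_linear (R : realType) n (k : R) (x y : 'rV[R]_n.+1) :
  horizontal (k *: x + y) = k *: horizontal x + horizontal y.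
Proof.
apply/rowP => i; rewrite [RHS]mxE [X in _ = X + _]mxE !horizontalE !mxE.
by case: eqP => _; rewrite ?mulr0 ?addr0.
Qed.

(** [tau] is constant in the horizontal directions, so differentiating the relations between [H],
    [N] and [tau] in such a direction produces no derivative of [tau]. *)
Lemma adapted_frame_derive (R : realType) n (O : set 'rV[R]_n.+1)
    (H : 'rV[R]_n.+1 -> 'M[R]_n.+1) (N : 'rV[R]_n.+1 -> 'rV[R]_n.+1) (c eps : R) z l :
  let e : 'rV[R]_n.+1 := delta_mx 0 ord_max in
  let tau (z : 'rV[R]_n.+1) := eps * (z 0 ord_max - c) in
  open O -> Ck 1 O H -> Ck 1 O N -> (forall z, O z -> (H z)^T = H z) ->
  (forall z, O z -> eps *: (e *m H z) = tau z *: N z) ->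
  (forall z, O z -> N z 0 ord_max = eps) -> O z -> l != ord_max ->
  [/\ ('D_(delta_mx 0 l) H z)^T = 'D_(delta_mx 0 l) H z,
    eps *: (e *m 'D_(delta_mx 0 l) H z) = tau z *: 'D_(delta_mx 0 l) N z
    & ('D_(delta_mx 0 l) N z) 0 ord_max = 0].
Proof.
move=> e tau oO CH CN sH HE Ne Oz lm.
have nO : \forall w \near z, O w by exact: open_nbhs_nbhs.
have dH := diff_is_derive (delta_mx 0 l) (CH.1 z Oz).
have dN := diff_is_derive (delta_mx 0 l) (CN.1 z Oz).
split.
- have nE : \forall w \near z, (H w)^T = H w by apply: filterS nO => w /sH.
  exact: is_derive_unique (near_eq_is_derive nE (is_derive_tr dH)) dH.
- have nE : \forall w \near z, (eps *: e) *m H w = tau w *: N w.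
    by apply: filterS nO => w /HE; rewrite scalemxAl.
  have D1 := is_derive_mulmx (is_derive_cst (eps *: e) z (delta_mx 0 l)) dH.
  have := is_derive_unique (near_eq_is_derive nE D1).
  rewrite mul0mx add0r -scalemxAl; apply.
  have dtau : is_derive z (delta_mx 0 l) tau 0.
    have dc : is_derive z (delta_mx 0 l) (fun w : 'rV[R]_n.+1 => w 0 ord_max) 0.
      have := is_derive_id z (delta_mx 0 l) => /is_derive_mxP/(_ 0 ord_max).
      by rewrite mxE eqxx/= eq_sym (negbTE lm).
    have dcc := @is_deriveB _ _ _ (fun w : 'rV[R]_n.+1 => w 0 ord_max) (fun=> c) z _ _ _ dc (is_derive_cst _ _ _).
    have := @is_deriveZ _ _ _ _ eps z _ _ dcc.
    by rewrite subr0 scaler0.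
  apply/is_derive_mxP => i j; under eq_fun do rewrite mxE.
  have dNij := (is_derive_mxP _ _ _ _).2 dN i j.
  have := @is_deriveM _ _ tau (fun w => N w i j) z _ _ _ dtau dNij.
  by rewrite scaler0 addr0 mxE.
- have nE : \forall w \near z, eps = N w 0 ord_max by apply: filterS nO => w /Ne.
  have D1 := near_eq_is_derive nE (is_derive_cst eps z (delta_mx 0 l)).
  exact: is_derive_unique ((is_derive_mxP _ _ _ _).2 dN 0 ord_max) D1.
Qed.

(* E(s) = s |P_hor|^2 satisfies |E'| <= C |E|. It tends to 0 at s = 0, as P_hor stays
   bounded because H + e^T e is invertible on the hyperplane. *)
Lemma horizontal_momentum_zero (R : realType) n (O : set 'rV[R]_n.+1)
    (H : 'rV[R]_n.+1 -> 'M[R]_n.+1) (N : 'rV[R]_n.+1 -> 'rV[R]_n.+1) (c eps a b : R)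
    (y u P : R -> 'rV[R]_n.+1) :
  let e : 'rV[R]_n.+1 := delta_mx 0 ord_max in
  let tau (z : 'rV[R]_n.+1) := eps * (z 0 ord_max - c) in
  open O -> Ck 1 O H -> Ck 1 O N -> eps * eps = 1 -> (forall z, O z -> (H z)^T = H z) ->
  (forall z, O z -> eps *: (e *m H z) = tau z *: N z) ->
  (forall z, O z -> N z 0 ord_max = eps) ->
  (forall z, O z -> tau z = 0 -> H z + e^T *m e \in unitmx) ->
  a < 0 < b -> (forall s, a < s < b -> O (y s)) ->
  (forall s, a < s < b -> {for s, continuous y}) ->
  (forall s, a < s < b -> {for s, continuous u}) -> tau (y 0) = 0 ->
  (forall s : R, a < s < b -> s != 0 -> is_derive s 1 P
     (- (2 * s)^-1 *: P s - \row_l (2^-1 * (P s *m 'D_(delta_mx 0 l) H (y s) *m (P s)^T) 0 0))) ->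
  (forall s, a < s < b -> s != 0 -> P s *m H (y s) = u s) ->
  forall s, a < s < b -> s != 0 -> horizontal (P s) = 0.
Proof.
move=> e tau oO CH CN eps2 sH HE Ne uH /andP[a0 b0] yO cy cu t0 dP PH s /andP[as_ sb] sn0.
(* A compact subinterval with 0 and [s] in its interior, on which all coefficients are bounded. *)
pose a' := (a + Num.min 0 s) / 2; pose b' := (b + Num.max 0 s) / 2.
have [aa' a'0 a's] : [/\ a < a', a' < 0 & a' < s] by rewrite /a'; case: (leP 0 s) => h; split; lra.
have [bb' b'0 b's] : [/\ b' < b, 0 < b' & s < b'] by rewrite /b'; case: (leP 0 s) => h; split; lra.
clearbody a' b'.
have sub r : a' <= r <= b' -> a < r < b.
  by move=> /andP[h1 h2]; rewrite (lt_le_trans aa')//= (le_lt_trans h2).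
have ab' : a' <= b' by rewrite ltW// (lt_trans a'0).
have cP r : a' <= r <= b' -> r != 0 -> {for r, continuous P}.
  move=> /sub rab rn0; have [d _] := dP r rab rn0.
  by apply: differentiable_continuous; exact/derivable1_diffP.
have a'0b' : a' < 0 < b' by rewrite a'0.
have [Cp Cp0 CpP] := horizontal_momentum_bounded (CkW CH) (CkW CN) eps2 sH HE Ne uH a'0b'
  (fun r h => yO r (sub r h)) (fun r h => cy r (sub r h)) (fun r h => cu r (sub r h)) t0 cP
  (fun r h => PH r (sub r h)).
have bnd p (F : 'rV[R]_n.+1 -> 'rV[R]_p) : Ck 0 O F ->
    exists2 C, 0 <= C & forall r, a' <= r <= b' -> `|F (y r)| <= C.
  move=> cF; apply: (@bounded_on_segment R 1 p (fun r => F (y r))) => // r /sub rab.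
  by apply: continuous_comp; [exact: cy|exact/cF/yO].
have bndm p q (F : 'rV[R]_n.+1 -> 'M[R]_(p, q)) : Ck 0 O F ->
    exists2 C, 0 <= C & forall r, a' <= r <= b' -> `|F (y r)| <= C.
  move=> cF; apply: (@bounded_on_segment R p q (fun r => F (y r))) => // r /sub rab.
  by apply: continuous_comp; [exact: cy|exact/cF/yO].
have /choice[C1 C1P] : forall l, exists C, 0 <= C /\ forall r, a' <= r <= b' -> `|'D_(delta_mx 0 l) H (y r)| <= C.
  by move=> l; have [C C0 CC] := bndm _ _ _ (CH.2 (delta_mx 0 l)); exists C.
have /choice[C2 C2P] : forall l, exists C, 0 <= C /\ forall r, a' <= r <= b' -> `|'D_(delta_mx 0 l) N (y r)| <= C.
  by move=> l; have [C C0 CC] := bndm _ _ _ (CN.2 (delta_mx 0 l)); exists C.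
have [C3 C30 C3P] := bndm _ _ _ (CkW CN).
have [C4 C40 C4P] := @bounded_on_segment R _ _ u a' b' ab' (fun r h => cu r (sub r h)).
have [C5 C50 C5P] := bndm _ _ id (Ck_id 0 O).
pose q r := horizontal (P r).
pose f1 r := eps * u r 0 ord_max.
pose k r := f1 r - tau (y r) * (q r *m (N (y r))^T) 0 0.
(* The regular part of the momentum equation, in the form given by [momentum_force_split]. Each term
   has a factor [q], and [k] is bounded even if the last entry of [P] is not. *)
pose B r : 'rV[R]_n.+1 := \row_l - (2^-1 * (q r *m 'D_(delta_mx 0 l) H (y r) *m (q r)^T) 0 0
   + k r * ('D_(delta_mx 0 l) N (y r) *m (q r)^T) 0 0).
have eqs r : a < r < b -> r != 0 -> forall l, l != ord_max ->
    is_derive r 1 (fun r => P r 0 l) ((- (2 * r)^-1 *: P r + B r) 0 l).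
  move=> rab rn0 l lm; have Oy := yO _ rab.
  have /is_derive_mxP/(_ 0 l) D := dP r rab rn0.
  apply: (is_derive_eq D); rewrite [LHS]mxE [RHS]mxE; congr (_ + _).
  rewrite [LHS]mxE [X in - X = _]mxE [RHS]mxE; congr (- _).
  have [fP _] := horizontal_equation eps2 (sH _ Oy) (HE _ Oy) (Ne _ Oy) (PH _ rab rn0).
  have [S1 S2 S3] := adapted_frame_derive oO CH CN sH HE Ne Oy lm.
  rewrite (momentum_force_split eps2 S1 S2 S3 fP) -/(q r) -/(k r).
  by move: (_ 0 0) ((_ *m _) 0 0) => z1 z2; field.
pose CB l := 2^-1 * (n.+1%:R * (n.+1%:R * Cp * C1 l)) + (C4 + (C5 + `|c|) * (n.+1%:R * Cp * C3)) * (n.+1%:R * C2 l).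
have CB0 l : 0 <= CB l by have [h1 _] := C1P l; have [h2 _] := C2P l; rewrite /CB !(addr_ge0, mulr_ge0, invr_ge0).
have BB r l : a' <= r <= b' -> r != 0 -> `|B r 0 l| <= CB l * `|q r|.
  move=> rab rn0; have qC : `|q r| <= Cp by exact: CpP.
  have eps1 : `|eps| = 1.
    by apply/eqP; rewrite -sqrp_eq1// real_normK ?num_real// expr2 eps2.
  have [C10 /(_ r rab) h1] := C1P l; have [C20 /(_ r rab) h2] := C2P l.
  have h3 := C3P r rab; have h4 := C4P r rab; have h5 := C5P r rab.
  rewrite mxE normrN /CB [X in _ <= X]mulrDl (le_trans (ler_normD _ _))// lerD//.
    rewrite normrM gtr0_norm ?invr_gt0// -mulrA ler_wpM2l ?invr_ge0//.
    apply: (le_trans (mx11_norm _ _ _)); rewrite ler_wpM2r// ler_wpM2l//.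
    by rewrite ler_pM ?mulr_ge0// ler_wpM2l.
  rewrite normrM -[X in _ <= X]mulrA; apply: ler_pM => //; last first.
    by apply: (le_trans (row_dot_norm _ _)); rewrite ler_wpM2r// ler_wpM2l.
  rewrite /k (le_trans (ler_normB _ _))// lerD//.
    by rewrite /f1 normrM eps1 mul1r (le_trans (mx_coord_norm _ _ _)).
  rewrite normrM; apply: ler_pM => //.
    rewrite /tau normrM eps1 mul1r (le_trans (ler_normB _ _))// lerD2r.
    by rewrite (le_trans (mx_coord_norm _ _ _)).
  by apply: (le_trans (row_dot_norm _ _)); rewrite ler_pM ?mulr_ge0// ler_wpM2l.
pose E r := r * (q r *m (q r)^T) 0 0.
have E0 : E 0 = 0 by rewrite /E mul0r.
have cE : {for 0, continuous E}.
  apply/cvgrPdist_le => e0 e00.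
  pose X := n.+1%:R * Cp * Cp + 1.
  have X0 : 0 < X by rewrite ltr_wpDl// !mulr_ge0.
  have nA : \forall r \near (0 : R), [/\ a' < r, r < b' & `|r| < e0 / X].
    apply/nbhs_ballP; exists (Num.min (Num.min (- a') b') (e0 / X)).
      by rewrite /= !lt_min b'0 oppr_gt0 a'0 divr_gt0.
    move=> r; rewrite -ball_normE/= sub0r normrN !lt_min => /andP[/andP[h1 h2] h3].
    rewrite ltr_norml opprK in h1; rewrite ltr_norml in h2.
    by case/andP: h1 => h1 _; case/andP: h2 => _ h2; split.
  apply: filterS nA => r [h1 h2 h3]; rewrite E0 sub0r normrN.
  have [->|rn0] := eqVneq r 0; first by rewrite E0 normr0 ltW.
  have rab' : a' <= r <= b' by rewrite !ltW.
  rewrite /E normrM; apply: (@le_trans _ _ (e0 / X * X)); last by rewrite divfK ?gt_eqF.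
  apply: ler_pM => //; first exact: ltW.
  apply: (le_trans (row_dot_norm _ _)); apply: (@le_trans _ _ (n.+1%:R * Cp * Cp)); last by rewrite lerDl.
  by have h := CpP r rab' rn0; rewrite ler_pM ?mulr_ge0// ler_wpM2l.
have dE r : a' < r < b' -> r != 0 -> is_derive r 1 E (2 * r * (q r *m (horizontal (B r))^T) 0 0) /\
    `|2 * r * (q r *m (horizontal (B r))^T) 0 0| <= 2 * (\sum_l CB l) * `|E r|.
  move=> /andP[h1 h2] rn0; have rab' : a' <= r <= b' by rewrite !ltW.
  split.
    (* The multiplier contributes [2 r * (- 1 / (2 r)) |q|^2 = - |q|^2], which cancels the
       derivative of the weight [r]. *)
    apply: (is_derive_eq (is_derive_horizontal_dot (eqs _ (sub _ rab') rn0))).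
    have addE (X Y : 'M[R]_1) : (X + Y) 0 0 = X 0 0 + Y 0 0 by rewrite mxE.
    have scE (z : R) (X : 'M[R]_1) : (z *: X) 0 0 = z * X 0 0 by rewrite mxE.
    have trE (z : R) (X Y : 'rV[R]_n.+1) : (z *: X + Y)^T = z *: X^T + Y^T.
      by rewrite linearD linearZ.
    rewrite -/(q r) horizontal_linear -/(q r) trE mulmxDr -scalemxAr addE scE.
    by move: ((q r *m (q r)^T) 0 0) ((_ *m (horizontal (B r))^T) 0 0) => z1 z2; field.
  rewrite /E !normrM ger0_norm// -!mulrA ler_wpM2l// [leRHS]mulrCA ler_wpM2l//.
  have dot0 : 0 <= (q r *m (q r)^T) 0 0 by apply: le_trans (sqr_norm_le_dot _); rewrite sqr_ge0.
  rewrite (ger0_norm dot0) mxE (le_trans (ler_norm_sum _ _ _))// mulr_suml; apply: ler_sum => l _.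
  rewrite normrM [(horizontal (B r))^T l 0]mxE horizontalE; apply: (@le_trans _ _ (CB l * `|q r| ^+ 2)); last first.
    by rewrite ler_wpM2l// sqr_norm_le_dot.
  rewrite expr2 mulrCA; apply: ler_pM => //; first exact: mx_coord_norm.
  by case: eqP => _; [rewrite normr0 mulr_ge0|exact: BB].
have := gronwall_two_sided a'0b' cE E0 dE (s := s); rewrite a's b's => /(_ isT) /eqP.
rewrite mulf_eq0 (negbTE sn0)/= => /eqP qq.
have := sqr_norm_le_dot (q s); rewrite qq => h.
by apply/eqP; rewrite -normr_eq0 -sqrf_eq0; apply/eqP/le_anti; rewrite h sqr_ge0.
Unshelve. all: by end_near. Qed.

Lemma open_oo (R : realType) (a b : R) : open [set s : R | a < s < b].
Proof.
rewrite (_ : mkset _ = [set` `]a, b[]); first exact: itv_open.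
by apply/seteqP; split => s /=; rewrite in_itv.
Qed.

Lemma near_oo (R : realType) (a b s : R) : a < s < b -> \forall r \near s, a < r < b.
Proof. 
move=> sab; have oI := @open_oo R a b.
by apply: (@open_nbhs_nbhs R s [set s : R | a < s < b]); split.
Qed.

Lemma near_neq0 (R : realType) (V : normedModType R) (f : V -> R) (x : V) :
  {for x, continuous f} -> f x != 0 -> \forall z \near x, f z != 0.
Proof.
move=> cf f0; have fp : 0 < `|f x| by rewrite normr_gt0.
have : f @ x --> f x := cf.
move=> /cvgrPdist_lt/(_ _ fp); apply: filterS => z; apply: contraTneq => ->.
by rewrite subr0 ltxx.
Qed.

Lemma velocity_derive (R : realType) (M : topologicalType) m (c : chart R M m) (gam : R -> M)
    (a b : R) : Ck 2 [set s | a < s < b] (c \o gam) ->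
  forall s : R, a < s < b -> is_derive s 1 (c \o gam) (velocity c gam s) /\
    is_derive s 1 (velocity c gam) (derive1 (velocity c gam) s).
Proof.
move=> [dy Dy] s sab.
have vE : velocity c gam = 'D_1 (c \o gam).
  by apply/funext => r; rewrite /velocity derive1E.
split; first by rewrite vE; exact: diff_is_derive (dy s sab).
by rewrite derive1E vE; exact: diff_is_derive ((Dy 1).1 s sab).
Qed.

(** Hamilton's equation for the momentum, up to reparametrization. Its coefficients are derivatives
    of [H] alone, hence remain bounded near the end. *)
Lemma momentum_equation (R : realType) (M : topologicalType) m (c : chart R M m)
    (g : chart R M m -> M -> 'M[R]_m) (gam : R -> M) (s lam : R)
    (H : 'rV[R]_m -> 'M[R]_m) :
  let G z := g c (cinv c z) in let y := c \o gam in let u := velocity c gam in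
  let P r := u r *m G (y r) in
  cinv c (c (gam s)) = gam s ->
  (\forall z \near y s, H z *m G z = 1%:M) -> (H (y s))^T = H (y s) ->
  differentiable G (y s) -> differentiable H (y s) ->
  is_derive s 1 y (u s) -> is_derive s 1 u (derive1 u s) ->
  covariant_acceleration g c gam s = lam *: u s ->
  is_derive s 1 P (lam *: P s - \row_l (2^-1 * (P s *m 'D_(delta_mx 0 l) H (y s) *m (P s)^T) 0 0)).
Proof.
move=> G y u P cK HG sH dG dH dy du acc.
have HGs := nbhs_singleton HG; have GHs := mulmx1C HGs.
have unitG : G (y s) \in unitmx by case/mulmx1_unit: GHs.
have sG : (G (y s))^T = G (y s).
  have E : (G (y s))^T *m H (y s) = 1%:M by rewrite -sH -trmx_mul HGs trmx1.
  by rewrite -[LHS]mulmx1 -HGs mulmxA E mul1mx.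
have Gy : g c (gam s) = G (y s) by rewrite /G /y /= cK.
have D := is_derive_momentum (g := g) (c := c) (gam := gam) (s := s) cK.
rewrite Gy in D; have {}D := D unitG sG dG dy du.
apply: (is_derive_eq D); rewrite acc -scalemxAl; congr (_ + _).
apply/rowP => l; rewrite [LHS]mxE [RHS]mxE [X in - X]mxE.
rewrite (dual_derive (P := P s) (delta_mx 0 l) HG dG dH sG erefl).
by rewrite [X in _ * X = _]mxE mulrN.
Qed.

(* The multiplier is found by differentiating P H P^T = 1 / s. *)
Lemma momentum_multiplier (R : realType) m (H : 'rV[R]_m -> 'M[R]_m) (y u P : R -> 'rV[R]_m)
    (s lam : R) : s != 0 -> differentiable H (y s) -> (H (y s))^T = H (y s) ->
  is_derive s 1 y (u s) ->
  is_derive s 1 P (lam *: P s - \row_l (2^-1 * (P s *m 'D_(delta_mx 0 l) H (y s) *m (P s)^T) 0 0)) ->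
  P s *m H (y s) = u s ->
  (\forall r \near s, (P r *m H (y r) *m (P r)^T) 0 0 = r^-1) -> lam = - (2 * s)^-1.
Proof.
move=> s0 dH sH dy dP PH nrm.
set dPs := (X in is_derive s 1 P X) in dP.
pose F l := (P s *m 'D_(delta_mx 0 l) H (y s) *m (P s)^T) 0 0.
have addE (X Y : 'M[R]_1) : (X + Y) 0 0 = X 0 0 + Y 0 0 by rewrite mxE.
have tr00 (X : 'M[R]_1) : X 0 0 = X^T 0 0 by rewrite mxE.
have D1 := is_derive_mulmx (is_derive_mulmx dP (is_derive_comp_mx dy dH)) (is_derive_tr dP).
have {}D1 := (is_derive_mxP _ _ _ _).2 D1 0 0.
have dV : is_derive s 1 (fun r : R => r^-1) (- s ^- 2).
  have did : is_derive s 1 (fun r : R => r) 1 by exact: is_derive_id.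
  have dd : derivable (fun r : R => r) s 1 by case: did.
  split; first exact: derivableV.
  by rewrite deriveV// derive_id /GRing.scale/= mulr1.
have := is_derive_unique (near_eq_is_derive nrm D1) dV.
have uP : (P s *m (u s)^T) 0 0 = s^-1.
  by rewrite -PH trmx_mul sH mulmxA; exact: nbhs_singleton nrm.
have dPu : (dPs *m (u s)^T) 0 0 = lam * s^-1 - 2^-1 * \sum_l u s 0 l * F l.
  rewrite /dPs mulmxBl -scalemxAl addE [X in X + _ = _]mxE uP; congr (_ + _).
  rewrite mxE mxE; congr (- _); rewrite mulr_sumr; apply: eq_bigr => l _.
  by rewrite mxE [X in _ * X = _]mxE -/(F l); ring.
rewrite mulmxDl !addE PH (tr00 (u s *m _)) trmx_mul trmxK dPu.
have -> : (dPs *m H (y s) *m (P s)^T) 0 0 = (dPs *m (u s)^T) 0 0.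
  by rewrite -PH trmx_mul sH mulmxA.
have -> : (P s *m (\sum_i u s 0 i *: 'D_(delta_mx 0 i) H (y s)) *m (P s)^T) 0 0 = \sum_l u s 0 l * F l.
  rewrite mulmx_sumr mulmx_suml summxE; apply: eq_bigr => l _.
  by rewrite -scalemxAr -scalemxAl mxE.
rewrite dPu; move: (\sum_l _) => S E.
have E2 : 2 * lam * s^-1 = - s ^- 2 by rewrite -E; field.
have -> : lam = (2 * lam * s^-1) * s / 2 by field.
by rewrite E2; field.
Qed.

Lemma canonical_curve_time (R : realType) (M : topologicalType) n (ch : chart R M n.+1)
    (g : chart R M n.+1 -> M -> 'M[R]_n.+1) (gam : R -> M) (O : set 'rV[R]_n.+1)
    (H : 'rV[R]_n.+1 -> 'M[R]_n.+1) (N : 'rV[R]_n.+1 -> 'rV[R]_n.+1) (c eps a b : R) :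
  let e : 'rV[R]_n.+1 := delta_mx 0 ord_max in
  let tau (z : 'rV[R]_n.+1) := eps * (z 0 ord_max - c) in
  let G z := g ch (cinv ch z) in let y := ch \o gam in
  open O -> Ck 1 O H -> Ck 1 O N -> eps * eps = 1 -> (forall z, O z -> (H z)^T = H z) ->
  (forall z, O z -> eps *: (e *m H z) = tau z *: N z) ->
  (forall z, O z -> N z 0 ord_max = eps) ->
  (forall z, O z -> tau z = 0 -> H z + e^T *m e \in unitmx) ->
  (forall z, O z -> tau z != 0 -> H z *m G z = 1%:M /\ differentiable G z) ->
  a < 0 < b -> Ck 2 [set s | a < s < b] y ->
  (forall s, a < s < b -> O (y s) /\ cinv ch (ch (gam s)) = gam s) ->
  tau (y 0) = 0 -> (forall s, a < s < b -> s != 0 -> tau (y s) != 0) ->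
  (forall s, a < s < b -> s != 0 -> exists lam,
    covariant_acceleration g ch gam s = lam *: velocity ch gam s) ->
  (forall s, a < s < b -> s != 0 ->
    (velocity ch gam s *m g ch (gam s) *m (velocity ch gam s)^T) 0 0 = s^-1) ->
  forall s, a < s < b -> tau (y s) = s.
Proof.
move=> e tau G y oO CH CN eps2 sH HE Ne uH HG a0b Cy yO t0 tn0 pre nrm.
set u := velocity ch gam.
have D := velocity_derive Cy; rewrite -/u -/y in D.
have nI (s : R) : a < s < b -> s != 0 -> \forall r \near s, a < r < b /\ r != 0.
  move=> sab sn0; have ci : {for s, continuous (fun r : R => r)} by exact: cvg_id.
  by apply: filterS2 (near_oo sab) (near_neq0 ci sn0).
have nHG s : a < s < b -> s != 0 -> \forall z \near y s, H z *m G z = 1%:M.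
  move=> sab sn0; have [Oy _] := yO s sab.
  have nO : \forall z \near y s, O z by exact: open_nbhs_nbhs.
  have ct : Ck 0 setT tau.
    apply: (CkM openT); first exact: Ck_cst.
    by apply: (CkB openT); [exact: (Ck_coord _ _ _ openT)|exact: Ck_cst].
  have nt := near_neq0 (ct (y s) I) (tn0 s sab sn0).
  by apply: filterS2 nO nt => z Oz tz; exact: (HG z Oz tz).1.
have sGx z : O z -> tau z != 0 -> (G z)^T = G z.
  move=> Oz tz; have [HGz _] := HG z Oz tz.
  have E : (G z)^T *m H z = 1%:M by rewrite -(sH z Oz) -trmx_mul HGz trmx1.
  by rewrite -[LHS]mulmx1 -HGz mulmxA E mul1mx.
pose P r := u r *m G (y r).
have PH s : a < s < b -> s != 0 -> P s *m H (y s) = u s.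
  move=> sab sn0; have [Oy _] := yO s sab; have [HGz _] := HG _ Oy (tn0 s sab sn0).
  by rewrite /P -mulmxA (mulmx1C HGz) mulmx1.
have Pn s : a < s < b -> s != 0 -> (P s *m (u s)^T) 0 0 = s^-1.
  move=> sab sn0; rewrite -(nrm s sab sn0) /P /G /y /= (yO s sab).2 //.
have dP s : a < s < b -> s != 0 -> is_derive (s : R) 1 P
     (- (2 * s)^-1 *: P s - \row_l (2^-1 * (P s *m 'D_(delta_mx 0 l) H (y s) *m (P s)^T) 0 0)).
  move=> sab sn0; have [Oy cK] := yO s sab; have [HGz dG] := HG _ Oy (tn0 s sab sn0).
  have [dy du] := D s sab; have [lam acc] := pre s sab sn0.
  have dPl := momentum_equation cK (nHG s sab sn0) (sH _ Oy) dG (CH.1 _ Oy) dy du acc.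
  rewrite -(momentum_multiplier sn0 (CH.1 _ Oy) (sH _ Oy) dy dPl (PH s sab sn0)) //.
  apply: filterS (nI s sab sn0) => r [rab rn0]; rewrite -mulmxA.
  have -> : H (y r) *m (P r)^T = (u r)^T 
    by rewrite -[in RHS](PH r rab rn0) [RHS]trmx_mul (sH _ (yO r rab).1).
  exact: Pn.
have hz := horizontal_momentum_zero oO CH CN eps2 sH HE Ne uH a0b (fun s h => (yO s h).1) _ _ t0 dP PH.
have {}hz s : a < s < b -> s != 0 -> horizontal (P s) = 0.
  apply: hz => r rab; first exact: differentiable_continuous (Cy.1 r rab).
  have [_ [d2 _]] := D r rab.
  exact: differentiable_continuous ((derivable1_diffP _ _).1 d2).
pose f r := tau (y r); pose f1 r := eps * u r 0 ord_max.
pose f2 r := eps * (derive1 u r) 0 ord_max.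
have dlin (F : R -> 'rV[R]_n.+1) (F' : 'rV[R]_n.+1) (k s : R) : is_derive s 1 F F' ->
    is_derive s 1 (fun r => eps * (F r 0 ord_max - k)) (eps * F' 0 ord_max).
  move=> /is_derive_mxP/(_ 0 ord_max) dF.
  have H1 := is_deriveM1 (is_derive_cst eps s (1 : R)) (is_deriveB1 dF (is_derive_cst k s (1 : R))).
  by apply: (is_derive_eq H1); rewrite subr0 mulr0 addr0.
have df s : a < s < b -> is_derive (s : R) 1 f (f1 s).
  by move=> sab; exact: dlin (D s sab).1.
have df1 s : a < s < b -> is_derive (s : R) 1 f1 (f2 s).
  move=> sab; have := dlin _ _ 0 _ (D s sab).2.
  by under eq_fun do rewrite subr0.
(* [P] is now [p e]: [horizontal_equation] gives [eps * f * p = f1], and the norm condition gives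
   [p * eps * f1 = 1 / s]. Eliminating [p] yields the relation. *)
have fE s : a < s < b -> s != 0 -> f s = s * (f1 s * f1 s).
  move=> sab sn0; have [Oy cK] := yO s sab; have q0 := hz s sab sn0.
  have [fP _] := horizontal_equation eps2 (sH _ Oy) (HE _ Oy) (Ne _ Oy) (PH s sab sn0).
  have PE := row_split (P s); rewrite q0 add0r in PE.
  have scE (z : R) (X : 'M[R]_1) : (z *: X) 0 0 = z * X 0 0 by rewrite mxE.
  have eu : (e *m (u s)^T) 0 0 = u s 0 ord_max by rewrite -rowE; rewrite !mxE.
  have := Pn s sab sn0; rewrite PE -scalemxAl scE eu.
  have z00 : (0 : 'M[R]_1) 0 0 = 0 by rewrite mxE.
  rewrite q0 mul0mx z00 mulr0 subr0 -/(f s) -/(f1 s) in fP.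
  have uE : u s 0 ord_max = eps * f1 s by rewrite /f1 mulrA eps2 mul1r.
  rewrite uE => Pe; rewrite -{1}fP.
  have -> : s * (eps * f s * P s 0 ord_max * f1 s) = s * (P s 0 ord_max * (eps * f1 s)) * f s by ring.
  by rewrite Pe mulfV// mul1r.
(* Differentiating [f = s f1^2] shows that [f1] times the derivative of [E] vanishes off 0, and [f1]
   is nonzero there because [f] is. So [E] is constant on each side of 0, and it vanishes at 0. This
   gives [f1 = 1] without extracting square roots of [f / s]. *)
pose E r := r * ((f1 r - 1) * (f1 r - 1)).
have did (s : R) : is_derive s 1 (fun r : R => r) 1 by exact: is_derive_id.
have dE' (s : R) : a < s < b -> is_derive s 1 E
    (s * ((f1 s - 1) * f2 s + (f1 s - 1) * f2 s) + (f1 s - 1) * (f1 s - 1)).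
  move=> sab; have d1 : is_derive s 1 (fun r => f1 r - 1) (f2 s).
    by have := is_deriveB1 (df1 s sab) (is_derive_cst (1 : R) s (1 : R)); rewrite subr0.
  by have := is_deriveM1 (did s) (is_deriveM1 d1 d1); rewrite mulr1.
have dE (s : R) : a < s < b -> s != 0 -> is_derive s 1 E 0.
  move=> sab sn0; apply: (is_derive_eq (dE' s sab)).
  have nf : \forall r \near s, r * (f1 r * f1 r) = f r.
    by apply: filterS (nI s sab sn0) => r [rab rn0]; rewrite fE.
  have d2 := is_deriveM1 (did s) (is_deriveM1 (df1 s sab) (df1 s sab)).
  have := is_derive_unique (near_eq_is_derive nf d2) (df s sab).
  have f10 : f1 s != 0.
    by apply: contra_neq (tn0 s sab sn0) => f10; rewrite -/(f s) fE// f10 !mulr0.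
  move=> E1; apply: (mulfI f10); rewrite mulr0.
  have -> : f1 s * (s * ((f1 s - 1) * f2 s + (f1 s - 1) * f2 s) + (f1 s - 1) * (f1 s - 1)) =
    (f1 s - 1) * (s * (f1 s * f2 s + f1 s * f2 s) + f1 s * f1 s * 1 - f1 s) by ring.
  by rewrite E1 subrr mulr0.
have E0 s : a < s < b -> E s = 0.
  apply: (gronwall_two_sided (E' := fun=> 0) (C := 0) a0b).
  - exact: is_derive1_continuous (dE' 0 a0b).
  - by rewrite /E mul0r.
  - by move=> r rab rn0; rewrite normr0 mul0r; split; [exact: dE|].
move=> s sab; have [->|sn0] := eqVneq s 0; first exact: t0.
rewrite -/(f s) fE//; have /eqP := E0 s sab.
by rewrite /E mulf_eq0 (negbTE sn0)/= mulf_eq0 orbb subr_eq0 => /eqP ->; rewrite !mulr1.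
Qed.

(** * Charts and transitions *)

Lemma chart_cont (R : realType) (M : topologicalType) m (c : chart R M m) x :
  cdom c x -> {for x, continuous c}.
Proof.
move=> cx; have := @cfun_cont R M m c; rewrite continuous_open_subspace; last exact: cdom_open.
by apply; rewrite inE.
Qed.

Lemma chart_inv_cont (R : realType) (M : topologicalType) m (c : chart R M m) y :
  (c @` cdom c) y -> {for y, continuous (cinv c)}.
Proof.
move=> cy; have := @cinv_cont R M m c; rewrite continuous_open_subspace; last exact: cimg_open.
by apply; rewrite inE.
Qed.

Lemma cimageP (R : realType) (M : topologicalType) m (c : chart R M m) (U : set M) y :
  cimage c U y <-> [/\ U (cinv c y), cdom c (cinv c y) & c (cinv c y) = y].
Proof.
split=> [[x [Ux cx] <-]|[Ux cx cy]]; first by rewrite cfunK.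
by exists (cinv c y).
Qed.

Lemma cimage_mem (R : realType) (M : topologicalType) m (c : chart R M m) (U : set M) x :
  U x -> cdom c x -> cimage c U (c x).
Proof. by move=> Ux cx; exists x. Qed.

Lemma cimage_open (R : realType) (M : topologicalType) m (c : chart R M m) (U : set M) :
  open U -> open (cimage c U).
Proof.
move=> oU; rewrite openE => y /cimageP[Uy cy yE].
have iy : (c @` cdom c) y by exists (cinv c y).
have n1 : nbhs y (c @` cdom c) by apply: open_nbhs_nbhs; split=> //; exact: cimg_open.
have n2 : nbhs y (cinv c @^-1` U).
  by apply: (chart_inv_cont iy); exact: open_nbhs_nbhs.
apply: filterS2 n1 n2 => z [x cx <-] /=; rewrite cfunK// => Ux.
by exists x.
Qed.

Lemma chart_preimage_open (R : realType) (M : topologicalType) m (c : chart R M m)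
    (W : set 'rV[R]_m) : open W -> open [set x | cdom c x /\ W (c x)].
Proof.
move=> oW; rewrite openE => x [cx Wx].
have n1 : nbhs x (cdom c) by apply: open_nbhs_nbhs; split=> //; exact: cdom_open.
have n2 : nbhs x (c @^-1` W) by apply: (chart_cont cx); exact: open_nbhs_nbhs.
by apply: filterS2 n1 n2.
Qed.

Lemma derive_transition (R : realType) (M : topologicalType) m (c c' : chart R M m) x v :
  differentiable (c' \o cinv c) (c x) ->
  'D_v (c' \o cinv c) (c x) = v *m transition c c' x.
Proof. by move=> d; rewrite deriveEjacobian. Qed.

Lemma transition_entry (R : realType) (M : topologicalType) m (c c' : chart R M m) x i j :
  differentiable (c' \o cinv c) (c x) ->
  transition c c' x i j = 'D_(delta_mx 0 i) (fun y => (c' (cinv c y)) 0 j) (c x).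
Proof.
move=> d; transitivity (('D_(delta_mx 0 i) (c' \o cinv c) (c x)) 0 j).
  by rewrite derive_transition// -rowE [RHS]mxE.
exact: (derive_coord 0 j (diff_derivable d)).
Qed.

Lemma mx_eq_mul (R : pzRingType) m n (X Y : 'M[R]_(m, n)) :
  (forall v : 'rV[R]_m, v *m X = v *m Y) -> X = Y.
Proof.
by move=> E; apply/row_matrixP => i; rewrite !rowE.
Qed.

Section Atlas.
Context {R : realType} {M : topologicalType} {m : nat}.
Context (A : set (chart R M m)) (sA : smooth_manifold A).

Lemma transition_smooth c c' : A c -> A c' -> smooth_on (cimage c (cdom c')) (c' \o cinv c).
Proof. by move=> Ac Ac'; have [] := atlas_compatible sA Ac Ac'. Qed.

Lemma transition_diff c c' x : A c -> A c' -> cdom c x -> cdom c' x ->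
  differentiable (c' \o cinv c) (c x).
Proof.
by move=> Ac Ac' cx c'x; apply: (transition_smooth Ac Ac' 1%N).1; exact: cimage_mem.
Qed.

Lemma transition_id c x : A c -> cdom c x -> transition c c x = 1%:M.
Proof.
move=> Ac cx; apply: mx_eq_mul => v.
rewrite mulmx1 -derive_transition; last exact: transition_diff.
rewrite -[RHS](derive_id (c x) v); apply: near_eq_derive.
have : \forall z \near c x, cimage c (cdom c) z.
  by apply: open_nbhs_nbhs; split; [exact: cimage_open (cdom_open c)|exact: cimage_mem].
by apply: filterS => z /cimageP[].
Qed.

Lemma transition_cocycle c c' c'' x : A c -> A c' -> A c'' ->
  cdom c x -> cdom c' x -> cdom c'' x ->
  transition c c'' x = transition c c' x *m transition c' c'' x.
Proof.
move=> Ac Ac' Ac'' cx c'x c''x; apply: mx_eq_mul => v; rewrite mulmxA.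
have d1 := transition_diff Ac Ac' cx c'x.
have d2 := transition_diff Ac' Ac'' c'x c''x.
have d3 := transition_diff Ac Ac'' cx c''x.
have E1 := derive_transition v d1.
apply: etrans (esym (derive_transition v d3)) (etrans _ (derive_transition _ d2)).
rewrite -E1; move: E1 => _.
have xE : (c' \o cinv c) (c x) = c' x by rewrite /= cfunK.
rewrite -xE in d2 *; rewrite (deriveE _ d2) (deriveE _ d1).
transitivity ('D_v ((c'' \o cinv c') \o (c' \o cinv c)) (c x)).
  apply: near_eq_derive.
  have : \forall z \near c x, cimage c (cdom c') z.
    by apply: open_nbhs_nbhs; split; [exact: cimage_open (cdom_open c')|exact: cimage_mem].
  by apply: filterS => z /cimageP[c'z _ _] /=; rewrite cfunK.
rewrite (deriveE _ (differentiable_comp d1 d2)).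
exact: (congr1 (fun F => F v) (diff_comp d1 d2)).
Qed.

Lemma transition_inv c c' x : A c -> A c' -> cdom c x -> cdom c' x ->
  transition c c' x *m transition c' c x = 1%:M.
Proof. by move=> Ac Ac' cx c'x; rewrite -transition_cocycle// transition_id. Qed.

Lemma transition_unit c c' x : A c -> A c' -> cdom c x -> cdom c' x ->
  transition c c' x \in unitmx.
Proof.
move=> Ac Ac' cx c'x; have [h _] := mulmx1_unit (transition_inv Ac Ac' cx c'x).
exact: h.
Qed.

Lemma transition_derive c c' (gam : R -> M) (s : R) u : A c -> A c' ->
  {for s, continuous gam} -> cdom c (gam s) -> cdom c' (gam s) ->
  is_derive s 1 (c \o gam) u -> is_derive s 1 (c' \o gam) (u *m transition c c' (gam s)).
Proof.
move=> Ac Ac' cg cs c's dg.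
have d1 := transition_diff Ac Ac' cs c's.
have [dd uE] := dg; have ddf : differentiable (c \o gam) s by exact/derivable1_diffP.
have ng : \forall r \near s, ((c' \o cinv c) \o (c \o gam)) r = (c' \o gam) r.
  have : \forall r \near s, cdom c (gam r).
    by apply: cg; apply: open_nbhs_nbhs; split => //; exact: cdom_open.
  by apply: filterS => r cr /=; rewrite cfunK.
apply: (near_eq_is_derive ng).
have dc : differentiable ((c' \o cinv c) \o (c \o gam)) s by exact: differentiable_comp.
split; first exact/derivable1_diffP.
rewrite deriveE// diff_comp//= -(derive_transition _ d1) -uE !deriveE//.
Qed.

Lemma smooth_curve_derive a b (gam : R -> M) c s : smooth_curve A a b gam -> A c ->
  a < s < b -> cdom c (gam s) -> is_derive s 1 (c \o gam) (velocity c gam s).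
Proof.
move=> [_ sg] Ac sab cs; rewrite /velocity derive1E; apply: diff_is_derive.
by apply: (sg c Ac 1%N).1; split.
Qed.

Lemma velocity_transition a b (gam : R -> M) c c' s : smooth_curve A a b gam ->
  A c -> A c' -> a < s < b -> cdom c (gam s) -> cdom c' (gam s) ->
  velocity c' gam s = velocity c gam s *m transition c c' (gam s).
Proof.
move=> sg Ac Ac' sab cs c's; have cg := sg.1 s sab.
have := transition_derive Ac Ac' cg cs c's (smooth_curve_derive sg Ac sab cs).
by move=> [_ <-]; rewrite /velocity derive1E.
Qed.

Lemma tangent_transition (S : set M) c c' x v : A c -> A c' -> cdom c x -> cdom c' x ->
  tangent A S c x v -> tangent A S c' x (v *m transition c c' x).
Proof.
move=> Ac Ac' cx c'x [e [gam [e0 sg gS gx vE]]]; exists e, gam; split=> //.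
rewrite (velocity_transition sg Ac Ac') ?gx ?vE//.
by rewrite oppr_lt0 e0.
Qed.

Lemma smooth_curve_of_chart c (a b : R) (z : R -> 'rV[R]_m) : A c ->
  smooth_on [set s : R | a < s < b] z -> (forall s, a < s < b -> (c @` cdom c) (z s)) ->
  smooth_curve A a b (cinv c \o z).
Proof.
move=> Ac sz cz.
have cont s : a < s < b -> {for s, continuous (cinv c \o z)}.
  move=> sab; apply: continuous_comp; first exact: (sz 0%N).
  by apply: chart_inv_cont; exact: cz.
split=> // c' Ac' k.
have oJ : open [set s | a < s < b /\ cdom c' ((cinv c \o z) s)].
  rewrite openE => s [sab cs].
  have n2 : nbhs s ((cinv c \o z) @^-1` cdom c').
    by apply: (cont s sab); apply: open_nbhs_nbhs; split=> //; exact: cdom_open.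
  by apply: filterS2 (near_oo sab) n2.
apply: (Ck_comp_mx (O' := cimage c (cdom c')) (f := c' \o cinv c) (g := z)) => //.
- exact: cimage_open (cdom_open c').
- move=> s [sab c's]; have [x cx xE] := cz s sab.
  by apply/cimageP; split; rewrite // -xE cfunK.
- by apply: Ck_sub (sz k) => s [].
- exact: transition_smooth.
Qed.

Lemma smooth_transport_scalar c c' (W : set 'rV[R]_m) (U : set M) (f : 'rV[R]_m -> R) :
  A c -> A c' -> open W -> open U -> (forall x, U x -> cdom c x /\ W (c x)) ->
  smooth_on W f -> smooth_on (cimage c' U) (f \o c \o cinv c').
Proof.
move=> Ac Ac' oW oU UW sf k.
apply: (Ck_comp (O' := W) (f := f) (g := c \o cinv c')) => //.
- exact: cimage_open.
- by move=> y /cimageP[/UW[_ +] _ _].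
- apply: Ck_sub (transition_smooth Ac' Ac k) => y /cimageP[/UW[cy _] c'y <-].
  exact: cimage_mem.
Qed.

(** The coordinate differentials of [c0]. In the chart [c0] they form the identity matrix, so that
    [dual_det] becomes a statement on the determinant of [gs c0]. *)
Lemma coordinate_coframe c0 : A c0 ->
  coframe A (cdom c0) (fun c x => (transition c c0 x)^T).
Proof.
move=> Ac0; split.
- move=> c c' x Ac Ac' c0x cx c'x; rewrite -trmx_mul; congr (_^T).
  exact: transition_cocycle.
- move=> c Ac i j k.
  have oI := cimage_open (c := c) (cdom_open c0).
  have Ct := (Ck_mxP _ _ oI).1 (transition_smooth Ac Ac0 k.+1) 0 i.
  apply: (Ck_ext oI _ (Ct.2 (delta_mx 0 j))) => y yI; have [c0y cy yE] := (cimageP _ _ _).1 yI.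
  by rewrite mxE (transition_entry _ _ (transition_diff Ac Ac0 cy c0y)) yE.
- move=> c x Ac c0x cx; rewrite row_free_unit unitmx_tr; exact: transition_unit.
Qed.

End Atlas.

(** * The metric near a polar point *)

Lemma sub_pid_mxE (R : fieldType) n (v : 'rV[R]_n.+1) :
  (v <= (pid_mx n : 'M[R]_n.+1))%MS = (v 0 ord_max == 0).
Proof.
apply/idP/eqP => [/submxP[w ->]|v0].
  rewrite mxE big1// => k _; rewrite mxE; case: eqP => [->|]/=; last by rewrite mulr0.
  by rewrite ltnn mulr0.
apply/submxP; exists v; apply/rowP => j; rewrite mxE (bigD1 j)//= big1 => [|k kj].
  rewrite mxE eqxx /= addr0; have [->|jn] := eqVneq j ord_max; first by rewrite v0 mul0r.
  have -> : (j < n)%N by rewrite ltn_neqAle -ltnS ltn_ord andbT; exact: jn.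
  by rewrite mulr1.
by rewrite mxE (inj_eq val_inj) (negbTE kj) mulr0.
Qed.

Lemma bilinear_inj (R : pzRingType) m (X Y : 'M[R]_m) :
  (forall v w : 'rV[R]_m, v *m X *m w^T = v *m Y *m w^T) -> X = Y.
Proof.
move=> E; apply: mx_eq_mul => v; apply/rowP => j.
have := E v (delta_mx 0 j); rewrite trmx_delta -!colE => /matrixP/(_ 0 0).
by rewrite !mxE.
Qed.

Lemma dual_matrixP (R : realType) m (G H : 'M[R]_m) : G \in unitmx -> G^T = G ->
  dual_matrix G H -> H *m G = 1%:M.
Proof.
move=> uG sG GH; have E : G *m H *m G = G.
  by apply: bilinear_inj => v w; rewrite -(GH v w) trmx_mul sG !mulmxA.
by rewrite -[LHS](mulKmx uG) (mulmxA G) E mulVmx.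
Qed.

Lemma radicalP (R : realType) m (H : 'M[R]_m) mu : radical H mu <-> mu *m H = 0.
Proof.
split=> [rad|E beta]; last by rewrite E mul0mx.
apply/rowP => j; have := rad (delta_mx 0 j); rewrite trmx_delta -colE => /matrixP/(_ 0 0).
by rewrite !mxE.
Qed.

(** Every covector in the radical kills the horizontal vectors, hence is a multiple of [e]. If all
    were zero, the annihilator would be the whole space and contain the last basis vector. *)
Lemma radical_annihilator_hyperplane (R : realType) n (H : 'M[R]_n.+1) :
  annihilator (radical H) = [set v | v 0 ord_max = 0] ->
  (delta_mx 0 ord_max : 'rV[R]_n.+1) *m H = 0 /\
  forall x : 'rV[R]_n.+1, x *m H = 0 -> x 0 ord_max = 0 -> x = 0.
Proof.
move=> E.
have key (x : 'rV[R]_n.+1) : x *m H = 0 -> forall i, i != ord_max -> x 0 i = 0.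
  move=> /radicalP xr i im.
  have : annihilator (radical H) (delta_mx 0 i) by rewrite E /= mxE eqxx/= eq_sym (negbTE im).
  move=> /(_ x xr); rewrite trmx_delta -colE => /matrixP/(_ 0 0).
  by rewrite !mxE.
have key2 (x : 'rV[R]_n.+1) : x *m H = 0 -> x 0 ord_max = 0 -> x = 0.
  move=> xH x0; apply/rowP => i; rewrite mxE.
  by have [->//|im] := eqVneq i ord_max; exact: key.
split=> //.
have [[mu [muH mu0]]|no] := pselect (exists mu : 'rV[R]_n.+1, mu *m H = 0 /\ mu 0 ord_max != 0).
  have muE : mu = mu 0 ord_max *: delta_mx 0 ord_max.
    apply/rowP => i; rewrite !mxE eqxx/=; have [->|im] := eqVneq i ord_max; first by rewrite mulr1.
    by rewrite mulr0 (key _ muH).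
  move: muH; rewrite muE -scalemxAl => /eqP; rewrite scalemx_eq0 (negbTE mu0)/=.
  by move=> /eqP.
have : annihilator (radical H) (delta_mx 0 ord_max).
  move=> mu /radicalP muH; suff -> : mu = 0 by rewrite mul0mx.
  apply: key2 => //; apply/eqP/negPn/negP => mu0; apply: no; by exists mu.
rewrite E /= mxE !eqxx/= => /eqP; by rewrite oner_eq0.
Qed.

Lemma det_zero_col (R : comPzRingType) n (X : 'M[R]_n) j : (forall i, X i j = 0) -> \det X = 0.
Proof. by move=> X0; rewrite (expand_det_col _ j) big1// => i _; rewrite X0 mul0r. Qed.

Lemma det_scale_row (R : comPzRingType) n (X Y : 'M[R]_n) i0 k :
  (forall j, X i0 j = k * Y i0 j) -> (forall i j, i != i0 -> X i j = Y i j) ->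
  \det X = k * \det Y.
Proof.
move=> r0 ri; have := @determinant_multilinear R n X Y Y i0 k 0.
rewrite mul0r addr0; apply.
- by apply/rowP => j; rewrite !mxE r0 mul0r addr0.
- by apply/matrixP => i j; rewrite !mxE ri// eq_sym neq_lift.
- by apply/matrixP => i j; rewrite !mxE ri// eq_sym neq_lift.
Qed.

(** The complement of a hyperplane is dense. This carries the symmetry of the dual metric over to
    the end, where it is not the inverse of a metric. *)
Lemma continuous_eq_off_hyperplane (R : realType) n (B : set 'rV[R]_n.+1)
    (f : 'rV[R]_n.+1 -> R) (c : R) : open B -> Ck 0 B f ->
  (forall y, B y -> y 0 ord_max != c -> f y = 0) -> forall y, B y -> f y = 0.
Proof.
move=> oB cf f0 y By; have [yc|] := eqVneq (y 0 ord_max) c; last exact: f0.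
apply/eqP/negPn/negP => fy.
have nB : \forall z \near y, B z by exact: open_nbhs_nbhs.
have : \forall z \near y, B z /\ f z != 0 by apply: filterI => //; exact: near_neq0 (cf y By) fy.
move=> /nbhs_ballP[r /= r0 rP].
have [] := rP (y + (r / 2) *: delta_mx 0 ord_max).
  rewrite -ball_normE/= opprD addNKr normrN normrZ.
  apply: (@le_lt_trans _ _ (r / 2)).
    rewrite gtr0_norm ?divr_gt0// ler_piMr//; [by rewrite ltW// divr_gt0|exact: delta_norm_le1].
  by rewrite ltr_pdivrMr// ltr_pMr// ltr1n.
move=> Bz /eqP; apply; apply: f0 => //; rewrite !mxE !eqxx/= mulr1 yc.
by rewrite gt_eqF// ltrDl divr_gt0.
Qed.

Lemma polar_normal_form (R : realType) n (y0 : 'rV[R]_n.+1) (r : R)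
    (H : 'rV[R]_n.+1 -> 'M[R]_n.+1) :
  let c := y0 0 ord_max in let e : 'rV[R]_n.+1 := delta_mx 0 ord_max in
  let B := [set y | `|y0 - y| < r] in
  0 < r -> smooth_on B H ->
  (forall y, B y -> y 0 ord_max != c -> (H y)^T = H y) ->
  (forall y, B y -> y 0 ord_max = c -> e *m H y = 0 /\
    forall x : 'rV[R]_n.+1, x *m H y = 0 -> x 0 ord_max = 0 -> x = 0) ->
  (exists v, 'D_v (fun y => \det (H y)) y0 != 0) ->
  exists eps r' (a : 'rV[R]_n.+1 -> R) (N : 'rV[R]_n.+1 -> 'rV[R]_n.+1),
  let B' := [set y | `|y0 - y| < r'] in
  [/\ eps * eps = 1, 0 < r' <= r, smooth_on B' a, smooth_on B' N &
  forall y, B' y -> [/\ 0 < a y, (H y)^T = H y,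
    eps *: (e *m ((a y)^-1 *: H y)) = (eps * (y 0 ord_max - c)) *: N y,
    N y 0 ord_max = eps &
    (y 0 ord_max = c -> (a y)^-1 *: H y + e^T *m e \in unitmx)]].
Proof.
move=> c e B' r0 sH symH radH [v dv]; rewrite {}/B' in sH symH radH *.
set B' := [set y | `|y0 - y| < r] in sH symH radH *.
have oB : open B' by exact: open_norm_ball.
have y0B : B' y0 by rewrite /B' /= subrr normr0.
have sHij i j : smooth_on B' (fun y => H y i j) by move=> k; exact: (Ck_mxP _ _ oB).1 (sH k) i j.
have {}symH y : B' y -> (H y)^T = H y.
  move=> By; apply/matrixP => i j; rewrite mxE; apply/eqP; rewrite -subr_eq0; apply/eqP.
  apply: (@continuous_eq_off_hyperplane R n B' (fun y => H y j i - H y i j) c) => //.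
    by apply: CkB => //; exact: (sHij _ _ 0%N).
  by move=> z Bz zc; rewrite -{1}(symH z Bz zc) mxE subrr.
have eH y : e *m H y = row ord_max (H y) by rewrite -rowE.
have rowH y j : B' y -> y 0 ord_max = c -> H y ord_max j = 0.
  by move=> By yc; have [/rowP/(_ j)] := radH y By yc; rewrite eH !mxE.
have /choice[q qP] : forall j, exists q : 'rV[R]_n.+1 -> R, smooth_on B' q /\
    forall y, B' y -> H y ord_max j = (y 0 ord_max - c) * q y.
  move=> j; have [q sq qE] := @hadamard R n y0 r (fun y => H y ord_max j) (sHij ord_max j)
    (fun y By yc => rowH y j By yc).
  by exists q.
pose Q y : 'rV[R]_n.+1 := \row_j q j y.
have sQ : smooth_on B' Q.
  move=> k; apply/(Ck_mxP _ _ oB) => i j; rewrite /Q.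
  by under [X in Ck _ _ X]eq_fun do rewrite mxE; exact: (qP j).1.
have qn0 : q ord_max y0 != 0.
  (* [H'] is [H] with its last row divided by [y_n - c], so the derivative of [\det H] at [y0] is
     [v_n * \det (H' y0)]. By symmetry the last column of [H' y0] is zero except for [q ord_max y0];
     were this entry 0 too, the derivative would vanish. *)
  pose H' y := \matrix_(i, j) if i == ord_max then q j y else H y i j.
  have sH' : smooth_on B' H'.
    move=> k; apply/(Ck_mxP _ _ oB) => i j; rewrite /H'.
    under [X in Ck _ _ X]eq_fun do rewrite mxE.
    by case: eqP => _; [exact: (qP j).1|exact: sHij].
  have dd : differentiable (fun y => \det (H' y)) y0 by exact: (Ck_det oB (sH' 1%N)).1.
  have nE : \forall y \near y0, ((y : 'rV[R]_n.+1) 0 ord_max - c) * \det (H' y) = \det (H y).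
    have nB : \forall y \near y0, B' y by exact: open_nbhs_nbhs.
    apply: filterS nB => y By; symmetry.
    apply: (det_scale_row (i0 := ord_max)) => [j|i j im]; rewrite mxE ?eqxx ?(negbTE im)//.
    exact: (qP j).2.
  have dl : is_derive y0 v (fun y : 'rV[R]_n.+1 => y 0 ord_max - c) (v 0 ord_max - 0).
    have dc : is_derive y0 v (fun y : 'rV[R]_n.+1 => y 0 ord_max) (v 0 ord_max).
      by have := is_derive_id y0 v => /is_derive_mxP/(_ 0 ord_max).
    exact: (@is_deriveB _ _ _ _ (fun=> c) y0 v _ _ dc (is_derive_cst _ _ _)).
  have D1 := @is_deriveM _ _ (fun y : 'rV[R]_n.+1 => y 0 ord_max - c) _ y0 v _ _ dl (diff_is_derive v dd).
  have [_ D2] := near_eq_is_derive nE D1.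
  apply: contra_neq dv => q0; rewrite D2 subrr scale0r add0r.
  rewrite (@det_zero_col _ _ (H' y0) ord_max) ?scale0r// => i.
  rewrite mxE; case: eqP => [_|_]; first exact: q0.
  by rewrite -(symH y0 y0B) mxE rowH.
pose eps : R := Num.sg (q ord_max y0).
have eps2 : eps * eps = 1 by rewrite -expr2 sqr_sg qn0.
have epsq : 0 < eps * q ord_max y0 by rewrite /eps -normrEsg normr_gt0.
have [r1 r10 r1P] : exists2 r1 : R, 0 < r1 & forall y, `|y0 - y| < r1 -> 0 < eps * q ord_max y.
  have C0 : Ck 0 B' (fun y => eps * q ord_max y).
    by apply: CkM => //; [exact: Ck_cst|exact: ((qP ord_max).1 0%N)].
  have : (fun y => eps * q ord_max y) @ y0 --> eps * q ord_max y0 := C0 y0 y0B.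
  move=> /(cvgr_gt _)/(_ 0 epsq) /nbhs_ballP[r1 /= r10 r1P].
  by exists r1 => // y yr; apply: r1P; rewrite -ball_normE.
(* The sign [eps] makes [a] positive near [y0], as an exponential must be, and the last entry of
   [Q / a] is then [1 / eps = eps]. *)
pose a y := eps * Q y 0 ord_max; pose N y := (a y)^-1 *: Q y.
pose B2 := [set y | `|y0 - y| < Num.min r r1].
have sub : B2 `<=` B' by move=> y; rewrite /B2 /= lt_min => /andP[].
have oB2 : open B2 by exact: open_norm_ball.
have a0 y : B2 y -> 0 < a y.
  by rewrite /B2 /= lt_min => /andP[_ /r1P]; rewrite /a mxE.
have sa : smooth_on B2 a.
  move=> k; apply: CkM => //; first exact: Ck_cst.
  by apply: (Ck_sub sub); exact: (Ck_mxP _ _ oB).1 (sQ k) 0 ord_max.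
exists eps, (Num.min r r1), a, N; rewrite /= -/B2; split=> //.
- by rewrite lt_min r0 r10 ge_min lexx.
- move=> k; apply: Ck_scale_mx => //; last exact: Ck_sub sub (sQ k).
  by apply: CkV => // y /a0; rewrite lt0r => /andP[].
- move=> y B2y; have By := sub y B2y; have ay := a0 y B2y.
  have an0 : a y != 0 by rewrite gt_eqF.
  split=> //; first exact: symH.
  + rewrite -scalemxAr eH /N !scalerA; apply/rowP => j; rewrite !mxE (qP j).2//; ring.
  + rewrite mxE /a; have := an0; rewrite /a; move: (Q y 0 ord_max) => z.
    rewrite mulf_eq0 negb_or => /andP[e0 z0]; apply: (mulfI e0); rewrite eps2.
    by field; rewrite e0 z0.
  (* Injectivity suffices. Multiplying the equation for [x] by [e^T] leaves [x 0 ord_max = 0],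
     because [H e^T = 0]; then [x] is a horizontal element of the radical, hence 0. *)
  + move=> yc; have [eH0 ker] := radH y By yc.
    rewrite -row_free_unit; apply: inj_row_free => x; rewrite mulmxDr mulmxA -scalemxAr.
    have xe : x *m e^T = (x 0 ord_max)%:M.
      by rewrite trmx_delta -colE; apply/matrixP => i j; rewrite !ord1 !mxE eqxx.
    rewrite xe mul_scalar_mx => E.
    have He : H y *m e^T = 0 by rewrite -[LHS]trmxK trmx_mul trmxK symH// eH0 trmx0.
    have x0 : x 0 ord_max = 0.
      move/(congr1 (mulmx^~ e^T)): E; rewrite mulmxDl mul0mx -!scalemxAl -mulmxA He mulmx0 scaler0 add0r.
      move/matrixP/(_ 0 0); rewrite trmx_delta mul_delta_mx !mxE !eqxx/= mulr1//.
    apply: ker => //; move/eqP: E; rewrite x0 scale0r addr0 scalemx_eq0 invr_eq0 (negbTE an0)/=.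
    by move=> /eqP.
Qed.

Lemma flat_sub (R : realType) (M : topologicalType) n (c : chart R M n.+1)
    (D : chart R M n.+1 -> M -> 'M[R]_n.+1) x (v : 'rV[R]_n.+1) :
  (forall y, cdom c y -> (D c y == (pid_mx n : 'M[R]_n.+1))%MS) -> cdom c x ->
  (v <= D c x)%MS = (v 0 ord_max == 0).
Proof. by move=> flat cx; rewrite (eqmxP (flat x cx)) sub_pid_mxE. Qed.

Lemma dual_symmetric (R : realType) m (G H : 'M[R]_m) : G^T = G -> H *m G = 1%:M -> H^T = H.
Proof.
move=> sG HG; have E : G *m H^T = 1%:M by rewrite -{1}sG -trmx_mul HG trmx1.
by rewrite -[LHS]mul1mx -HG -mulmxA E mulmx1.
Qed.

(** In a flat chart the leaves are horizontal, and so are the tangent spaces of the end, an integral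
    manifold. This supplies the hypothesis of [regular_level_set] for the determinant and, through
    the condition on the radical, that of [polar_normal_form]. *)
Lemma polar_chart (R : realType) (M : topologicalType) n (A : set (chart R M n.+1)) (Dinf : set M)
    (g gs D : chart R M n.+1 -> M -> 'M[R]_n.+1) (p : M) :
  smooth_manifold A -> metric_field A (~` Dinf) g -> polar_dual A Dinf g gs ->
  simultaneity_distribution A Dinf D -> Dinf p ->
  exists (c0 : chart R M n.+1) (eps r : R) (a : 'rV[R]_n.+1 -> R) (N : 'rV[R]_n.+1 -> 'rV[R]_n.+1),
  let c := c0 p 0 ord_max in let e : 'rV[R]_n.+1 := delta_mx 0 ord_max in
  let H y := gs c0 (cinv c0 y) in let B := [set y | `|c0 p - y| < r] in
  [/\ A c0, cdom c0 p, (forall y, cdom c0 y -> (D c0 y == (pid_mx n : 'M[R]_n.+1))%MS),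
    eps * eps = 1 & 0 < r] /\
  [/\ smooth_on B a, smooth_on B N, smooth_on B H, B `<=` c0 @` cdom c0 &
  forall y, B y -> (Dinf (cinv c0 y) <-> y 0 ord_max = c) /\ [/\ 0 < a y, (H y)^T = H y,
    eps *: (e *m ((a y)^-1 *: H y)) = (eps * (y 0 ord_max - c)) *: N y,
    N y 0 ord_max = eps &
    (y 0 ord_max = c -> (a y)^-1 *: H y + e^T *m e \in unitmx)]].
Proof.
move=> sA mg pd [Dd Di De] pD; have [c0 [Ac0 c0p flat]] := Di p.
have oO : open (c0 @` cdom c0) by exact: cimg_open.
have imE y : (c0 @` cdom c0) y -> cdom c0 (cinv c0 y) /\ c0 (cinv c0 y) = y.
  by move=> [x cx <-]; rewrite cfunK.
have Oy0 : (c0 @` cdom c0) (c0 p) by exists p.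
pose H y := gs c0 (cinv c0 y); pose d y := \det (H y).
have sH : smooth_on (c0 @` cdom c0) H.
  move=> k; apply/(Ck_mxP _ _ oO) => i j.
  have := dual_smooth pd Ac0 i j k; rewrite /cimage setTI; exact.
have sd : smooth_on (c0 @` cdom c0) d by move=> k; exact: Ck_det oO (sH k).
have detE x : cdom c0 x ->
    coframe_det gs (fun c x => (transition c c0 x)^T) c0 x = \det (gs c0 x).
  by move=> cx; rewrite /coframe_det (transition_id sA)// trmx1 trmx1 mulmx1 mul1mx.
have ne : cdom c0 `&` Dinf !=set0 by exists p.
have det := dual_det pd (cdom_open c0) ne (coordinate_coframe sA Ac0).
have DinfE y : (c0 @` cdom c0) y -> (Dinf (cinv c0 y) <-> d y = 0).
  move=> /imE[cy _]; have [h _] := det c0 _ Ac0 cy cy.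
  by rewrite h detE.
have tangE x v : Dinf x -> cdom c0 x -> tangent A Dinf c0 x v <-> v 0 ord_max = 0.
  move=> Dx cx; rewrite -(De c0 x Ac0 Dx cx) /= (flat_sub _ flat cx).
  by split=> [/eqP|->].
(* A horizontal basis vector at a point of the end is the velocity of a curve that runs inside the
   end, and [d] vanishes along that curve. *)
have hd y : (c0 @` cdom c0) y -> d y = 0 -> forall i, i != ord_max -> 'D_(delta_mx 0 i) d y = 0.
  move=> Oy dy i im; have [cy yE] := imE y Oy.
  have Dx : Dinf (cinv c0 y) by apply/DinfE.
  have : tangent A Dinf c0 (cinv c0 y) (delta_mx 0 i).
    by apply/(tangE _ _ Dx cy); rewrite mxE eqxx/= eq_sym (negbTE im).
  move=> [e [gam [e0 sg gD g0 vE]]].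
  have z0 : - e < 0 < e by rewrite oppr_lt0 e0.
  have cg0 : cdom c0 (gam 0) by rewrite g0.
  have dy0 := smooth_curve_derive sg Ac0 z0 cg0; rewrite vE in dy0.
  have yE0 : (c0 \o gam) 0 = y by rewrite /= g0.
  have dd : differentiable d ((c0 \o gam) 0) by rewrite yE0; exact: (sd 1%N).1.
  have D1 := is_derive_comp_rV dy0 dd.
  have nz : \forall s \near (0 : R), 0 = d ((c0 \o gam) s).
    have n1 : \forall s \near (0 : R), cdom c0 (gam s).
      have cg : gam @ 0 --> gam 0 := sg.1 0 z0.
      by apply: cg; apply: open_nbhs_nbhs; split=> //; exact: cdom_open.
    apply: filterS2 n1 (near_oo z0) => s cs se; symmetry; apply/DinfE; first by exists (gam s).
    by rewrite /= cfunK//; exact: gD.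
  have := is_derive_unique D1 (near_eq_is_derive nz (is_derive_cst (0 : R) (0 : R) (1 : R))).
  rewrite yE0 (bigD1 i)//= big1 => [|k ki]; last by rewrite mxE eqxx (negbTE ki) mul0r.
  by rewrite mxE !eqxx mul1r addr0.
have dy0 : d (c0 p) = 0 by apply/DinfE => //; rewrite cfunK.
have [_ /(_ pD)[v dv]] := det c0 p Ac0 c0p c0p.
have {}dv : 'D_v d (c0 p) != 0.
  rewrite (_ : 'D_v d (c0 p) = 'D_v (fun y => coframe_det gs (fun c x => (transition c c0 x)^T) c0 (cinv c0 y)) (c0 p))//.
  have nO : \forall y \near c0 p, (c0 @` cdom c0) y by exact: open_nbhs_nbhs.
  by apply: near_eq_derive; apply: filterS nO => y /imE[cy _]; rewrite detE.
(* Some directional derivative of [d] is nonzero at the polar point and the horizontal ones vanish,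
   so the last one cannot. *)
have dn : 'D_(delta_mx 0 ord_max) d (c0 p) != 0.
  apply: contra_neq dv => dn0; rewrite derive_partials; last exact: (sd 1%N).1.
  apply: big1 => i _; have [->|im] := eqVneq i ord_max; first by rewrite dn0 mulr0.
  by rewrite hd// mulr0.
have [r r0 rP] := regular_level_set oO Oy0 (sd 2) dy0 hd dn.
have sub : [set y | `|c0 p - y| < r] `<=` c0 @` cdom c0 by move=> y /rP[].
have sHr : smooth_on [set y | `|c0 p - y| < r] H by move=> k; exact: Ck_sub sub (sH k).
have [|||eps [r' [a [N [eps2 /andP[r'0 r'r] sa sN nf]]]]] := polar_normal_form r0 sHr.
- move=> y yr yc; have [Oy dE] := rP y yr; have [cy _] := imE y Oy.
  have nD : ~ Dinf (cinv c0 y) by rewrite DinfE// dE; exact/eqP.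
  apply: (dual_symmetric (Defs.metric_sym mg Ac0 nD cy)).
  apply: (dual_matrixP (metric_nondeg mg Ac0 nD cy) (Defs.metric_sym mg Ac0 nD cy)).
  exact: (dual_off_end pd Ac0 nD cy).
- move=> y yr yc; have [Oy dE] := rP y yr; have [cy _] := imE y Oy.
  have Dx : Dinf (cinv c0 y) by rewrite DinfE// dE.
  apply: radical_annihilator_hyperplane; rewrite (dual_radical pd Ac0 Dx cy).
  by apply/seteqP; split=> w /(tangE _ _ Dx cy).
- by exists v.
have sub' : [set y | `|c0 p - y| < r'] `<=` [set y | `|c0 p - y| < r].
  by move=> y /= /lt_le_trans; apply.
exists c0, eps, r', a, N; split; split=> //.
- by move=> k; exact: Ck_sub sub' (sHr k).
- by move=> y /sub'/sub.
- move=> y yr'; have [Oy dE] := rP y (sub' y yr'); split; first by rewrite DinfE// dE.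
  exact: nf.
Qed.

(** Bootstrap: if [z] is of class [C^k], so is its derivative [N \o z], hence [z] is of class
    [C^(k+1)]. *)
Lemma flow_smooth (R : realType) m (O : set 'rV[R]_m) (N : 'rV[R]_m -> 'rV[R]_m) (a b : R)
    (z : R -> 'rV[R]_m) : open O -> smooth_on O N ->
  (forall t : R, a < t < b -> O (z t) /\ is_derive t 1 z (N (z t))) ->
  smooth_on [set t | a < t < b] z.
Proof.
move=> oO sN zP.
have dz t : a < t < b -> differentiable z t.
  by move=> /zP[_ [d _]]; exact/derivable1_diffP.
elim=> [t /= /dz/differentiable_continuous//|k IH]; split=> [t /dz//|v].
apply: (Ck_ext (f := fun t => v *: N (z t))); first exact: open_oo.
  move=> t tab; have [Ot [_ zE]] := zP t tab.
  by rewrite (deriveE _ (dz t tab)) -zE (deriveE _ (dz t tab)) -linearZ /= /GRing.scale/= mulr1.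
apply: Ck_scale_mx; [exact: open_oo|exact: Ck_cst|].
apply: (Ck_comp_mx (O' := O) (f := N) (g := z)) => //; first exact: open_oo.
by move=> t /zP[].
Qed.

Lemma covector_pullback (R : comPzRingType) m (k : R) (e : 'rV[R]_m) (X Y H Z : 'M[R]_m) :
  X *m Y = 1%:M -> (k *: (e *m X)) *m (Y *m H *m Z) = (k *: (e *m H)) *m Z.
Proof. by move=> E; rewrite -!scalemxAl !mulmxA -(mulmxA e) E mulmx1. Qed.

Lemma covector_pairing (R : comPzRingType) n (k t : R) (u : 'rV[R]_n.+1) (X Y : 'M[R]_n.+1) :
  X *m Y = 1%:M -> k * u 0 ord_max = 1 ->
  (t *: (u *m X)) *m (k *: ((delta_mx 0 ord_max : 'rV[R]_n.+1) *m Y^T))^T = t%:M.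
Proof.
move=> E ku; rewrite linearZ/= trmx_mul trmxK -scalemxAl -scalemxAr -!mulmxA (mulmxA X) E.
rewrite mul1mx trmx_delta -colE scalerA.
by apply/matrixP => i j; rewrite !ord1 !mxE -mulrA ku mulr1.
Qed.

Lemma is_derive_affine (R : realType) (V : normedModType R) (x v : V) (t : R) :
  is_derive t 1 (fun s : R => x + s *: v) v.
Proof.
have dl : is_diff t (fun s : R => x + s *: v) (fun s : R => s *: v).
  have := @is_diffD R R V (fun=> x) (fun s : R => s *: v) (fun=> 0) (fun s : R => s *: v) t.
  by rewrite (_ : (fun=> 0) + _ = fun s : R => s *: v); [apply|apply/funext => s; rewrite /= fctE add0r].
have [dd dE] := dl; split; first exact/derivable1_diffP.
by rewrite deriveE// dE scale1r.
Qed.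

(** * The conformal metric on the slab and its canonical curves *)

Section PolarNormalForm.
Context {R : realType} {M : topologicalType} {n : nat}.
Context (A : set (chart R M n.+1)) (sA : smooth_manifold A) (Dinf : set M).
Context (g gs D : chart R M n.+1 -> M -> 'M[R]_n.+1).
Context (mg : metric_field A (~` Dinf) g) (pd : polar_dual A Dinf g gs).
Context (c0 : chart R M n.+1) (Ac0 : A c0) (W : set 'rV[R]_n.+1) (oW : open W).
Context (Wc0 : W `<=` c0 @` cdom c0).
Context (eps c : R) (a : 'rV[R]_n.+1 -> R) (N : 'rV[R]_n.+1 -> 'rV[R]_n.+1).
Context (eps2 : eps * eps = 1) (sa : smooth_on W a) (sN : smooth_on W N).
Context (cDinf : closed Dinf).
Context (DinfE : forall y, W y -> (Dinf (cinv c0 y) <-> y 0 ord_max = c)).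
Context (a_gt0 : forall y, W y -> 0 < a y).
Context (symH : forall y, W y -> (gs c0 (cinv c0 y))^T = gs c0 (cinv c0 y)).
Context (rowH : forall y, W y ->
  eps *: ((delta_mx 0 ord_max : 'rV[R]_n.+1) *m ((a y)^-1 *: gs c0 (cinv c0 y))) =
  (eps * (y 0 ord_max - c)) *: N y).
Context (Neps : forall y, W y -> N y 0 ord_max = eps).
Context (unitH : forall y, W y -> y 0 ord_max = c ->
  (a y)^-1 *: gs c0 (cinv c0 y) +
  (delta_mx 0 ord_max : 'rV[R]_n.+1)^T *m (delta_mx 0 ord_max : 'rV[R]_n.+1) \in unitmx).

Local Notation e := (delta_mx 0 ord_max : 'rV[R]_n.+1).
Let U : set M := [set x | cdom c0 x /\ W (c0 x)].
Let tau (x : M) : R := eps * (c0 x 0 ord_max - c).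
Let gb (ch : chart R M n.+1) (x : M) := a (c0 x) *: g ch x.
Let Hb (ch : chart R M n.+1) (x : M) := (a (c0 x))^-1 *: gs ch x.

Lemma polar_nbhd_open : open U.
Proof. exact: chart_preimage_open. Qed.

Lemma polar_nbhd_chart y : W y -> U (cinv c0 y) /\ c0 (cinv c0 y) = y.
Proof. by move=> Wy; have [x cx xE] := Wc0 Wy; rewrite -xE cfunK// /U /= xE. Qed.

Lemma polar_sign_neq0 : eps != 0.
Proof. by apply/eqP => e0; move/eqP: eps2; rewrite e0 mul0r eq_sym oner_eq0. Qed.

Lemma polar_end_time0 x : U x -> Dinf x <-> tau x = 0.
Proof.
move=> [cx Wx]; have := DinfE Wx; rewrite cfunK// => ->.
rewrite /tau; split=> [->|/eqP]; first by rewrite subrr mulr0.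
by rewrite mulf_eq0 (negbTE polar_sign_neq0)/= subr_eq0 => /eqP.
Qed.

Lemma conformal_dual_inverse ch x : A ch -> U x -> ~ Dinf x -> cdom ch x -> Hb ch x *m gb ch x = 1%:M.
Proof.
move=> Ach [_ Wx] nD cx; rewrite -scalemxAl -scalemxAr scalerA mulVf ?scale1r; last first.
  by rewrite gt_eqF// a_gt0.
apply: (dual_matrixP (metric_nondeg mg Ach nD cx) (Defs.metric_sym mg Ach nD cx)).
exact: (dual_off_end pd Ach nD cx).
Qed.

Lemma conformal_dual_transform ch x : A ch -> U x -> cdom ch x ->
  Hb ch x = (transition c0 ch x)^T *m Hb c0 x *m transition c0 ch x.
Proof.
move=> Ach [c0x _] cx; rewrite /Hb.
have -> := dual_transform pd Ac0 Ach I c0x cx.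
by rewrite -scalemxAr -scalemxAl.
Qed.

Lemma conformal_dual_sym ch x : A ch -> U x -> cdom ch x -> (Hb ch x)^T = Hb ch x.
Proof.
move=> Ach Ux cx; rewrite conformal_dual_transform// !trmx_mul trmxK mulmxA.
have [c0x Wx] := Ux; suff -> : (Hb c0 x)^T = Hb c0 x by [].
by rewrite /Hb linearZ/=; have := symH Wx; rewrite cfunK// => ->.
Qed.

Lemma polar_time_smooth : smooth_fun A U tau.
Proof.
move=> ch Ach; apply: (@smooth_transport_scalar R M n.+1 A sA c0 ch W U
  (fun y : 'rV[R]_n.+1 => eps * (y 0 ord_max - c)) Ac0 Ach oW polar_nbhd_open) => // k.
apply: CkM => //; first exact: Ck_cst.
by apply: CkB => //; [exact: Ck_coord|exact: Ck_cst].
Qed.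

Lemma polar_time_differential ch x : A ch -> U x -> cdom ch x ->
  (\row_l 'D_(delta_mx 0 l) (tau \o cinv ch) (ch x) : 'rV[R]_n.+1) =
  eps *: (e *m (transition ch c0 x)^T).
Proof.
move=> Ach [c0x _] cx; have dt := transition_diff sA Ach Ac0 cx c0x.
apply/rowP => l; rewrite mxE -[e]trmxK -trmx_mul trmx_delta -colE !mxE.
have /is_derive_mxP/(_ 0 ord_max) d1 := diff_is_derive (delta_mx 0 l) dt.
have d2 := @is_deriveB _ _ _ _ (fun=> c) _ _ _ _ d1 (is_derive_cst _ _ _).
have [_ ->] := @is_deriveZ _ _ _ _ eps _ _ _ d2.
by rewrite subr0 deriveE.
Qed.

(** The left factor is [dtau] in the chart [ch], by [polar_time_differential]. The identity is
    [rowH] transported by the transition matrices: the gradient of [tau] is [tau] times the field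
    [N], also on the end. *)
Lemma polar_time_gradient ch x : A ch -> U x -> cdom ch x ->
  (eps *: (e *m (transition ch c0 x)^T)) *m Hb ch x =
  tau x *: (N (c0 x) *m transition c0 ch x).
Proof.
move=> Ach Ux cx; have [c0x Wx] := Ux; rewrite conformal_dual_transform//.
have E : (transition ch c0 x)^T *m (transition c0 ch x)^T = 1%:M.
  by rewrite -trmx_mul (transition_inv sA Ac0 Ach c0x cx) trmx1.
rewrite (covector_pullback _ _ _ _ E).
have := rowH Wx; rewrite cfunK// => E'.
by rewrite /Hb E' -scalemxAl.
Qed.

Lemma polar_time_gradient_norm ch x : A ch -> U x -> cdom ch x ->
  (eps *: (e *m (transition ch c0 x)^T)) *m Hb ch x *m
  (eps *: (e *m (transition ch c0 x)^T))^T = (tau x)%:M.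
Proof.
move=> Ach Ux cx; have [c0x Wx] := Ux; rewrite polar_time_gradient//.
apply: covector_pairing; first exact: (transition_inv sA Ac0 Ach c0x cx).
by rewrite Neps.
Qed.

Lemma conformal_dual_smooth ch : A ch -> smooth_on (cimage ch U) (fun z => Hb ch (cinv ch z)).
Proof.
move=> Ach k; have oI := cimage_open (c := ch) polar_nbhd_open.
apply: Ck_scale_mx => //.
  apply: CkV => //; first by move=> z /cimageP[[_ Wz] _ _]; rewrite gt_eqF// a_gt0.
  by apply: (smooth_transport_scalar sA Ac0 Ach oW polar_nbhd_open) => //.
apply/(Ck_mxP _ _ oI) => i j; apply: Ck_sub (dual_smooth pd Ach i j k).
by move=> z /cimageP[_ cz <-]; exact: cimage_mem.
Qed.

Lemma polar_nbhd_off_end_open : open (U `&` ~` Dinf).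
Proof. by apply: openI; [exact: polar_nbhd_open|exact: closed_openC]. Qed.

Lemma conformal_metric_smooth ch : A ch ->
  smooth_on (cimage ch (U `&` ~` Dinf)) (fun z => gb ch (cinv ch z)).
Proof.
move=> Ach k; have oI := cimage_open (c := ch) polar_nbhd_off_end_open.
apply: Ck_scale_mx => //.
  have := smooth_transport_scalar sA Ac0 Ach oW polar_nbhd_open (fun _ h => h) sa k.
  by apply: Ck_sub => z /cimageP[[Uz _] cz <-]; exact: cimage_mem.
apply/(Ck_mxP _ _ oI) => i j; apply: Ck_sub (metric_smooth mg Ach i j k).
by move=> z /cimageP[[_ Dz] cz <-]; exact: cimage_mem.
Qed.

Lemma canonical_curve_polar_time al be gam : canonical_curve A Dinf U gb al be gam ->
  forall s, al < s < be -> tau (gam s) = s.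
Proof.
move=> cc.
have sg := canonical_smooth cc; have gU := canonical_in cc.
have ab := canonical_interval cc.
have zW z : W z -> [/\ U (cinv c0 z), cdom c0 (cinv c0 z) & c0 (cinv c0 z) = z].
  by move=> /polar_nbhd_chart[[h1 h2] E].
have WI : W `<=` cimage c0 U by move=> z /zW[h1 h2 E]; apply/cimageP.
apply: (@canonical_curve_time R M n c0 gb gam W (fun y => (a y)^-1 *: gs c0 (cinv c0 y)) N c eps) => //.
- apply: (Ck_ext (f := fun z => Hb c0 (cinv c0 z))) => //.
    by move=> z /zW[_ _ E]; rewrite /Hb E.
  exact: Ck_sub WI (conformal_dual_smooth Ac0 1%N).
- by move=> z Wz; rewrite linearZ/= symH.
- move=> z Wz /eqP; rewrite mulf_eq0 (negbTE polar_sign_neq0)/= subr_eq0 => /eqP; exact: unitH.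
- move=> z Wz t0; have [Uz cz zE] := zW z Wz.
  have nD : ~ Dinf (cinv c0 z) by rewrite (polar_end_time0 Uz) /tau zE; exact/eqP.
  split; first by have := conformal_dual_inverse Ac0 Uz nD cz; rewrite /Hb zE.
  have Iz : cimage c0 (U `&` ~` Dinf) z by apply/cimageP; split.
  exact: (conformal_metric_smooth Ac0 1%N).1.
- apply: Ck_sub (sg.2 c0 Ac0 2%N) => s sab; split=> //; exact: (gU s sab).1.
- move=> s sab; have [h1 h2] := gU s sab; split=> //=; by rewrite cfunK.
- have g0 := gU 0 ab; by have := canonical_start cc; rewrite (polar_end_time0 g0).
- move=> s sab s0; apply/eqP; have gs0 := gU s sab.
  by have := canonical_off_end cc sab s0; rewrite (polar_end_time0 gs0).
- move=> s sab s0; exact: (canonical_pregeodesic cc sab s0 Ac0 (gU s sab).1).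
- move=> s sab s0; exact: (canonical_norm cc sab s0 Ac0 (gU s sab).1).
Qed.

Context (tangentE : forall x v, U x -> Dinf x -> tangent A Dinf c0 x v -> v 0 ord_max = 0).

Lemma integral_curve_canonical al be (z : R -> 'rV[R]_n.+1) : al < 0 < be ->
  (forall t : R, al < t < be -> [/\ W (z t), is_derive t 1 z (N (z t)) &
        eps * (z t 0 ord_max - c) = t]) ->
  canonical_curve A Dinf U gb al be (cinv c0 \o z).
Proof.
move=> ab zP; pose gam := cinv c0 \o z.
have zI t : al < t < be -> [/\ U (gam t), c0 (gam t) = z t & tau (gam t) = t].
  move=> tab; have [Wt dt tt] := zP t tab; have [h1 h2] := polar_nbhd_chart Wt.
  by split=> //; rewrite /tau h2.
have sz : smooth_on [set t : R | al < t < be] z.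
  by apply: (flow_smooth oW sN) => t /zP[].
have sg : smooth_curve A al be gam.
  by apply: smooth_curve_of_chart => // t /zP[/Wc0].
have v0 t : al < t < be -> velocity c0 gam t = N (z t).
  move=> tab; have [Ut zt _] := zI t tab; have [_ dt _] := zP t tab.
  have nz : \forall r \near (t : R), z r = (c0 \o gam) r.
    by apply: filterS (near_oo tab) => r /zI[].
  exact: is_derive_unique (smooth_curve_derive sg Ac0 tab Ut.1) (near_eq_is_derive nz dt).
have vE ch t : A ch -> al < t < be -> cdom ch (gam t) ->
    velocity ch gam t = N (c0 (gam t)) *m transition c0 ch (gam t).
  move=> Ach tab ct; have [Ut zt _] := zI t tab.
  by rewrite (velocity_transition sA sg Ac0 Ach tab Ut.1 ct) v0// zt.
have offD t : al < t < be -> t != 0 -> ~ Dinf (gam t).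
  by move=> tab t0; have [Ut _ tt] := zI t tab; rewrite (polar_end_time0 Ut) tt; exact/eqP.
(* Off the end the velocity is the gradient of [tau] divided by [tau = t], the form of curve treated
   by [gradient_curve_pregeodesic]. *)
have vG ch t : A ch -> al < t < be -> t != 0 -> cdom ch (gam t) ->
    velocity ch gam t = t^-1 *: ((eps *: (e *m (transition ch c0 (gam t))^T)) *m Hb ch (gam t)).
  move=> Ach tab t0 ct; have [Ut _ tt] := zI t tab.
  by rewrite polar_time_gradient// tt scalerA mulVf// scale1r vE.
split=> //.
- by move=> s /zI[].
- by have [Ut _ tt] := zI 0 ab; apply/(polar_end_time0 Ut).
- move=> ch Ach c0g tg; have [Ut zt tt] := zI 0 ab.
  have D0 : Dinf (gam 0) by apply/(polar_end_time0 Ut).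
  have := tangent_transition sA Ach Ac0 c0g Ut.1 tg.
  rewrite -(velocity_transition sA sg Ach Ac0 ab c0g Ut.1) v0// => /(tangentE Ut D0).
  by have [W0 _ _] := zP 0 ab; rewrite Neps// => /eqP; rewrite (negbTE polar_sign_neq0).
- move=> s sab s0 ch Ach cs; exists (- (2 * s)^-1).
  have [Us zs ts] := zI s sab.
  pose O := cimage ch (U `&` ~` Dinf).
  have OI : O `<=` cimage ch U by move=> z' /cimageP[[h1 _] h2 <-]; exact: cimage_mem.
  have Os : O ((ch \o gam) s) by apply: cimage_mem => //; split=> //; exact: offD.
  have oO : open O := cimage_open (c := ch) polar_nbhd_off_end_open.
  have TE : (tau \o cinv ch) ((ch \o gam) s) = s by rewrite /= cfunK.
  have nearJ : \forall r \near s, [/\ al < r < be, r != 0 & cdom ch (gam r)].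
    have n1 := near_oo sab.
    have n2 : \forall r \near s, r != 0 by apply: (near_neq0 (f := fun r => r)) => //; exact: cvg_id.
    have n3 : \forall r \near s, cdom ch (gam r).
      have cg : gam @ s --> gam s := sg.1 s sab.
      by apply: cg; apply: open_nbhs_nbhs; split=> //; exact: cdom_open.
    by move: n1 n2 n3; apply: filterS3.
  rewrite -{2}TE; apply: (gradient_curve_pregeodesic (O := O) (H := fun z => Hb ch (cinv ch z))) => //.
  + exact: Ck_sub OI (polar_time_smooth Ach 2%N).
  + exact: (conformal_metric_smooth Ach 1%N).1.
  + by apply: (conformal_dual_smooth Ach 1%N).1; exact: OI.
  + by move=> z' /cimageP[[h1 h2] h3 _]; exact: conformal_dual_inverse.
  + by move=> z' /cimageP[[h1 h2] h3 _]; exact: conformal_dual_sym.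
  + move=> z' /cimageP[[h1 h2] h3 zE]; have := polar_time_differential Ach h1 h3; rewrite zE => ->.
    by rewrite polar_time_gradient_norm// mxE eqxx.
  + by rewrite TE.
  + by rewrite cfunK.
  + apply: filterS nearJ => r [rab r0 cr]; have [Ur _ tr] := zI r rab.
    have dT := polar_time_differential Ach Ur cr.
    rewrite [(tau \o _) _]/= [X in _ X _]/= dT cfunK// tr -vG//.
    exact: smooth_curve_derive sg Ach rab cr.
  + apply: filterS nearJ => r [rab r0 cr]; have [Ur _ tr] := zI r rab.
    by apply: cimage_mem => //; split=> //; exact: offD.
(* The square of the velocity is [s^-2] times [g*(dtau, dtau) = tau = s]. *)
- move=> s ch sab s0 Ach cs; have [Us _ ts] := zI s sab.
  have E := polar_time_gradient_norm Ach Us cs; rewrite vG//.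
  move: E; set dt := eps *: _; move=> E.
  rewrite -scalemxAl -scalemxAl -(mulmxA dt) conformal_dual_inverse//; last exact: offD.
  rewrite mulmx1 linearZ/= -scalemxAr trmx_mul conformal_dual_sym// mulmxA E ts scalerA !mxE eqxx.
  by rewrite mulr1n -mulrA mulVf// mulr1.
Qed.

Lemma polar_time_level_tangent x v : U x ->
  tangent A [set y | U y /\ tau y = tau x] c0 x v <-> v 0 ord_max = 0.
Proof.
move=> Ux; have [c0x Wx] := Ux; split.
  move=> [r [gam [r0 sg gP g0 vE]]].
  have z0 : - r < 0 < r by rewrite oppr_lt0 r0.
  have cg0 : cdom c0 (gam 0) by rewrite g0.
  have := smooth_curve_derive sg Ac0 z0 cg0; rewrite vE => /is_derive_mxP/(_ 0 ord_max) d1.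
  have nz : \forall s \near (0 : R), c0 x 0 ord_max = (c0 \o gam) s 0 ord_max.
    apply: filterS (near_oo z0) => s /gP[_ /(mulfI polar_sign_neq0)/addIr]; exact.
  exact: is_derive_unique d1 (near_eq_is_derive nz (is_derive_cst (c0 x 0 ord_max) (0 : R) (1 : R))).
(* Conversely, a straight line in a horizontal direction stays in the level set. *)
move=> v0; pose z (r : R) := c0 x + r *: v.
have dz (r : R) : is_derive r 1 z v by exact: is_derive_affine.
have : \forall r \near (0 : R), W (z r).
  have cz : z @ 0 --> z 0.
    by have [d _] := dz 0; apply: differentiable_continuous; exact/derivable1_diffP.
  by apply: cz; rewrite /z scale0r addr0; apply: open_nbhs_nbhs.
move=> /nbhs_ballP[r /= r0 rP].
have zW s : - r < s < r -> W (z s).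
  by move=> sr; apply: rP; rewrite -ball_normE/= sub0r normrN ltr_norml.
exists r, (cinv c0 \o z); split=> //.
- apply: smooth_curve_of_chart => //; last by move=> s /zW/Wc0.
  by apply: (flow_smooth oW (N := fun=> v)) => [k|s /zW]; [exact: Ck_cst|].
- move=> s /zW/polar_nbhd_chart[h1 h2]; split=> //.
  by rewrite /tau h2 /z !mxE v0 mulr0 addr0.
- by rewrite /= /z scale0r addr0 cfunK.
- have z0 : - r < 0 < r by rewrite oppr_lt0 r0.
  rewrite /velocity derive1E; apply: derive_val.
  have nz : \forall s \near (0 : R), z s = (c0 \o (cinv c0 \o z)) s.
    by apply: filterS (near_oo z0) => s /zW/polar_nbhd_chart[_].
  exact: near_eq_is_derive nz (dz 0).
Qed.

End PolarNormalForm.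

Theorem theorem17 (R : realType) (m : nat) (M : topologicalType)
    (A : set (chart R M m)) (Dinf : set M)
    (g D : chart R M m -> M -> 'M[R]_m) :
  (2 <= m)%N ->
  smooth_manifold A ->
  riemann_lorentz A Dinf g ->
  simultaneity_distribution A Dinf D ->
  forall p : M, Dinf p ->
  exists U : set M, [/\ open U, U p &
    exists2 gbar, conformal_class A Dinf U g gbar &
      metric_simultaneity A Dinf U gbar D].
Proof.
case: m A g D => [//|n] A g D _ sA [_ cD mg [gs pd] _] sD p pD.
have [c0 [eps [r [a [N]]]]] := polar_chart sA mg pd sD pD.
set c := c0 p 0 ord_max; set e := delta_mx 0 ord_max; cbv zeta.
set B := [set y | `|c0 p - y| < r].
move=> [[Ac0 c0p flat eps2 r0] [sa sN _ Bc0 nf]].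
have oB : open B by exact: open_norm_ball.
have Bp : B (c0 p) by rewrite /B /= subrr normr0.
have Neps y : B y -> N y 0 ord_max = eps by move=> /nf[_ []].
(* The ball of the normal form is replaced by a slab, because [tau_domain] asks each point to lie on
   a canonical curve contained in the neighbourhood. *)
have [K [r1 [K0 r10 flow]]] := flow_through_slab oB Bp (sN 1%N) Neps eps2.
have r1r1 : 0 < r1 <= r1 by rewrite r10 lexx.
have {flow} [WB flow] := flow r1 r1r1.
set W := slab (c0 p) K r1 in WB flow.
have oW : open W by exact: open_slab.
have Wp : W (c0 p) by rewrite /W /slab /= !subrr !normr0 mulr0 addr0.
have Wc0 : W `<=` c0 @` cdom c0 by move=> y /WB/Bc0.
have saW : smooth_on W a by move=> k; exact: Ck_sub WB (sa k).
have sNW : smooth_on W N by move=> k; exact: Ck_sub WB (sN k).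
have DinfE y : W y -> Dinf (cinv c0 y) <-> y 0 ord_max = c by move=> /WB/nf[].
have a_gt0 y : W y -> 0 < a y by move=> /WB/nf[_ []].
have symH y : W y -> (gs c0 (cinv c0 y))^T = gs c0 (cinv c0 y) by move=> /WB/nf[_ []].
have rowH y : W y -> eps *: (e *m ((a y)^-1 *: gs c0 (cinv c0 y))) =
    (eps * (y 0 ord_max - c)) *: N y by move=> /WB/nf[_ []].
have unitH y : W y -> y 0 ord_max = c ->
    (a y)^-1 *: gs c0 (cinv c0 y) + e^T *m e \in unitmx by move=> /WB/nf[_ []].
have NepsW y : W y -> N y 0 ord_max = eps by move=> /WB/Neps.
have [Dd _ De] := sD.
have tangentE x v : (cdom c0 x /\ W (c0 x)) -> Dinf x -> tangent A Dinf c0 x v -> v 0 ord_max = 0.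
  move=> [cx _] Dx; rewrite -(De c0 x Ac0 Dx cx) /= (flat_sub _ flat cx).
  by move/eqP.
pose U := [set x | cdom c0 x /\ W (c0 x)].
have oU : open U by exact: chart_preimage_open.
exists U; split=> //; exists (fun ch x => a (c0 x) *: g ch x).
  exists (fun x => 2^-1 * ln (a (c0 x))).
    move=> ch Ach.
    apply: (@smooth_transport_scalar R M n.+1 A sA c0 ch W U (fun y => 2^-1 * ln (a y)) Ac0 Ach oW oU) => // k.
    by apply: CkM => //; [exact: Ck_cst|exact: Ck_ln].
  by move=> ch x _ [_ Wx] _ _; rewrite mulrA mulfV ?pnatr_eq0// mul1r lnK// posrE a_gt0.
exists (fun x => eps * (c0 x 0 ord_max - c)).
  split.
  - exact: polar_time_smooth.
  - exact: (canonical_curve_polar_time sA mg pd Ac0 oW Wc0 eps2 saW sNW cD DinfE a_gt0 symH rowH NepsW unitH).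
  - move=> x [cx Wx]; have [al [be [z [s [ab sab zs zP]]]]] := flow _ Wx.
    exists al, be, (cinv c0 \o z), s; split=> //; last by rewrite /= zs cfunK.
    exact: (integral_curve_canonical sA mg pd Ac0 oW Wc0 eps2 saW sNW cD DinfE a_gt0 symH rowH NepsW tangentE ab).
(* Both the distribution and the tangent vectors transform by the transition matrices, so the
   comparison is made in the flat chart, where each consists of the vectors with last entry 0. *)
move=> ch x Ach Ux cx; have [c0x Wx] := Ux.
have lt v := polar_time_level_tangent sA Ac0 oW Wc0 c eps2 v Ux.
have DT := distribution_transform Dd Ach Ac0 cx c0x.
have DT' := distribution_transform Dd Ac0 Ach c0x cx.
apply/seteqP; split=> v /=.
  move=> vD; rewrite -[v]mulmx1 -(transition_inv sA Ach Ac0 cx c0x) mulmxA.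
  apply: tangent_transition => //; apply/lt/eqP.
  by rewrite -(flat_sub _ flat c0x) (eqmxP DT) submxMr.
move=> /(tangent_transition sA Ach Ac0 cx c0x)/lt/eqP.
rewrite -(flat_sub _ flat c0x) => vD.
by rewrite -[v]mulmx1 -(transition_inv sA Ach Ac0 cx c0x) mulmxA (eqmxP DT') submxMr.
Qed.
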